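(* There exist functions $q,p\in C^2([0,L])$ and constants $\delta_q>0$, $\delta_p\in(0,\delta_q/2)$ satisfying the requirements (Q) and (P) of the context. Moreover, for every such choice of $q,p,\delta_q,\delta_p$ and every $\varepsilon_1$ with $$0<\varepsilon_1<\min\left\{\frac{1}{2C_3},\ \left(\|q\|_{L^\infty}+\frac{L}{\pi}\|p\|_{L^\infty}\right)^{-1}\right\},$$ the functional $V:H^1_0(0,L)\times L^2(0,L)\to\mathbb{R}$ defined by $$V:=E+\varepsilon_1 M+C_0E_0,\qquad C_0:=\frac{\varepsilon_1C_1}{a_{\min}},$$ is a strict Lyapunov function for the damped wave equation in $H^1_0(0,L)\times L^2(0,L)$, in the following sense. (i) There exists $C_5>0$ such that, for all $(f,g)\in H^1_0(0,L)\times L^2(0,L)$, $$\delta_M\,E(f,g)\le V(f,g)\le C_5\,E(f,g),\qquad \delta_M:=1-\varepsilon_1\left(\|q\|_{L^\infty}+\frac{L}{\pi}\|p\|_{L^\infty}\right)>0.$$ (ii) For any $C_5>0$ such that $V\le C_5E$ on $H^1_0(0,L)\times L^2(0,L)$, for all $(y_0,y_1)\in H^1_0(0,L)\times L^2(0,L)$, if $y$ is the weak solution with initial data $(y_0,y_1)$ and $V(t):=V(y(t),y_t(t))$, then $$\dot V\le-\delta_1\int_0^L y_x^2\,dx-\delta_2\int_0^L y_t^2\,dx\le-\gamma V\quad\text{in }\mathcal{D}'(0,+\infty),$$ where $$\delta_1:=\frac{\varepsilon_1\delta_p}{2},\qquad \delta_2:=\min\left\{\frac{a_{\min}}{2},\frac{\varepsilon_1\delta_q}{2}\right\},\qquad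 \gamma:=\frac{2\min\{\delta_1,\delta_2\}}{C_5}.$$
   Context: Standing assumptions. $L>0$; $a\in L^\infty(0,L)$ with $a\ge0$ almost everywhere; there are $0\le x_0<x_1\le L$ and $a_{\min}\in(0,+\infty)$ with $a(x)\ge a_{\min}$ for almost every $x\in(x_0,x_1)$. Equation. The damped wave equation is $$y_{tt}-y_{xx}+a(x)y_t=0\ \ (t\ge0,\ x\in(0,L)),\qquad y(t,0)=y(t,L)=0,\qquad y(0)=y_0,\ y_t(0)=y_1,$$ where $y(t)=y(t,\cdot)$. For $(y_0,y_1)\in H^1_0(0,L)\times L^2(0,L)$, a weak solution is a function $y\in C^0([0,+\infty);H^1_0(0,L))\cap C^1([0,+\infty);L^2(0,L))$ with $y_{tt}\in C^0([0,+\infty);H^{-1}(0,L))$, $y(0)=y_0$, $y_t(0)=y_1$, such that for every $v\in H^1_0(0,L)$ and every $t\ge0$, $$\langle y_{tt}(t),v\rangle_{H^{-1},H^1_0}+\int_0^Ly_x(t)v_x\,dx+\int_0^La(x)y_t(t)v\,dx=0.$$ It is classical that there is a unique weak solution for each such $(y_0,y_1)$, and that for every $T>0$ it depends continuously on $(y_0,y_1)$ as an element of $C^0([0,T];H^1_0(0,L))\cap C^1([0,T];L^2(0,L))$. If moreover $y_0\in H^2(0,L)\cap H^1_0(0,L)$ and $y_1\in H^1_0(0,L)$, then $y\in C^0([0,+\infty);H^2(0,L)\cap H^1_0(0,L))\cap C^1([0,+\infty);H^1_0(0,L))\cap C^2([0,+\infty);L^2(0,L))$. Requirements on $q$ and $p$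 (both in $C^2([0,L])$): (Q) $q(0)\ge0$, $q(L)\le0$, $\delta_q>0$, and $q'(x)\ge\delta_q$ for all $x\in[0,x_0]\cup[x_1,L]$. (P) $p(x)=0$ for all $x\in[0,x_0]\cup[x_1,L]$, $\delta_p\in(0,\delta_q/2)$, and $p(x)+\frac12q'(x)\ge\delta_p$ for all $x\in[x_0,x_1]$. Functionals, for $(f,g)\in H^1_0(0,L)\times L^2(0,L)$: $$E(f,g):=\frac12\int_0^L(f_x^2+g^2)\,dx,\qquad M(f,g):=\int_0^Lp(x)fg\,dx+\int_0^Lq(x)gf_x\,dx,$$ $$E_0(f,g):=E(\mathcal{L}(f,g),f),$$ where $h=\mathcal{L}(f,g)\in H^1_0(0,L)$ is the unique solution of $h_{xx}=a(x)f+g$ in $H^{-1}(0,L)$. Constants: $$C_1:=\frac12\left(1+\|p''\|_{L^\infty}\right),\qquad C_2(\eta):=\|a\|_{L^\infty}\left(\frac{\|q\|_{L^\infty}^2}{4\eta}+\frac{\|p\|_{L^\infty}^2}{2}\right)\ (\eta>0),$$ $$K:=\max_{x\in[0,L]}\left(p(x)-\frac12q'(x)\right)_+,\qquad C_3:=\frac{K}{a_{\min}}+C_2(\delta_p/2),$$ where $(s)_+=\max\{s,0\}$. $\mathcal{D}'(0,+\infty)$ is the space of distributions on $(0,+\infty)$; an inequality in $\mathcal{D}'(0,+\infty)$ means that it holds after testing against every nonnegative $\varphi\in C_c^\infty(0,+\infty)$, and $\dot V$ is the distributional derivative of the continuous function $t\mapsto V(t)$. *)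

(* Defs.v *)
From HB Require Import structures.
From mathcomp Require Import all_boot all_order all_algebra.
From mathcomp Require Import all_classical all_reals all_analysis.

Set Implicit Arguments.
Unset Strict Implicit.
Unset Printing Implicit Defensive.

Import Order.TTheory GRing.Theory Num.Theory.
Import numFieldNormedType.Exports.

Local Open Scope classical_set_scope.
Local Open Scope ring_scope.

(* Elements of the function spaces on (0,L) are represented by functions R -> R;
   only the values on ]0,L[, up to a null set, matter. *)

Section function_spaces.
Context {R : realType}.
Implicit Types (L : R) (U : set R) (f g h v : R -> R).

Local Notation leb := (@lebesgue_measure R).
Local Notation dom L := (`]0, L[%classic : set R).

Definition L2 L f : Prop := f \_ (dom L) \in Lfun leb 2%:E.
Definition L2norm L f : R := fine ('N[leb]_(2%:E)[EFin \o (f \_ (dom L))])%E.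

Definition Linf L f : Prop := f \_ (dom L) \in Lfun leb +oo%E.
Definition Linfnorm L f : R := fine ('N[leb]_(+oo)[EFin \o (f \_ (dom L))])%E.

Definition test_fun U (phi : R -> R) : Prop :=
  [/\ forall n x, derivable (phi^`(n))%classic x 1,
      compact (closure [set x | phi x != 0]) &
      closure [set x | phi x != 0] `<=` U].

Definition is_wderiv L f g : Prop :=
  forall phi, test_fun (dom L) phi ->
    \int[leb]_(x in dom L) (f x * (phi^`())%classic x)
      = - \int[leb]_(x in dom L) (g x * phi x).

(* The weak derivative in L^2; unspecified (0) when there is none. *)
Definition wderiv L f : R -> R :=
  xget (fun=> 0) [set g | L2 L g /\ is_wderiv L f g].

Definition H1 L f : Prop := L2 L f /\ exists g, L2 L g /\ is_wderiv L f g.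
Definition H1norm L f : R :=
  Num.sqrt (L2norm L f ^+ 2 + L2norm L (wderiv L f) ^+ 2).

(* The closure of C_c^oo(0,L) in H^1(0,L). *)
Definition H10 L f : Prop :=
  H1 L f /\ forall e : R, 0 < e ->
    exists phi, test_fun (dom L) phi /\ H1norm L (f - phi) < e.

(* Continuous linear forms on H^1_0(0,L). A bounded linear form takes the same
   value on two representatives of one class. *)
Definition Hm1 L (F : (R -> R) -> R) : Prop :=
  (forall (c : R) u v, H10 L u -> H10 L v -> F (c *: u + v) = c * F u + F v) /\
  exists C : R, forall v, H10 L v -> `|F v| <= C * H1norm L v.
Definition Hm1norm L (F : (R -> R) -> R) : R :=
  sup [set `|F v| | v in [set v | H10 L v /\ H1norm L v <= 1]].
Definition Hm1_eq L (F G : (R -> R) -> R) : Prop :=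
  forall v, H10 L v -> F v = G v.

(* The canonical embedding of L^2 into H^{-1}. *)
Definition Hm1_of_L2 L g : (R -> R) -> R :=
  fun v => \int[leb]_(x in dom L) (g x * v x).

(* h_xx as an element of H^{-1}, for h in H^1. *)
Definition Hm1_dxx L h : (R -> R) -> R :=
  fun v => - \int[leb]_(x in dom L) (wderiv L h x * wderiv L v x).

(* Curves on [0,+oo) with values in X, for the topology of the (semi)norm N;
   limits at time 0 are one-sided. *)
Definition cont_curve (X : lmodType R) (N : X -> R) (u : R -> X) : Prop :=
  forall t : R, 0 <= t ->
    N (u s - u t) @[s --> within `[0, +oo[ (nbhs t)] --> (0 : R).
Definition diff_curve (X : lmodType R) (N : X -> R) (u u' : R -> X) : Prop :=
  forall t : R, 0 <= t ->
    N ((s - t)^-1 *: (u s - u t) - u' t) @[s --> within `[0, +oo[ t^'] --> (0 : R).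

Definition ae_on L (P : R -> Prop) : Prop := {ae leb, forall x, dom L x -> P x}.

(* yt is y_t; the witness ytt is y_tt, the H^{-1}-valued derivative of y_t. *)
Definition weak_solution L (a y0 y1 : R -> R) (y yt : R -> R -> R) : Prop :=
  [/\ (forall t, 0 <= t -> H10 L (y t)) /\ cont_curve (H1norm L) y,
      (forall t, 0 <= t -> L2 L (yt t)) /\ cont_curve (L2norm L) yt,
      diff_curve (L2norm L) y yt,
      ae_on L (fun x => y 0 x = y0 x) /\ ae_on L (fun x => yt 0 x = y1 x) &
      exists ytt : R -> (R -> R) -> R,
        [/\ forall t, 0 <= t -> Hm1 L (ytt t),
            cont_curve (Hm1norm L) ytt,
            diff_curve (Hm1norm L) (fun t => Hm1_of_L2 L (yt t)) ytt &
            forall v t, H10 L v -> 0 <= t ->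
              ytt t v
              + \int[leb]_(x in dom L) (wderiv L (y t) x * wderiv L v x)
              + \int[leb]_(x in dom L) (a x * yt t x * v x) = 0]].

End function_spaces.

Section C2_functions.
Context {R : realType}.
Implicit Types (L x : R) (f : R -> R).

(* Differentiation on the closed interval [0,L], one-sided at 0 and L. *)
Definition dquotI L f x : R -> R := fun z => (z - x)^-1 * (f z - f x).
Definition derivableI L f : Prop :=
  forall x, x \in `[0, L] -> cvg (dquotI L f x @ within `[0, L] x^').
Definition derivI L f : R -> R :=
  fun x => lim (dquotI L f x @ within `[0, L] x^').

Definition C2I L f : Prop :=
  [/\ derivableI L f, derivableI L (derivI L f) &
      {within `[0, L], continuous (derivI L (derivI L f))}].

Definition reqQ L (x0 x1 : R) (q : R -> R) (dq : R) : Prop :=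
  [/\ 0 <= q 0, q L <= 0, 0 < dq &
      forall x, x \in `[0, x0] \/ x \in `[x1, L] -> dq <= derivI L q x].

Definition reqP L (x0 x1 : R) (q p : R -> R) (dq dp : R) : Prop :=
  [/\ forall x, x \in `[0, x0] \/ x \in `[x1, L] -> p x = 0,
      0 < dp < dq / 2 &
      forall x, x \in `[x0, x1] -> dp <= p x + 2^-1 * derivI L q x].

Definition admissible L (x0 x1 : R) (q p : R -> R) (dq dp : R) : Prop :=
  [/\ C2I L q, C2I L p, reqQ L x0 x1 q dq & reqP L x0 x1 q p dq dp].

End C2_functions.

Section functionals.
Context {R : realType}.
Implicit Types (L : R) (a q p f g : R -> R).

Local Notation leb := (@lebesgue_measure R).
Local Notation dom L := (`]0, L[%classic : set R).

Definition energy L f g : R :=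
  2^-1 * \int[leb]_(x in dom L) (wderiv L f x ^+ 2 + g x ^+ 2).

Definition Mfun L q p f g : R :=
  \int[leb]_(x in dom L) (p x * f x * g x)
  + \int[leb]_(x in dom L) (q x * g x * wderiv L f x).

(* The solution h in H^1_0 of h_xx = a f + g in H^{-1}. *)
Definition calL L a f g : R -> R :=
  xget (fun=> 0) [set h | H10 L h /\
    Hm1_eq L (Hm1_dxx L h) (Hm1_of_L2 L (fun x => a x * f x + g x))].

Definition energy0 L a f g : R := energy L (calL L a f g) f.

Definition C1c L p : R := 2^-1 * (1 + Linfnorm L (derivI L (derivI L p))).

Definition C2c L a q p (eta : R) : R :=
  Linfnorm L a * (Linfnorm L q ^+ 2 / (4 * eta) + Linfnorm L p ^+ 2 / 2).

(* The supremum is a maximum: the function is continuous on [0,L]. *)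
Definition Kc L q p : R :=
  sup [set Num.max (p x - 2^-1 * derivI L q x) 0 | x in `[0, L]].

Definition C3c L a q p (amin dp : R) : R :=
  Kc L q p / amin + C2c L a q p (dp / 2).

Definition C0c L p (amin e1 : R) : R := e1 * C1c L p / amin.

Definition lyapunov L a q p (amin e1 : R) f g : R :=
  energy L f g + e1 * Mfun L q p f g + C0c L p amin e1 * energy0 L a f g.

Definition qpnorm L q p : R := Linfnorm L q + L / pi * Linfnorm L p.

End functionals.

Section distributions.
Context {R : realType}.
Local Notation leb := (@lebesgue_measure R).

(* Distributions on (0,+oo) are given by their action on test functions. *)
Definition dist_of (w : R -> R) : (R -> R) -> R :=
  fun phi => \int[leb]_(t in `]0, +oo[) (w t * phi t).
Definition dist_deriv (T : (R -> R) -> R) : (R -> R) -> R :=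
  fun phi => - T (phi^`())%classic.
Definition dist_le (S T : (R -> R) -> R) : Prop :=
  forall phi, test_fun `]0, +oo[ phi -> (forall t, 0 <= phi t) ->
    S phi <= T phi.

End distributions.

(* Main.v *)
Require Import Defs.
From HB Require Import structures.
From mathcomp Require Import all_boot all_order all_algebra.
From mathcomp Require Import all_classical all_reals all_analysis.
From mathcomp Require Import measurable_realfun ess_sup_inf ring lra.

Set Implicit Arguments.
Unset Strict Implicit.
Unset Printing Implicit Defensive.

Import Order.TTheory GRing.Theory Num.Theory.
Import numFieldNormedType.Exports.

Local Open Scope classical_set_scope.
Local Open Scope ring_scope.

(* For a weak solution y, the curve h(t) = calL(y(t), y_t(t)) is differentiable in H^1_0 with
   derivative y(t): formally h_xx = a y + y_t, so that (h_t)_xx = a y_t + y_tt = y_xx. Hence the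
   difference quotients y_k(t) = (h(t + k) - h(t)) / k have the H^1_0-valued time derivative
   z_k(t) = (y(t + k) - y(t)) / k and solve the damped wave equation in the strong sense, so that
   t |-> V(y_k, z_k) is differentiable. Testing the equation with p y_k and q (y_k)_x, with the
   boundary terms signed by q(0) >= 0 >= q(L), bounds its derivative by the integral of a pointwise
   quadratic form, in which the derivative - \int a y_k^2 of E_0 absorbs the lower order terms where
   a >= amin. As k -> 0, y_k -> y in H^1_0 and z_k -> y_t in L^2 for each t > 0, boundedly on compact
   intervals of time by the mean value inequality, and dominated convergence passes to the limit in
   the inequality tested against a fixed function. *)

(** * The space L^2(0,L) *)

(** A weak solution is too rough for the multiplier computation: testing with q y_x requires y_x to
    be absolutely continuous in x and y_t to lie in H^1_0, and neither is given. The difference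
    quotients of h have both properties. Passing to h gains one antiderivative in time, so y_k
    approximates y itself; its time derivative z_k is a quotient of y and hence lies in H^1_0; and
    its second space derivative is a z_k plus the quotient of y_t, an element of L^2. The derivation
    of V is therefore legitimate for each fixed k, and the limit only uses the continuity of V and
    of the dissipation on H^1_0 x L^2.

    Functions are representatives and weak derivatives are chosen by [xget], so identities between
    derivatives hold only up to [L2eq]. Everything about H^1_0 goes through one characterization: up
    to [L2eq], its elements are the primitives of L^2 functions of mean zero. It supplies the
    boundary values and the integrations by parts. The L^2 theory is written for an arbitrary length
    because it serves again for the time variable, on an interval ]0, B[ that contains the support
    of the test function. *)

Section L2_space.
Context {R : realType}.
Variable L : R.
Local Notation mu := (@lebesgue_measure R).
Local Notation D := (`]0, L[%classic : set R).
Implicit Types f g h : R -> R.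

Definition ip f g : R := \int[mu]_(x in D) (f x * g x).

Lemma measurable_dom : measurable (D : set (measurableTypeR R)).
Proof. exact: measurable_itv. Qed.
Hint Resolve measurable_dom : core.

Lemma dom_ltey : (mu D < +oo)%E.
Proof. by rewrite lebesgue_measure_itv; case: ifP => // _; rewrite -EFinB ltry. Qed.
Hint Resolve dom_ltey : core.

(** The definition of [L2] concerns the extension by zero to R and a power with real exponent; this
    form involves only ]0, L[ and the square. *)
Lemma L2P f : L2 L f <->
  measurable_fun D f /\ mu.-integrable D (EFin \o (fun x => f x ^+ 2)).
Proof.
have fE : (fun x => ((f \_ D) x) ^+ 2) = (fun x => f x ^+ 2) \_ D.
  by apply/funext => x; rewrite /patch; case: ifP => // _; rewrite expr0n.
have iE (g : R -> R) : mu.-integrable setT (EFin \o (g \_ D)) <->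
    mu.-integrable D (EFin \o g).
  rewrite -restrict_EFin; have := integrable_restrict mu measurable_dom measurableT (EFin \o g).
  by rewrite setTI => H; split => /H.
split.
- move=> Lf; split.
    apply/(measurable_restrictT _ measurable_dom).
    by move: Lf; rewrite /L2 inE => /andP[+ _]; rewrite inE.
  by apply/iE; rewrite -fE; exact: Lfun2_integrable_sqr.
- move=> [mf /iE]; rewrite -fE => if2.
  rewrite /L2 inE; apply/andP; split.
    by rewrite inE /=; apply/(measurable_restrictT _ measurable_dom).
  rewrite inE /= /finite_norm unlock; apply: poweR_lty.
  move/integrableP : if2 => [_]; apply: le_lt_trans.
  apply: ge0_le_integral => //.
  + by move=> x _; rewrite poweR_ge0.
  + apply: (measurableT_comp (measurable_poweR _)); apply: measurableT_comp => //.
    by apply/measurable_EFinP/(measurable_restrictT _ measurable_dom).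
  + apply: measurableT_comp => //; apply/measurable_EFinP; apply: measurable_funX.
    by apply/(measurable_restrictT _ measurable_dom).
  + by move=> x _ /=; rewrite lee_fin powR_mulrn// normrX.
Qed.

Lemma L2_measurable f : L2 L f -> measurable_fun D f.
Proof. by case/L2P. Qed.

Lemma L2_mul_integrable f g : L2 L f -> L2 L g ->
  mu.-integrable D (EFin \o (fun x => f x * g x)).
Proof.
move=> /L2P[mf if2] /L2P[mg ig2].
have i2 : mu.-integrable D (EFin \o (fun x => f x ^+ 2 + g x ^+ 2)).
  by have := integrableD measurable_dom if2 ig2; apply: eq_integrable.
apply: (le_integrable measurable_dom _ _ i2) => //=.
  by apply/measurable_EFinP; exact: measurable_funM.
move=> x _; rewrite lee_fin [leRHS]ger0_norm ?addr_ge0 ?sqr_ge0//.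
rewrite ler_norml; apply/andP; split; nra.
Qed.

Lemma L2_add f g : L2 L f -> L2 L g -> L2 L (f + g).
Proof.
rewrite /L2 => Lf Lg.
have -> : (f + g) \_ D = f \_ D + g \_ D.
  apply/funext => x; change ((f \_ D + g \_ D) x) with ((f \_ D) x + (g \_ D) x).
  by rewrite /patch; case: ifP => //= _; rewrite addr0.
have p1 : (1 <= (2 : R)%:E :> \bar R)%E by rewrite lee_fin ler1n.
exact: (Lfun_addr_closed mu p1).2.
Qed.

Lemma L2_scale c f : L2 L f -> L2 L (c *: f).
Proof.
rewrite /L2 => Lf.
have -> : (c *: f) \_ D = (c \o* (f \_ D)).
  by apply/funext => x; rewrite /= /patch /=; case: ifP; rewrite ?mulr0 ?mul0r// mulrC.
by apply: Lfun_scale => //; rewrite ler1n.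
Qed.

Lemma L2_opp f : L2 L f -> L2 L (- f).
Proof. by rewrite -scaleN1r; exact: L2_scale. Qed.

Lemma L2_sub f g : L2 L f -> L2 L g -> L2 L (f - g).
Proof. by move=> Lf Lg; apply: L2_add => //; exact: L2_opp. Qed.

Lemma L2_bounded f (M : R) : measurable_fun D f -> (forall x, D x -> `|f x| <= M) ->
  L2 L f.
Proof.
move=> mf fM; apply/L2P; split => //.
apply: measurable_bounded_integrable => //; first exact: measurable_funX.
exists (M ^+ 2); split; first by rewrite num_real.
move=> y My x Dx; apply: (le_trans _ (ltW My)).
by rewrite normrX ler_sqr ?nnegrE// ?(le_trans _ (fM x Dx))//; exact: fM.
Qed.

Lemma L2_cst c : L2 L (cst c).
Proof. by apply: (@L2_bounded _ `|c|). Qed.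

Lemma L2_0 : L2 L 0.
Proof. exact: L2_cst. Qed.

Lemma ipC f g : ip f g = ip g f.
Proof. by apply: eq_Rintegral => x _; rewrite mulrC. Qed.

Lemma ipDl f g h : L2 L f -> L2 L g -> L2 L h -> ip (f + g) h = ip f h + ip g h.
Proof.
move=> Lf Lg Lh; rewrite /ip -RintegralD//; last 2 first.
- exact: L2_mul_integrable.
- exact: L2_mul_integrable.
by apply: eq_Rintegral => x _; rewrite mulrDl.
Qed.

Lemma ipZl c f g : L2 L f -> L2 L g -> ip (c *: f) g = c * ip f g.
Proof.
move=> Lf Lg; rewrite /ip -RintegralZl//; last exact: L2_mul_integrable.
by apply: eq_Rintegral => x _; rewrite mulrA.
Qed.

Lemma ipNl f g : L2 L f -> L2 L g -> ip (- f) g = - ip f g.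
Proof. by move=> Lf Lg; rewrite -scaleN1r ipZl// mulN1r. Qed.

Lemma ipBl f g h : L2 L f -> L2 L g -> L2 L h -> ip (f - g) h = ip f h - ip g h.
Proof. by move=> Lf Lg Lh; rewrite ipDl ?ipNl//; exact: L2_opp. Qed.

Lemma ipDr f g h : L2 L f -> L2 L g -> L2 L h -> ip h (f + g) = ip h f + ip h g.
Proof. by move=> Lf Lg Lh; rewrite ipC ipDl// !(ipC h). Qed.
Lemma ipZr c f g : L2 L f -> L2 L g -> ip g (c *: f) = c * ip g f.
Proof. by move=> Lf Lg; rewrite ipC ipZl// ipC. Qed.
Lemma ipBr f g h : L2 L f -> L2 L g -> L2 L h -> ip h (f - g) = ip h f - ip h g.
Proof. by move=> Lf Lg Lh; rewrite ipC ipBl// !(ipC h). Qed.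

Lemma ip_ge0 f : 0 <= ip f f.
Proof. by apply: Rintegral_ge0 => x _; rewrite -expr2 sqr_ge0. Qed.

Lemma L2normE f : L2norm L f = Num.sqrt (ip f f).
Proof.
rewrite /L2norm unlock.
have -> : (\int[mu]_x `|(EFin \o f \_ D) x| `^ 2 = \int[mu]_(x in D) (f x * f x)%:E)%E.
  rewrite [RHS]integral_mkcond; apply: eq_integral => x _ /=.
  rewrite powR_mulrn// real_normK ?num_real//.
  by rewrite /patch; case: ifP => // _; rewrite expr0n.
rewrite /ip /Rintegral; set I := (\int[mu]_(x in D) _)%E.
have : (0 <= I)%E by apply: integral_ge0 => x _; rewrite lee_fin -expr2 sqr_ge0.
case: I => [r||]//=; first by rewrite lee_fin => r0; rewrite powR12_sqrt.
(* Infinite integral: [fine] sends both sides to 0, so the formula holds for every f. *)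
by rewrite sqrtr0 invr_eq0 gt_eqF.
Qed.

Lemma L2norm_ge0 f : 0 <= L2norm L f.
Proof. by rewrite L2normE sqrtr_ge0. Qed.

Lemma L2norm_sqr f : L2norm L f ^+ 2 = ip f f.
Proof. by rewrite L2normE sqr_sqrtr// ip_ge0. Qed.

Lemma ip_sqr f : ip f f = \int[mu]_(x in D) (f x ^+ 2).
Proof. by []. Qed.

Lemma cauchy_schwarz f g : L2 L f -> L2 L g -> `|ip f g| <= L2norm L f * L2norm L g.
Proof.
move=> Lf Lg; rewrite -(@ler_pXn2r _ 2)// ?nnegrE ?mulr_ge0 ?L2norm_ge0//.
rewrite exprMn !L2norm_sqr real_normK ?num_real//.
have H t : 0 <= t ^+ 2 * ip f f - 2 * t * ip f g + ip g g.
  have := ip_ge0 (t *: f - g).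
  have Ltf := L2_scale t Lf.
  rewrite ipBl ?ipBr//; last exact: L2_sub.
  rewrite !ipZl ?ipZr// (ipC g f); nra.
have := ip_ge0 f; have := ip_ge0 g; rewrite le_eqVlt => /predU1P[g0|g0].
  rewrite le_eqVlt => /predU1P[f0|f0].
    by move: (H 1) (H (-1)); rewrite -g0 -f0; nra.
  have := H (ip f g / ip f f); rewrite -g0; move: f0; set a := ip f f; set b := ip f g => f0.
  have -> : (b / a) ^+ 2 * a - 2 * (b / a) * b + 0 = - (b ^+ 2 / a).
    by field; rewrite gt_eqF.
  by rewrite oppr_ge0 mulr0 pmulr_lle0// invr_gt0.
rewrite le_eqVlt => /predU1P[f0|f0].
  (* When <f, f> = 0 the polynomial is affine in t; at this t it equals - <g, g> < 0, a
     contradiction unless <f, g> = 0. *)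
  have := H (ip g g / ip f g); rewrite -f0; move: g0; set c := ip g g; set b := ip f g => c0.
  have [->|b0] := eqVneq b 0; first by rewrite expr0n mul0r.
  have -> : (c / b) ^+ 2 * 0 - 2 * (c / b) * b + c = - c by field.
  lra.
have := H (ip f g / ip f f); move: f0; set a := ip f f; set b := ip f g => a0.
have -> : (b / a) ^+ 2 * a - 2 * (b / a) * b + ip g g = ip g g - b ^+ 2 / a.
  by field; rewrite gt_eqF.
by rewrite subr_ge0 ler_pdivrMr// mulrC.
Qed.

Lemma L2normZ c f : L2 L f -> L2norm L (c *: f) = `|c| * L2norm L f.
Proof.
move=> Lf; rewrite !L2normE ipZl ?ipZr//; last exact: L2_scale.
by rewrite mulrA -expr2 sqrtrM ?sqr_ge0// sqrtr_sqr.
Qed.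

Lemma L2normN f : L2 L f -> L2norm L (- f) = L2norm L f.
Proof. by move=> Lf; rewrite -scaleN1r L2normZ// normrN1 mul1r. Qed.

Lemma L2norm0 : L2norm L 0 = 0.
Proof. by rewrite -(scale0r (0 : R -> R)) L2normZ ?normr0 ?mul0r//; exact: L2_0. Qed.

Lemma L2norm_triangle f g : L2 L f -> L2 L g ->
  L2norm L (f + g) <= L2norm L f + L2norm L g.
Proof.
move=> Lf Lg; rewrite -(@ler_pXn2r _ 2)// ?nnegrE ?addr_ge0 ?L2norm_ge0//.
rewrite sqrrD !L2norm_sqr ipDl ?ipDr// ?(ipC g f); last exact: L2_add.
by have := cauchy_schwarz Lf Lg; rewrite ler_norml => /andP[_]; lra.
Qed.

Lemma L2norm_distC f g : L2 L f -> L2 L g -> L2norm L (f - g) = L2norm L (g - f).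
Proof. by move=> Lf Lg; rewrite -L2normN ?opprB//; exact: L2_sub. Qed.

Lemma L2norm_sub_triangle h f g : L2 L f -> L2 L g -> L2 L h ->
  L2norm L (f - g) <= L2norm L (f - h) + L2norm L (h - g).
Proof.
move=> Lf Lg Lh.
have -> : f - g = (f - h) + (h - g) by rewrite addrA subrK.
by apply: L2norm_triangle; exact: L2_sub.
Qed.

Lemma L2norm_le f g : L2 L f -> L2 L g -> (forall x, D x -> `|f x| <= `|g x|) ->
  L2norm L f <= L2norm L g.
Proof.
move=> Lf Lg fg; rewrite !L2normE ler_wsqrtr//; apply: le_Rintegral => //.
- exact: L2_mul_integrable.
- exact: L2_mul_integrable.
by move=> x /fg; rewrite -!expr2 -ler_sqr ?nnegrE// !real_normK ?num_real.
Qed.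

Lemma L2norm_cst c : 0 <= L -> L2norm L (cst c) = `|c| * Num.sqrt L.
Proof.
move=> L0; rewrite L2normE /ip (Rintegral_cst _ measurable_dom (c * c)).
have -> : fine (mu D) = L.
  rewrite lebesgue_measure_itv/= lte_fin; case: ltP => [_|]; first by rewrite /= subr0.
  by move=> L0'; apply/eqP; rewrite eq_le L0 L0'.
by rewrite -expr2 sqrtrM ?sqr_ge0// sqrtr_sqr.
Qed.

Lemma eq_ip f f' g g' : {in D, f =1 f'} -> {in D, g =1 g'} -> ip f g = ip f' g'.
Proof. by move=> ff gg; apply: eq_Rintegral => x xD; rewrite ff// gg. Qed.

Lemma eq_L2 f g : {in D, f =1 g} -> L2 L f -> L2 L g.
Proof.
move=> fg /L2P[mf if2]; apply/L2P; split; first exact: (eq_measurable_fun _ fg).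
by apply: eq_integrable if2 => // x xD /=; rewrite fg.
Qed.

Lemma eq_L2norm f g : {in D, f =1 g} -> L2norm L f = L2norm L g.
Proof. by move=> fg; rewrite !L2normE (eq_ip fg fg). Qed.

Lemma eq_ip_L2norm0 f g h : L2 L f -> L2 L g -> L2 L h -> L2norm L (f - g) = 0 ->
  ip f h = ip g h.
Proof.
move=> Lf Lg Lh fg; apply/eqP; rewrite -subr_eq0 -ipBl// -normr_le0.
by rewrite (le_trans (cauchy_schwarz _ _))// ?fg ?mul0r//; exact: L2_sub.
Qed.

End L2_space.
#[global] Hint Resolve measurable_dom dom_ltey L2_add L2_scale L2_opp L2_sub L2_cst L2_0 L2norm_ge0 : core.

(** * Test functions and their density *)

Section smooth_functions.
Context {R : realType}.
Implicit Types (f g : R -> R) (x : R).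

Definition smooth f := forall n x, derivable (f^`(n))%classic x 1.

(** Differentiability to a finite order, by recursion on the first derivative, so that the Leibniz
    rule is an induction on the order in which f and g vary. *)
Fixpoint diffn (n : nat) f : Prop :=
  (forall x, derivable f x 1) /\ (if n is m.+1 then diffn m (f^`())%classic else True).

Lemma diffnP n f : diffn n f <-> forall k x, (k <= n)%N -> derivable (f^`(k))%classic x 1.
Proof.
elim: n f => [|n IH] f /=; split.
- by move=> [df _] k x; rewrite leqn0 => /eqP ->.
- by move=> H; split => // x; exact: (H 0%N).
- by move=> [df /IH H] [|k] x kn; [exact: df|rewrite derive1Sn; exact: H].
- move=> H; split; first by move=> x; exact: (H 0%N).
  by apply/IH => k x kn; rewrite -derive1Sn; exact: H.
Qed.

Lemma smooth_diffn f : smooth f <-> forall n, diffn n f.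
Proof.
split=> [sf n|sf n x]; first by apply/diffnP.
by have /diffnP := sf n; apply.
Qed.

Lemma diffnS n f : diffn n.+1 f -> diffn n f.
Proof. by move/diffnP => H; apply/diffnP => k x kn; apply: H; exact: leqW. Qed.

Lemma smooth_derivable f x : smooth f -> derivable f x 1.
Proof. by move=> /(_ 0%N x). Qed.

Lemma smooth_derive f : smooth f -> smooth (f^`())%classic.
Proof. by move=> sf n x; rewrite -derive1Sn. Qed.

Lemma smooth_continuous f : smooth f -> continuous f.
Proof. by move=> sf x; apply/differentiable_continuous/derivable1_diffP/smooth_derivable. Qed.

(** Coinduction principle: a class of functions stable under derivation takes the place of a formula
    for the n-th derivative. *)
Lemma smooth_coind (P : set (R -> R)) :
  (forall f, P f -> (forall x, derivable f x 1) /\ P (f^`())%classic) ->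
  forall f, P f -> smooth f.
Proof.
move=> H f Pf n; elim: n f Pf => [|n IH] f /H[df Pf'] x; first exact: df.
by rewrite derive1Sn; exact: IH.
Qed.

Lemma diffn_add n f g : diffn n f -> diffn n g -> diffn n (f + g).
Proof.
elim: n f g => [|n IH] f g /= [df f'] [dg g'];
  split; try by [move=> x; exact: (derivableD (df x) (dg x))|].
have -> : ((f + g)^`())%classic = (f^`())%classic + (g^`())%classic; last exact: IH.
apply/funext => x; rewrite -[RHS]/((f^`())%classic x + (g^`())%classic x) !derive1E.
exact: deriveD.
Qed.

Lemma diffn_mul n f g : diffn n f -> diffn n g -> diffn n (f * g).
Proof.
elim: n f g => [|n IH] f g.
  by move=> [df _] [dg _]; split; [move=> x; exact: (derivableM (df x) (dg x))|].
(* The derivative f g' + g f' contains f and g themselves, at the lower order n. *)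
move=> f1 g1; have f0 := diffnS f1; have g0 := diffnS g1.
move: f1 g1 => /= [df f'] [dg g']; split; first by move=> x; exact: (derivableM (df x) (dg x)).
have -> : ((f * g)^`())%classic = f * (g^`())%classic + g * (f^`())%classic.
  apply/funext => x.
  rewrite -[RHS]/(f x * (g^`())%classic x + g x * (f^`())%classic x) !derive1E.
  exact: (deriveM (df x) (dg x)).
by apply: diffn_add; exact: IH.
Qed.

Lemma smooth_add f g : smooth f -> smooth g -> smooth (f + g).
Proof. by move=> /smooth_diffn sf /smooth_diffn sg; apply/smooth_diffn => n; exact: diffn_add. Qed.

Lemma smooth_mul f g : smooth f -> smooth g -> smooth (f * g).
Proof. by move=> /smooth_diffn sf /smooth_diffn sg; apply/smooth_diffn => n; exact: diffn_mul. Qed.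

Lemma derive1_cst (c x : R) : ((cst c : R -> R)^`())%classic x = 0.
Proof. by rewrite derive1E derive_cst. Qed.

Lemma smooth_cst c : smooth (cst c).
Proof.
apply: (@smooth_coind [set f | exists c, f = cst c]); last by exists c.
move=> _ [{}c ->]; split => //; exists 0; apply/funext => x; exact: derive1_cst.
Qed.

Lemma smooth_scale c f : smooth f -> smooth (c *: f).
Proof.
move=> sf; have -> : c *: f = cst c * f by [].
by apply: (@smooth_mul (cst c) f _ sf); exact: smooth_cst.
Qed.

Lemma smooth_antiderivative f g : smooth g -> (forall x, is_derive x 1 f (g x)) -> smooth f.
Proof.
move=> sg fg; apply/smooth_diffn => -[|n] /=; split => //.
have -> : (f^`())%classic = g by apply/funext => x; rewrite derive1E derive_val.
by move/smooth_diffn : sg.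
Qed.

Lemma smooth_affine f a b : smooth f -> smooth (fun x => f (a * x + b)).
Proof.
move=> sf; apply: (@smooth_coind [set g | exists c f, smooth f /\ g = fun x => c * f (a * x + b)]);
  last by exists 1, f; split => //; apply/funext => x; rewrite mul1r.
move=> _ [c [{sf}f [sf ->]]].
have H x : is_derive x 1 (fun x => c * f (a * x + b)) (c * ((f^`())%classic (a * x + b) * a)).
  have df : is_derive (a * x + b) 1 f ((f^`())%classic (a * x + b)).
    by rewrite derive1E; apply/derivableP; exact: smooth_derivable.
  have dl : is_derive x 1 (fun x => a * x + b) a.
    by apply: is_derive_eq; rewrite addr0 /GRing.scale/= mulr1.
  exact: (is_deriveZ c (@is_derive1_comp _ f (fun y => a * y + b) x _ _ df dl)).
split; first by move=> x; case: (H x).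
exists (c * a), (f^`())%classic; split; first exact: smooth_derive.
by apply/funext => x; rewrite derive1E; have -> := @derive_val _ _ _ _ _ _ _ (H x); ring.
Qed.

Lemma is_derive_near f g x d : (\near x, f x = g x) -> is_derive x 1 f d -> is_derive x 1 g d.
Proof.
move=> fg df; apply: DeriveDef; first by apply: near_eq_derivable fg _; case: df.
by rewrite -(near_eq_derive _ fg); exact: derive_val.
Qed.

(* The family [x |-> p(1/x) exp(-1/x)] (extended by 0) is stable under derivation. *)
Definition flat (p : {poly R}) x : R := if 0 < x then p.[x^-1] * expR (- x^-1) else 0.

(** exp(u) is the n-th power of exp(u / n), which is at least u / n. For n = 0 the bound is 0 ^ 0 =
    1. *)
Lemma powu_expR_bounded (n : nat) (u : R) : 0 < u -> u ^+ n * expR (- u) <= n%:R ^+ n.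
Proof.
move=> u0; rewrite expRN ler_pdivrMr ?expR_gt0//.
case: n => [|n]; first by rewrite !expr0 mul1r; have := expR_ge1Dx u; lra.
have n0 : 0 < n.+1%:R :> R by rewrite ltr0n.
have -> : expR u = expR (u / n.+1%:R) ^+ n.+1.
  by rewrite -expRM_natl; congr expR; field; rewrite gt_eqF.
rewrite -exprMn ler_pXn2r ?nnegrE ?mulr_ge0 ?expR_ge0 ?ltW//.
by rewrite mulrC -ltr_pdivrMr// (lt_le_trans _ (expR_ge1Dx _))// ltrDr.
Qed.

Lemma flat_bounded p : exists C, forall x, `|flat p x| <= C.
Proof.
exists (\sum_(i < size p) `|p`_i| * i%:R ^+ i) => x; rewrite /flat; case: ifPn => x0; last first.
  by rewrite normr0 sumr_ge0// => i _; rewrite mulr_ge0// exprn_ge0.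
rewrite horner_coef mulr_suml (le_trans (ler_norm_sum _ _ _))// ler_sum// => i _.
rewrite -mulrA normrM ler_wpM2l// ger0_norm ?mulr_ge0 ?expR_ge0 ?exprn_ge0 ?invr_ge0 ?(ltW x0)//.
by apply: powu_expR_bounded; rewrite invr_gt0.
Qed.

(** For x > 0 this is the chain rule, the factor ['X^2] being the derivative of - 1 / x. At 0 the
    quotient [flat p h / h] equals h times [flat ('X^2 * p) h], which is bounded, so it tends to
    0. *)
Lemma is_derive_flat p x : is_derive x 1 (flat p) (flat ('X^2 * (p - p^`())) x).
Proof.
have [x0|x0|<-] := ltrgtP 0 x.
- have dV : is_derive x 1 (fun y : R => y^-1) (- x ^- 2).
    by have := @is_deriveV _ id x 1 1 (lt0r_neq0 x0) (is_derive_id _ _); rewrite /GRing.scale/= mulr1.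
  have dp := is_derive1_comp (is_derive_poly p x^-1) dV.
  have de := @is_derive1_comp _ expR (fun y => - y^-1) x _ _ (is_derive_expR (- x^-1)) (is_deriveN dV).
  apply: is_derive_near (is_derive_eq (is_deriveM dp de) _).
    by near=> y; rewrite /flat ifT//; near: y; exact: lt_nbhsr.
  rewrite /flat x0 /= !hornerE /GRing.scale/=.
  by rewrite -exprVn; ring.
- apply: is_derive_near (is_derive_eq (is_derive_cst 0 x 1) _).
    by near=> y; rewrite /flat ifF//; apply/negbTE; rewrite -leNgt ltW//; near: y; exact: lt_nbhsl.
  by rewrite /flat ifF//; apply/negbTE; rewrite -leNgt ltW.
- have [C HC] := flat_bounded ('X^2 * p).
  have C0 : 0 <= C by rewrite (le_trans _ (HC 0)).
  have H : h^-1 *: (flat p (h *: 1 + 0) - flat p 0) @[h --> 0^'] --> (0 : R).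
    apply/cvgrPdist_le => e e0.
    near=> h.
    rewrite sub0r normrN /GRing.scale/= mulr1 addr0 {2}/flat ltxx subr0 normrM.
    have [h0|h0] := ltP 0 h; last first.
      by rewrite {1}/flat ltNge h0/= normr0 mulr0 ltW.
    have -> : flat p h = h ^+ 2 * flat ('X^2 * p) h.
      by rewrite /flat h0 hornerM hornerXn; field; rewrite gt_eqF.
    rewrite normrM mulrA -normrM (_ : h^-1 * h ^+ 2 = h); last by field; rewrite gt_eqF.
    rewrite (le_trans (ler_wpM2l _ (HC h)))//.
    have : `|h| <= e / (C + 1).
      near: h; apply: dnbhs0_le; rewrite divr_gt0//; lra.
    rewrite ler_pdivlMr; last lra.
    by apply: le_trans; rewrite ler_wpM2l//; lra.
  apply: DeriveDef; first by apply/cvg_ex; exists 0.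
  by rewrite /flat ltxx; apply/cvg_lim.
Unshelve. all: by end_near. Qed.

Lemma smooth_flat p : smooth (flat p).
Proof.
apply: (@smooth_coind (range flat)); last by exists p.
move=> _ [q _ <-]; split; first by move=> x; case: (is_derive_flat q x).
exists ('X^2 * (q - q^`())) => //; apply/funext => x.
by rewrite derive1E; have -> := @derive_val _ _ _ _ _ _ _ (is_derive_flat q x).
Qed.

End smooth_functions.

Section test_functions.
Context {R : realType}.
Implicit Types (f g phi : R -> R) (x : R).

Lemma test_fun_smooth U phi : test_fun U phi -> smooth phi.
Proof. by case. Qed.

Lemma test_funI (al be : R) U phi : smooth phi -> (forall x, x \notin `[al, be] -> phi x = 0) ->
  `[al, be]%classic `<=` U -> test_fun U phi.
Proof.
move=> sphi z sub.
have sc : closure [set x | phi x != 0] `<=` `[al, be].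
  rewrite (closure_id `[al, be]).1; last exact: interval_closed.
  by apply: closure_subset => x /= /eqP px; apply/negP => /negP /z.
split => //; last exact: subset_trans sub.
apply: subclosed_compact sc; first exact: closed_closure.
exact: segment_compact.
Qed.

(** The end points are the minimum and the maximum of the identity on the compact support; [c]
    serves when the support is empty. In an open interval this keeps the support away from the
    ends. *)
Lemma test_fun_supp (i : interval R) phi (c : R) : c \in i ->
  test_fun [set` i] phi ->
  exists al be, [/\ al \in i, be \in i, al <= be & forall x, x \notin `[al, be] -> phi x = 0].
Proof.
move=> ci [_ cK KU]; set K := closure _ in cK KU.
have [K0|/set0P Kn] := eqVneq K set0.
  exists c, c; split => // x _; apply: contrapT => /eqP px.
  by have : K x; [exact: subset_closure|rewrite K0].
have cid : {within K, continuous (@id R)} by apply: continuous_subspaceT => ?; exact: cvg_id.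
have [m /set_mem mK mM] := compact_EVT_min Kn cK cid.
have [M /set_mem MK MM] := compact_EVT_max Kn cK cid.
exists m, M; split; [exact: KU|exact: KU|exact/mM/mem_set|] => x.
rewrite in_itv/=; apply: contraNeq => px.
by have /mem_set xK : K x; [exact: subset_closure|rewrite mM// MM].
Qed.

Lemma test_fun_add U phi psi : test_fun U phi -> test_fun U psi -> test_fun U (phi + psi).
Proof.

move=> [s1 c1 k1] [s2 c2 k2].
have sub : closure [set x | (phi + psi) x != 0] `<=`
    closure [set x | phi x != 0] `|` closure [set x | psi x != 0].
  rewrite -closureU; apply: closure_subset => x /= /eqP px; apply: contrapT => /not_orP.
  move=> [/negP/negPn/eqP p1 /negP/negPn/eqP p2]; apply: px.
  by rewrite -[LHS]/(phi x + psi x) p1 p2 addr0.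
split; first exact: smooth_add.
- by apply: subclosed_compact sub; [exact: closed_closure|exact: compactU].
- by apply: subset_trans sub _; rewrite subUset.
Qed.

Lemma test_fun_scale U c phi : test_fun U phi -> test_fun U (c *: phi).
Proof.
move=> [s cK KU].
have sub : closure [set x | (c *: phi) x != 0] `<=` closure [set x | phi x != 0].
  apply: closure_subset => x /= /eqP px; apply/eqP => p0; apply: px.
  by rewrite -[LHS]/(c * phi x) p0 mulr0.
split; [exact: smooth_scale|apply: subclosed_compact cK sub|exact: subset_trans KU].
exact: closed_closure.
Qed.

Lemma test_fun_derive (L : R) phi : 0 < L -> test_fun `]0, L[ phi -> test_fun `]0, L[ (phi^`())%classic.
Proof.
move=> L0 tphi.
have cL : L / 2 \in `]0, L[ by rewrite in_itv/=; apply/andP; split; lra.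
have [a1 [b1 [/itvP A1 /itvP B1 _ z1]]] := test_fun_supp cL tphi.
apply: (@test_funI a1 b1); first exact/smooth_derive/test_fun_smooth/tphi.
- move=> x xab; rewrite derive1E (@near_eq_derive _ _ _ phi (cst 0)) ?derive_cst//.
  have : nbhs x (~` `[a1, b1]%classic).
    apply: open_nbhs_nbhs; split; last exact/negP.
    by apply: closed_openC; exact: interval_closed.
  by apply: filterS => y /negP; exact: z1.
- move=> x /=; rewrite !in_itv/= => /andP[h1 h2]; apply/andP; split.
    by rewrite (lt_le_trans _ h1)// A1.
  by rewrite (le_lt_trans h2)// B1.
Qed.

End test_functions.

Import HBNNSimple.

(** * Density of test functions in L^2 by a monotone class argument *)

Section density.
Context {R : realType}.
Variable L : R.
Hypothesis L_gt0 : 0 < L.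
Local Notation mu := (@lebesgue_measure R).
Local Notation D := (`]0, L[%classic : set R).
Implicit Types f g h phi : R -> R.

Lemma within_continuous_bounded (a b : R) f : {within `[a, b], continuous f} ->
  exists M, 0 <= M /\ forall x, a <= x <= b -> `|f x| <= M.
Proof.
move=> cf; have [ab|ba] := leP a b; last first.
  by exists 0; split => // x /andP[h1 h2]; have := le_trans h1 h2; rewrite leNgt ba.
have cn : {within `[a, b], continuous (fun x => `|f x|)}.
  by move=> x; apply: continuous_comp; [exact: cf|exact: norm_continuous].
have [c _ Hc] := EVT_max ab cn.
exists `|f c|; split => // x xab; apply: Hc; by rewrite in_itv.
Qed.

Lemma within_continuous_measurable (a b : R) f : {within `[a, b], continuous f} ->
  measurable_fun (`[a, b]%classic : set R) f.
Proof. by move=> cf; apply: subspace_continuous_measurable_fun => //; exact: measurable_itv. Qed.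

Lemma L2_within_continuous f : {within `[0, L], continuous f} -> L2 L f.
Proof.
move=> cf; have [M [_ HM]] := within_continuous_bounded cf.
apply: (@L2_bounded _ _ _ M).
  apply: measurable_funS (within_continuous_measurable cf); first exact: measurable_itv.
  exact: subset_itv_oo_cc.
by move=> x /=; rewrite in_itv/= => /andP[h1 h2]; apply: HM; rewrite !ltW.
Qed.

Lemma L2_continuous f : continuous f -> L2 L f.
Proof. by move=> cf; apply/L2_within_continuous/continuous_subspaceT. Qed.

Lemma L2_test_fun phi : test_fun D phi -> L2 L phi.
Proof. by move=> /test_fun_smooth/smooth_continuous; exact: L2_continuous. Qed.

Lemma cvg_fine0 (u : nat -> \bar R) : u n @[n --> \oo] --> 0%:E ->
  fine (u n) @[n --> \oo] --> (0 : R).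
Proof. by move=> /fine_cvgP[]. Qed.

(** Dominated convergence for (f - f_n)^2, which is at most 4 g^2. *)
Lemma L2_dominated (f_ : nat -> R -> R) f g : L2 L g -> (forall n, L2 L (f_ n)) ->
  measurable_fun D f ->
  (forall n x, D x -> `|f_ n x| <= `|g x|) ->
  (forall x, D x -> f_ n x @[n --> \oo] --> f x) ->
  L2 L f /\ L2norm L (f - f_ n) @[n --> \oo] --> 0.
Proof.
move=> Lg Lf_ mf fg ff.
have le_fg x : D x -> `|f x| <= `|g x|.
  move=> Dx; have /(cvg_norm) H := ff x Dx.
  by apply: (@cvgr_to_le _ _ _ _ _ _ _ H); near=> n; exact: fg.
have Lf : L2 L f.
  apply/L2P; split => //; have [_ ig] := (L2P L g).1 Lg.
  apply: le_integrable ig => //.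
    by apply/measurable_EFinP; exact: measurable_funX.
  move=> x Dx /=; rewrite lee_fin !normrX ler_sqr ?nnegrE//; exact: le_fg.
split => //.
have -> : (fun n => L2norm L (f - f_ n)) = (fun n => Num.sqrt (ip L (f - f_ n) (f - f_ n))).
  by apply/funext => n; rewrite L2normE.
rewrite -[X in _ --> X]sqrtr0; apply: (@continuous_cvg _ _ _ _ _ _ Num.sqrt); first exact: sqrt_continuous.
apply: cvg_fine0.
have -> : (0%:E : \bar R) = (\int[mu]_(x in D) cst 0 x)%E by rewrite integral0.
have [_ ig] := (L2P L g).1 Lg.
apply: (@dominated_cvg _ _ _ mu D _ _ _ (fun x => (4 * g x ^+ 2)%:E)) => //.
- move=> n; apply/measurable_EFinP.
  have mfn : measurable_fun D (f - f_ n) := L2_measurable (L2_sub Lf (Lf_ n)).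
  exact: (measurable_funM mfn mfn).
- move=> x Dx; apply: cvg_EFin; first by near=> n.
  have H : f x - f_ n x @[n --> \oo] --> 0.
    by rewrite -(subrr (f x)); apply: cvgB; [exact: cvg_cst|exact: ff].
  by rewrite -(mulr0 0); apply: cvgM; exact: H.
- exact: (integrableZl (measurable_dom L) 4 ig).
- move=> n x Dx; rewrite lee_fin.
  change (`|(f x - f_ n x) * (f x - f_ n x)| <= 4 * g x ^+ 2).
  rewrite normrM -expr2 -[g x ^+ 2]real_normK ?num_real//.
  have -> : 4 * `|g x| ^+ 2 = (2 * `|g x|) ^+ 2 by ring.
  rewrite ler_sqr ?nnegrE ?mulr_ge0//.
  rewrite (le_trans (ler_normB _ _))//.
  by have := le_fg x Dx; have := fg n x Dx; lra.
Unshelve. all: by end_near. Qed.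

Definition L2lim f := L2 L f /\
  forall e, 0 < e -> exists phi, test_fun D phi /\ L2norm L (f - phi) < e.

Lemma L2lim_closed f : L2 L f ->
  (forall e, 0 < e -> exists g, L2lim g /\ L2norm L (f - g) < e) -> L2lim f.
Proof.
move=> Lf H; split => // e e0.
have [g [[Lg Hg] fg]] := H (e / 2) (divr_gt0 e0 (ltr0n _ 2)).
have [phi [tphi gphi]] := Hg (e / 2) (divr_gt0 e0 (ltr0n _ 2)).
exists phi; split => //; have Lphi := L2_test_fun tphi.
by rewrite (le_lt_trans (L2norm_sub_triangle Lf Lphi Lg))// [ltRHS]splitr ltrD.
Qed.

Lemma L2lim_add f g : L2lim f -> L2lim g -> L2lim (f + g).
Proof.
move=> [Lf Hf] [Lg Hg]; split; first exact: L2_add.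
move=> e e0; have [phi [tphi f1]] := Hf (e / 2) (divr_gt0 e0 (ltr0n _ 2)).
have [psi [tpsi g1]] := Hg (e / 2) (divr_gt0 e0 (ltr0n _ 2)).
exists (phi + psi); split; first exact: test_fun_add.
have L1 := L2_test_fun tphi; have L2' := L2_test_fun tpsi.
have -> : f + g - (phi + psi) = (f - phi) + (g - psi) by rewrite opprD addrACA.
apply: (le_lt_trans (L2norm_triangle (L2_sub Lf L1) (L2_sub Lg L2'))).
by rewrite [ltRHS]splitr ltrD.
Qed.

Lemma L2lim_test phi : test_fun D phi -> L2lim phi.
Proof.
move=> t; split; first exact: L2_test_fun.
by move=> e e0; exists phi; rewrite subrr L2norm0.
Qed.

Lemma test_fun0 (U : set R) : test_fun U (0 : R -> R).
Proof.
split; first by have -> : (0 : R -> R) = cst 0 by []; exact: smooth_cst.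
- rewrite (_ : [set x | _] = set0) ?closure0; first exact: compact0.
  by apply/seteqP; split => x //=; rewrite eqxx.
- rewrite (_ : [set x | _] = set0) ?closure0//.
  by apply/seteqP; split => x //=; rewrite eqxx.
Qed.

Lemma L2lim0 : L2lim 0.
Proof. exact/L2lim_test/test_fun0. Qed.

Lemma L2lim_scale c f : L2lim f -> L2lim (c *: f).
Proof.
move=> [Lf Hf]; split; first exact: L2_scale.
move=> e e0; have c0 : 0 < `|c| + 1 by rewrite ltr_wpDl.
have [phi [tphi f1]] := Hf (e / (`|c| + 1)) (divr_gt0 e0 c0).
have Lphi := L2_test_fun tphi.
exists (c *: phi); split; first exact: test_fun_scale.
rewrite -scalerBr L2normZ; last exact: L2_sub.
move: f1; rewrite ltr_pdivlMr// => f1; apply: (le_lt_trans _ f1); rewrite mulrC.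
by apply: ler_wpM2l; [exact: L2norm_ge0|rewrite lerDl].
Qed.

Lemma L2lim_sub f g : L2lim f -> L2lim g -> L2lim (f - g).
Proof. by move=> Hf Hg; apply: L2lim_add => //; rewrite -scaleN1r; exact: L2lim_scale. Qed.

Lemma eq_L2lim f g : {in D, f =1 g} -> L2lim f -> L2lim g.
Proof.
move=> fg [Lf Hf]; split; first exact: eq_L2 fg Lf.
move=> e /Hf[phi [tphi H]]; exists phi; split => //.
rewrite (@eq_L2norm _ _ _ (f - phi))// => x xD.
by change (g x - phi x = f x - phi x); rewrite fg.
Qed.

Lemma L2lim_dominated (f_ : nat -> R -> R) f g : L2 L g -> (forall n, L2lim (f_ n)) ->
  measurable_fun D f ->
  (forall n x, D x -> `|f_ n x| <= `|g x|) ->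
  (forall x, D x -> f_ n x @[n --> \oo] --> f x) -> L2lim f.
Proof.
move=> Lg Hf mf fg ff.
have [Lf /cvgrPdist_lt H] := L2_dominated Lg (fun n => (Hf n).1) mf fg ff.
apply: L2lim_closed => // e e0; have [N _ HN] := H e e0.
exists (f_ N); split => //; have := HN N (leqnn N).
by rewrite /= sub0r normrN ger0_norm// L2norm_ge0.
Qed.

Lemma flat1_cvg1 : flat (1 : {poly R}) x @[x --> +oo] --> (1 : R).
Proof.
have H : expR (- x^-1) @[x --> +oo] --> (1 : R).
  rewrite -[X in _ --> X]expR0 -oppr0.
  apply: (@continuous_cvg _ _ _ _ _ _ expR); first exact: continuous_expR.
  apply: cvgN; apply/gtr0_cvgV0; last exact: cvg_id.
  exact: nbhs_pinfty_gt.
apply: cvg_trans H; apply: near_eq_cvg; near=> x.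
by rewrite /flat ifT ?hornerC ?mul1r//; near: x; exact: nbhs_pinfty_gt.
Unshelve. all: by end_near. Qed.

Lemma flat1_ge0_le1 x : 0 <= flat (1 : {poly R}) x <= 1.
Proof.
rewrite /flat; case: ifPn => [x0|_]; last by rewrite lexx ler01.
by rewrite hornerC mul1r expR_ge0/= -[leRHS]expR0 ler_expR oppr_le0 invr_ge0 ltW.
Qed.

Lemma L2lim_ray (a : R) : 0 <= a < L -> L2lim (\1_`]a, +oo[).
Proof.
move=> /andP[a0 aL].
(* The arguments are n (x - a) - 1 and n (L - x) - 1. The shift by 1 confines the support to
   [a + 1 / n, L - 1 / n], and on ]a, L[ both arguments tend to +oo, where [flat 1] tends to 1. For
   n = 0 the function vanishes. *)
pose b n x : R := flat 1 (n%:R * x + (- n%:R * a - 1)) * flat 1 (- n%:R * x + (n%:R * L - 1)).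
apply: (@L2lim_dominated b _ (cst 1)).
- exact: L2_cst.
- move=> n; apply: L2lim_test.
  have s : smooth (b n).
    by apply: (@smooth_mul _ (fun x => flat 1 (n%:R * x + _)) (fun x => flat 1 (- n%:R * x + _)));
      apply: smooth_affine; exact: smooth_flat.
  have [n0|n0] := posnP n.
    have -> : b n = 0; last exact: test_fun0.
    apply/funext => x; rewrite /b n0 {1}/flat ifF ?mul0r//.
    by apply/negbTE; rewrite -leNgt; lra.
  have N0 : 0 < n%:R :> R by rewrite ltr0n.
  have N1 : 0 < n%:R^-1 :> R by rewrite invr_gt0.
  have nn : n%:R * n%:R^-1 = 1 :> R by rewrite divff// gt_eqF.
  apply: (@test_funI _ (a + n%:R^-1) (L - n%:R^-1)) => //.
    move=> x; rewrite in_itv/= negb_and -!ltNge => /orP[h|h].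
      by rewrite /b {1}/flat ifF ?mul0r//; apply/negbTE; rewrite -leNgt; nra.
    by rewrite /b {2}/flat ifF ?mulr0//; apply/negbTE; rewrite -leNgt; nra.
  by move=> x /=; rewrite !in_itv/= => /andP[h1 h2]; apply/andP; split; lra.
- exact: measurable_indic.
- move=> n x _; rewrite normr1 /b ger0_norm.
    have /andP[h1 h2] := flat1_ge0_le1 (n%:R * x + (- n%:R * a - 1)).
    by have /andP[h3 h4] := flat1_ge0_le1 (- n%:R * x + (n%:R * L - 1)); rewrite mulr_ile1.
  by apply: mulr_ge0; case/andP: (flat1_ge0_le1 (n%:R * x + (- n%:R * a - 1)));
    case/andP: (flat1_ge0_le1 (- n%:R * x + (n%:R * L - 1))).
- have cn (c : R) : 0 < c -> n%:R * c - 1 @[n --> \oo] --> +oo.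
    move=> c0; apply/cvgryPge => A; near=> n.
    rewrite lerBrDr -ler_pdivrMr//.
    by near: n; exact: nbhs_infty_ger.
  move=> x; rewrite /= in_itv/= => /andP[x0 xL].
  rewrite indicE; case: (boolP (x \in _)) => xa; last first.
    apply: cvg_near_cst; near=> n.
    move: xa; rewrite notin_setE/= in_itv/= andbT => /negP; rewrite -leNgt => xa.
    rewrite /b {1}/flat ifF ?mul0r//; apply/negbTE; rewrite -leNgt.
    have : n%:R * x <= n%:R * a by rewrite ler_wpM2l.
    by lra.
  move: xa; rewrite inE/= in_itv/= andbT => xa.
  rewrite -[X in _ --> X](mulr1 1); apply: cvgM.
    have -> : (fun n : nat => flat 1 (n%:R * x + (- n%:R * a - 1))) =
        (flat 1 \o (fun n : nat => n%:R * (x - a) - 1)).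
      by apply/funext => n /=; congr flat; ring.
    by apply: cvg_comp flat1_cvg1; apply: cn; rewrite subr_gt0.
  have -> : (fun n : nat => flat 1 (- n%:R * x + (n%:R * L - 1))) =
      (flat 1 \o (fun n : nat => n%:R * (L - x) - 1)).
    by apply/funext => n /=; congr flat; ring.
  by apply: cvg_comp flat1_cvg1; apply: cn; rewrite subr_gt0.
Unshelve. all: by end_near. Qed.

Lemma indic_le1 (A : set R) x : `|\1_A x : R| <= 1.
Proof. by rewrite indicE; case: (x \in A); rewrite ?normr1 ?normr0. Qed.

(** Dynkin's theorem: the rays ]a, +oo[ are stable under intersection and generate the Borel sets,
    and the sets whose indicator is a limit of test functions form a lambda-system, increasing
    unions being dominated limits. *)
Lemma L2lim_indic (A : set (measurableTypeR R)) : measurable A -> L2lim (\1_A).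
Proof.
rewrite RGenOInfty.measurableE => mA.
pose H := [set A : set R | (measurable : set (set (measurableTypeR R))) A /\ L2lim (\1_A)].
suff : <<s setT, (@RGenOInfty.G R) >> `<=` H by move=> /(_ A mA)[].
have ray a : L2lim (\1_`]a, +oo[).
  have [aL|La] := ltP a L; last first.
    apply: eq_L2lim L2lim0 => x; rewrite inE/= in_itv/= => /andP[_ xL].
    rewrite indicE memNset//= in_itv/= andbT; apply/negP; rewrite -leNgt.
    by rewrite ltW// (lt_le_trans xL).
  have /L2lim_ray : 0 <= Num.max a 0 < L by rewrite le_max lexx orbT/= gt_max aL.
  apply: eq_L2lim => x; rewrite inE/= in_itv/= => /andP[x0 xL].
  rewrite !indicE; congr (_%:R); congr nat_of_bool.
  by apply/idP/idP; rewrite !inE/= !in_itv/= !andbT gt_max x0 andbT.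
apply: lambda_system_subset => //.
- move=> _ _ [a ->] [b ->]; exists (Num.max a b).
  apply/seteqP; split => x /=; rewrite !in_itv/= !andbT gt_max; first by move=> [-> ->].
  by move=> /andP[].
- split => //.
  + split; first exact: measurableT.
    (* On ]0, L[ the indicator of the whole line is that of ]0, +oo[. *)
    apply: eq_L2lim (ray 0) => x; rewrite inE/= in_itv/= => /andP[x0 _].
    by rewrite !indicE in_setT mem_set//= in_itv/= x0.
  + move=> X Y YX [mX HX] [mY HY]; split; first exact: measurableD.
    apply: eq_L2lim (L2lim_sub HX HY) => x _.
    change (\1_X x - \1_Y x = \1_(X `\` Y) x :> R).
    rewrite !indicE in_setD; case: (boolP (x \in Y)) => Yx.
      by rewrite (mem_set (YX _ (set_mem Yx))) subrr.
    by rewrite andbT subr0.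
  + move=> F ndF HF; split; first by apply: bigcupT_measurable => i; case: (HF i).
    apply: (@L2lim_dominated (fun n => \1_(F n)) _ (cst 1)).
    * exact: L2_cst.
    * by move=> n; case: (HF n).
    * by apply: measurable_indic; apply: bigcupT_measurable => i; case: (HF i).
    * by move=> n x _; rewrite normr1 indic_le1.
    * move=> x _; apply: cvg_near_cst; rewrite indicE.
      case: (boolP (x \in _)) => [/set_mem[n _ Fnx]|xF].
        near=> m; rewrite indicE mem_set//.
        have /subsetPset : (F n <= F m)%O by apply: ndF; near: m; exact: nbhs_infty_ge.
        exact.
      near=> m; rewrite indicE memNset// => Fm; move/negP: xF; apply; apply/mem_set.
      by exists m.
- move=> _ [a ->]; split; last exact: ray.
  by apply: measurable_itv.
Unshelve. all: by end_near. Qed.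

Lemma L2lim_simple (h : {nnsfun (measurableTypeR R) >-> R}) : L2lim (fun x => h x).
Proof.
pose s := finmap.enum_fset (fset_set (range h)).
have -> : (fun x => h x) = \sum_(i < size s) (s`_i *: \1_(h @^-1` [set s`_i])).
  apply/funext => x; rewrite fimfunEord fct_sumE; apply: eq_bigr => i _.
  by [].
elim/big_rec: _ => [|i g _ Hg]; first exact: L2lim0.
apply: L2lim_add => //; apply/L2lim_scale/L2lim_indic.
rewrite -[X in measurable X]setTI; exact: (measurable_funP h).
Qed.

(** A nonnegative function is a limit of simple functions that it dominates; the general case splits
    f into its positive and negative parts. *)
Theorem L2_density f : L2 L f -> L2lim f.
Proof.
have pos g : L2 L g -> (forall x, D x -> 0 <= g x) -> L2lim g.
  move=> Lg g0; have mg := L2_measurable Lg.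
  have mEg : measurable_fun D (EFin \o g) by exact/measurable_EFinP.
  have Eg0 x : D x -> (0 <= (EFin \o g) x)%E by move=> /g0; rewrite /= lee_fin.
  pose s := nnsfun_approx (measurable_dom L) mEg.
  apply: (@L2lim_dominated (fun n x => s n x) g g) => //.
  - by move=> n; exact: L2lim_simple.
  - move=> n x Dx; rewrite !ger0_norm ?g0//.
    by rewrite -lee_fin /s nnsfun_approxE; exact: le_approx.
  - move=> x Dx; have /fine_cvgP[_] := cvg_nnsfun_approx (measurable_dom L) mEg Eg0 Dx.
    by [].
move=> Lf; have mf := L2_measurable Lf.
have Lp : L2 L (f^\+).
  have mp := measurable_funrpos mf.
  apply/L2P; split => //; have [_ i2] := (L2P L f).1 Lf.
  apply: le_integrable i2 => //; first exact/measurable_EFinP/measurable_funX.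
  move=> x _ /=; rewrite lee_fin !normrX ler_sqr ?nnegrE// /funrpos.
  by rewrite ger0_norm ?le_max ?lexx ?orbT// ge_max ler_norm normr_ge0.
have Ln : L2 L (f^\-).
  have -> : f^\- = f^\+ - f by rewrite -[in X in _ - X](funrposBneg f) opprB addrC subrK.
  exact: L2_sub.
by rewrite -(funrposBneg f); apply: L2lim_sub; apply: pos.
Qed.

Corollary L2_dense f (e : R) : L2 L f -> 0 < e ->
  exists phi, [/\ test_fun D phi, L2 L phi & L2norm L (f - phi) < e].
Proof.
move=> /L2_density[_ H] /H [phi [t p]]; exists phi; split => //; exact: L2_test_fun.
Qed.

(** For a test function phi close to g, the square of the norm of g is <g, g - phi>, at most the
    norm of g times the distance. *)
Lemma L2norm0_test g : L2 L g -> (forall phi, test_fun D phi -> ip L g phi = 0) ->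
  L2norm L g = 0.
Proof.
move=> Lg H; apply/eqP; rewrite eq_le L2norm_ge0 andbT; apply/ler_addgt0Pr => e e0.
rewrite add0r.
have [phi [tphi Lphi gphi]] := L2_dense Lg e0.
have : L2norm L g ^+ 2 <= L2norm L g * L2norm L (g - phi).
  rewrite L2norm_sqr -[ip _ _ _](subr0) -(H phi tphi) -ipBr//.
  by rewrite (le_trans (ler_norm _))// cauchy_schwarz//; exact: L2_sub.
have [->|g0] := eqVneq (L2norm L g) 0; first by move=> _; exact: ltW.
rewrite expr2 ler_pM2l; first by move=> h; rewrite (le_trans h)// ltW.
by rewrite lt_def g0 L2norm_ge0.
Qed.

End density.

(** * Absolutely continuous functions *)

Section primitives.
Context {R : realType}.
Variable L : R.
Hypothesis L_gt0 : 0 < L.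
Local Notation mu := (@lebesgue_measure R).
Local Notation D := (`]0, L[%classic : set R).
Implicit Types f g h phi F G : R -> R.

(* Written as an inner product so that only the values of f in (0,L) matter. *)
Definition prim f x : R := ip L f (\1_`]-oo, x[).

Lemma L2_ray x : L2 L (\1_`]-oo, x[).
Proof.
apply: (@L2_bounded _ _ _ 1); first by apply: measurable_indic; exact: measurable_itv.
by move=> y _; exact: indic_le1.
Qed.
Hint Resolve L2_ray : core.

Lemma primD f g x : L2 L f -> L2 L g -> prim (f + g) x = prim f x + prim g x.
Proof. by move=> Lf Lg; rewrite /prim ipDl. Qed.

Lemma primB f g x : L2 L f -> L2 L g -> prim (f - g) x = prim f x - prim g x.
Proof. by move=> Lf Lg; rewrite /prim ipBl. Qed.

Lemma primZ c f x : L2 L f -> prim (c *: f) x = c * prim f x.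
Proof. by move=> Lf; rewrite /prim ipZl. Qed.

Lemma prim0 f x : x <= 0 -> prim f x = 0.
Proof.
move=> x0; rewrite /prim /ip (@eq_Rintegral _ _ _ _ _ (cst 0)) ?Rintegral_cst ?mul0r//.
move=> y; rewrite inE/= in_itv/= => /andP[y0 _]; rewrite indicE memNset ?mulr0//=.
by rewrite in_itv/=; apply/negP; rewrite -leNgt (le_trans x0)// ltW.
Qed.

Lemma primL f x : L <= x -> prim f x = ip L f (cst 1).
Proof.
move=> Lx; apply: eq_ip => // y; rewrite inE/= in_itv/= => /andP[_ yL].
by rewrite indicE mem_set//= in_itv/= (lt_le_trans yL).
Qed.

Lemma prim_bound f x : L2 L f -> `|prim f x| <= Num.sqrt L * L2norm L f.
Proof.
move=> Lf; rewrite mulrC (le_trans (cauchy_schwarz Lf (L2_ray x)))//.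
apply: ler_wpM2l; first exact: L2norm_ge0.
rewrite -[leRHS]mul1r -[X in X * _]normr1 -L2norm_cst ?(ltW L_gt0)//; apply: L2norm_le => //.
by move=> y _; rewrite normr1 indic_le1.
Qed.

Lemma primE f x : L2 L f -> 0 <= x <= L -> prim f x = \int[mu]_(t in `]0, x[) f t.
Proof.
move=> Lf /andP[x0 xL].
have -> : (`]0, x[%classic : set R) = D `&` `]-oo, x[.
  apply/seteqP; split => y /=; rewrite !in_itv/=; last by move=> [/andP[-> _] ->].
  by move=> /andP[-> yx]; rewrite yx (lt_le_trans yx).
rewrite Rintegral_mkcondr; apply: eq_Rintegral => y _.
by rewrite patchE indicE; case: ifP => _; rewrite ?mulr1 ?mulr0.
Qed.

Lemma L2_integrable f : L2 L f -> mu.-integrable D (EFin \o f).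
Proof.
move=> Lf; have := L2_mul_integrable Lf (L2_cst L 1).
by apply: eq_integrable => // x _ /=; rewrite mulr1.
Qed.

Lemma continuous_within_sub (a b c d : R) f : a <= c -> d <= b ->
  {within `[a, b], continuous f} -> {within `[c, d], continuous f}.
Proof.
move=> ac db; apply: continuous_subspaceW => x /=; rewrite !in_itv/= => /andP[h1 h2].
by rewrite (le_trans ac)// (le_trans h2).
Qed.

Lemma FTC2_itv (a b : R) F f : a <= b ->
  {within `[a, b], continuous F} -> {within `[a, b], continuous f} ->
  (forall x, a < x < b -> is_derive x 1 F (f x)) ->
  \int[mu]_(t in `[a, b]) f t = F b - F a.
Proof.
rewrite le_eqVlt => /predU1P[->|ab] cF cf dF.
  by rewrite set_itv1 Rintegral_set1 subrr.
have [_ cFa cFb] := (continuous_within_itvP F ab).1 cF.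
rewrite /Rintegral (@continuous_FTC2 _ f F)//.
- split => // x; rewrite in_itv/= => xab; by case: (dF x xab).
- move=> x; rewrite in_itv/= => xab; rewrite derive1E; by have [_ ->] := dF x xab.
Qed.

Lemma Rintegral_oo_cc (a b : R) f : {within `[a, b], continuous f} ->
  \int[mu]_(t in `]a, b[) f t = \int[mu]_(t in `[a, b]) f t.
Proof.
move=> cf.
have ic : mu.-integrable `[a, b] (EFin \o f).
  by apply: continuous_compact_integrable => //; exact: segment_compact.
rewrite Rintegral_itv_obnd_cbnd; last first.
  by apply: integrableS ic; [exact: measurable_itv|exact: measurable_itv|exact: subset_itv_oo_cc].
rewrite Rintegral_itv_bndo_bndc//.
by apply: integrableS ic; [exact: measurable_itv|exact: measurable_itv|exact: subset_itv_co_cc].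
Qed.

Lemma prim_FTC F f x : {within `[0, L], continuous F} -> {within `[0, L], continuous f} ->
  (forall x, 0 < x < L -> is_derive x 1 F (f x)) -> 0 <= x <= L ->
  prim f x = F x - F 0.
Proof.
move=> cF cf dF /andP[x0 xL]; have Lf := L2_within_continuous cf.
have cf' := continuous_within_sub (lexx 0) xL cf.
rewrite primE ?x0// Rintegral_oo_cc//.
apply: FTC2_itv => //; first exact: continuous_within_sub (lexx 0) xL cF.
by move=> y /andP[y0 yx]; apply: dF; rewrite y0 (lt_le_trans yx).
Qed.

Lemma prim_is_derive phi x : continuous phi -> 0 < x < L ->
  is_derive x 1 (prim phi) (phi x).
Proof.
move=> cphi /andP[x0 xL]; have Lphi := L2_continuous L cphi.
have cw (a b : R) : {within `[a, b], continuous phi} by exact: continuous_subspaceT.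
have [|d1 d2] := @continuous_FTC1_closed _ phi 0 x L xL _ x0 (cphi x).
  by apply: continuous_compact_integrable => //; exact: segment_compact.
apply: (@is_derive_near _ (fun y => \int[mu]_(t in `[0, y]) phi t)); last first.
  exact: (DeriveDef d1 (etrans (esym (derive1E _ _)) d2)).
near=> y; rewrite primE ?Rintegral_oo_cc//.
by apply/andP; split; apply/ltW; near: y; [exact: lt_nbhsr|exact: lt_nbhsl].
Unshelve. all: by end_near. Qed.

(** Outside the support the primitive is locally constant, which extends the fundamental theorem
    from ]0, L[ to the whole line. *)
Lemma prim_test_is_derive phi (x : R) : test_fun D phi -> is_derive x 1 (prim phi) (phi x).
Proof.
move=> tphi; have cphi := smooth_continuous (test_fun_smooth tphi).
have cL : L / 2 \in `]0, L[ by have L0 := L_gt0; rewrite in_itv/=; apply/andP; split; lra.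
have [a [b [/itvP A /itvP B ab z]]] := test_fun_supp cL tphi.
have [xa|ax] := ltP x a.
  have -> : phi x = 0 by apply: z; rewrite in_itv/= leNgt xa.
  apply: is_derive_near (is_derive_cst 0 x 1); near=> y.
  rewrite /prim /ip (@eq_Rintegral _ _ _ _ _ (cst 0)) ?Rintegral_cst ?mul0r//.
  move=> t _; rewrite indicE; case: (boolP (t \in _)); rewrite ?mulr0// inE/= in_itv/= => ty.
  rewrite z ?mul0r// in_itv/= leNgt (lt_trans ty)//.
  by near: y; exact: lt_nbhsl.
have [bx|xb] := ltP b x; last first.
  by apply: prim_is_derive => //; rewrite (lt_le_trans _ ax) ?(le_lt_trans xb) ?A ?B.
have -> : phi x = 0 by apply: z; rewrite in_itv/= negb_and orbC -ltNge bx.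
apply: is_derive_near (is_derive_cst (ip L phi (cst 1)) x 1); near=> y.
apply: eq_Rintegral => t _ /=; rewrite indicE; case: (boolP (t \in _)) => //.
rewrite notin_setE/= in_itv/= => /negP; rewrite -leNgt => yt.
rewrite z ?mul0r// in_itv/= negb_and orbC -ltNge (lt_le_trans _ yt)//.
by near: y; exact: lt_nbhsr.
Unshelve. all: by end_near. Qed.

(** By [prim_bound] the primitive is a uniform limit of primitives of test functions. *)
Lemma prim_continuous f : L2 L f -> continuous (prim f).
Proof.
move=> Lf x; apply/cvgrPdist_lt => e e0.
have s0 : 0 < Num.sqrt L by rewrite sqrtr_gt0.
have e3 : 0 < e / (3 * Num.sqrt L) by rewrite divr_gt0// mulr_gt0.
have [phi [tphi Lphi fphi]] := L2_dense L_gt0 Lf e3.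
have cphi : {for x, continuous (prim phi)}.
  apply/differentiable_continuous/derivable1_diffP.
  by case: (prim_test_is_derive x tphi).
have B y : `|prim f y - prim phi y| < e / 3.
  rewrite -primB// (le_lt_trans (prim_bound _ _))//; first exact: L2_sub.
  move: fphi; rewrite ltr_pdivlMr ?mulr_gt0// => fphi.
  by rewrite ltr_pdivlMr//; lra.
near=> y.
have H : `|prim phi x - prim phi y| < e / 3.
  by near: y; move/cvgrPdist_lt : cphi; apply; rewrite divr_gt0.
have -> : prim f x - prim f y =
  (prim f x - prim phi x) + (prim phi x - prim phi y) - (prim f y - prim phi y) by ring.
rewrite (le_lt_trans (ler_normB _ _))// (le_lt_trans (lerD (ler_normD _ _) (lexx _)))//.
by have := B x; have := B y; lra.
Unshelve. all: by end_near. Qed.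

Lemma L2_prim f : L2 L f -> L2 L (prim f).
Proof. by move=> Lf; apply: L2_continuous => //; exact: prim_continuous. Qed.

Lemma L2_bound_le g (M : R) : L2 L g -> (forall x, D x -> `|g x| <= M) -> 0 <= M ->
  L2norm L g <= M * Num.sqrt L.
Proof.
move=> Lg gM M0; rewrite -[X in X * _](ger0_norm M0) -L2norm_cst ?(ltW L_gt0)//.
by apply: L2norm_le => // x /gM h; rewrite (le_trans h)// ler_norm.
Qed.

Lemma L2norm_prim f : L2 L f -> L2norm L (prim f) <= L * L2norm L f.
Proof.
move=> Lf; have -> : L * L2norm L f = (Num.sqrt L * L2norm L f) * Num.sqrt L.
  by rewrite mulrAC -expr2 sqr_sqrtr// (ltW L_gt0).
apply: L2_bound_le; [exact: L2_prim|by move=> x _; exact: prim_bound|].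
by apply: mulr_ge0; [exact: sqrtr_ge0|exact: L2norm_ge0].
Qed.

Lemma L2_mul_bounded (b : R -> R) f (M : R) : measurable_fun D b ->
  (forall x, D x -> `|b x| <= M) -> L2 L f ->
  L2 L (b * f) /\ L2norm L (b * f) <= M * L2norm L f.
Proof.
move=> mb bM Lf; have mf := L2_measurable Lf.
have M0 : 0 <= M.
  apply: (le_trans (normr_ge0 (b (L / 2))) (bM (L / 2) _)) => /=; rewrite in_itv/=.
  by have L0 := L_gt0; apply/andP; split; lra.
have le x : D x -> `|(b * f) x| <= `|(M *: f) x|.
  move=> Dx; rewrite -[(b * f) x]/(b x * f x) -[(M *: f) x]/(M * f x) !normrM.
  by rewrite ler_wpM2r// (le_trans (bM x Dx))// ler_norm.
have Lbf : L2 L (b * f).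
  apply/L2P; have mbf : measurable_fun D (b * f) by exact: (measurable_funM mb mf).
  split => //; have [_ i2] := (L2P L (M *: f)).1 (L2_scale M Lf).
  apply: le_integrable i2 => //; first exact/measurable_EFinP/measurable_funX.
  by move=> x Dx; rewrite lee_fin !normrX ler_sqr ?nnegrE// le.
split => //; rewrite -[M in leRHS]ger0_norm// -L2normZ//.
by apply: L2norm_le => //; exact: L2_scale.
Qed.

(* F is absolutely continuous on [0,L], with derivative f. *)
Definition AC F f := L2 L f /\ forall x, 0 <= x <= L -> F x = F 0 + prim f x.

Lemma AC_prim c f : L2 L f -> AC (fun x => c + prim f x) f.
Proof. by move=> Lf; split => // x _; rewrite (prim0 f (lexx 0)) addr0. Qed.

Lemma AC_within_continuous F f : AC F f -> {within `[0, L], continuous F}.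
Proof.
move=> [Lf H]; have : {within `[0, L], continuous (fun x => F 0 + prim f x)}.
  apply: continuous_subspaceT => x; apply: cvgD; [exact: cvg_cst|exact: prim_continuous].
apply: subspace_eq_continuous => x; rewrite inE/= in_itv/= => xL.
by symmetry; exact: H.
Qed.

Lemma AC_bounded F f : AC F f -> exists M, 0 <= M /\ forall x, 0 <= x <= L -> `|F x| <= M.
Proof. by move=> /AC_within_continuous/within_continuous_bounded. Qed.

Lemma AC_L2 F f : AC F f -> L2 L F.
Proof. by move=> /AC_within_continuous; exact: L2_within_continuous. Qed.

Lemma AC_measurable F f : AC F f -> measurable_fun D F.
Proof. by move=> /AC_L2; exact: L2_measurable. Qed.

Lemma dom_le x : D x -> 0 <= x <= L.
Proof. by rewrite /= in_itv/= => /andP[h1 h2]; rewrite !ltW. Qed.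

Lemma AC_L2_mul F f g : AC F f -> L2 L g -> L2 L (F * g).
Proof.
move=> aF Lg; have [M [_ HM]] := AC_bounded aF.
by have [] := L2_mul_bounded (AC_measurable aF) (fun x Dx => HM x (dom_le Dx)) Lg.
Qed.

Lemma AC_FTC F f : {within `[0, L], continuous F} -> {within `[0, L], continuous f} ->
  (forall x, 0 < x < L -> is_derive x 1 F (f x)) -> AC F f.
Proof.
move=> cF cf dF; split; first exact: L2_within_continuous.
by move=> x xL; rewrite (prim_FTC cF cf dF xL) addrC subrK.
Qed.

Lemma AC_total F f : AC F f -> ip L f (cst 1) = F L - F 0.
Proof. by move=> [_ H]; rewrite (H L) ?(ltW L_gt0) ?lexx// primL// addrC addKr. Qed.

(** Density in one factor of the product rule: if phi is close to f in L^2, then F minus the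
    primitive P of phi with P(0) = F(0) is uniformly small, and every term of the rule is continuous
    for these two convergences. *)
Lemma AC_mul_dense G g : AC G g ->
  (forall c phi, test_fun D phi ->
     AC ((fun x => c + prim phi x) * G) (phi * G + (fun x => c + prim phi x) * g)) ->
  forall F f, AC F f -> AC (F * G) (f * G + F * g).
Proof.
move=> aG H F f aF; have [Lf HF] := aF; have [Lg HG] := aG.
have [M [M0 HM]] := AC_bounded aG.
have LfG : L2 L (f * G) by rewrite mulrC; exact: AC_L2_mul aG Lf.
have LFg : L2 L (F * g) := AC_L2_mul aF Lg.
split; first exact: L2_add.
move=> x xL; apply/eqP; rewrite -subr_eq0 -normr_le0; apply/ler_addgt0Pr => e e0.
rewrite add0r; set s := Num.sqrt L; have s0 : 0 <= s by rewrite sqrtr_ge0.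
set N := L2norm L g; have N0 : 0 <= N by exact: L2norm_ge0.
(* The error found at the end is at most (K - 1) times the distance from f to phi; the added 1 makes
   K positive. *)
pose K := s * M + s * (M + s * N) + 1.
have K0 : 0 < K by rewrite ltr_wpDl// addr_ge0 ?mulr_ge0// addr_ge0// mulr_ge0.
have [phi [tphi Lphi fphi]] := L2_dense L_gt0 Lf (divr_gt0 e0 K0).
pose P x := F 0 + prim phi x.
have aP : AC P phi by exact: AC_prim.
have LPg := AC_L2_mul aP Lg.
have LpG : L2 L (phi * G) by rewrite mulrC; exact: AC_L2_mul aG Lphi.
have [_ /(_ x xL)] := H (F 0) phi tphi; rewrite -/P => HP.
have P0 : P 0 = F 0 by rewrite /P prim0// addr0.
have FP y : 0 <= y <= L -> F y - P y = prim (f - phi) y.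
  by move=> yL; rewrite HF// /P primB//; ring.
have Lfp : L2 L (f - phi) by exact: L2_sub.
set d := L2norm L (f - phi) in fphi; have d0 : 0 <= d by exact: L2norm_ge0.
have E : (F * G) x - ((F * G) 0 + prim (f * G + F * g) x) =
   prim (f - phi) x * G x - prim ((f - phi) * G + (F - P) * g) x.
  have -> : (f - phi) * G + (F - P) * g = (f * G + F * g) - (phi * G + P * g).
    by rewrite !mulrBl opprD addrACA.
  rewrite (primB _ (L2_add LfG LFg) (L2_add LpG LPg)).
  have -> : prim (phi * G + P * g) x = P x * G x - P 0 * G 0.
    by move: HP; rewrite -[(P * G) x]/(P x * G x) -[(P * G) 0]/(P 0 * G 0) => ->; ring.
  rewrite -FP// P0 -[(F * G) x]/(F x * G x) -[(F * G) 0]/(F 0 * G 0); ring.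
have [L1 B1] : L2 L ((f - phi) * G) /\ L2norm L ((f - phi) * G) <= M * d.
  rewrite mulrC; apply: L2_mul_bounded => //; first exact: AC_measurable aG.
  by move=> y /dom_le; exact: HM.
have [L2' B2] : L2 L ((F - P) * g) /\ L2norm L ((F - P) * g) <= (s * d) * N.
  apply: L2_mul_bounded => //.
    exact: (measurable_funB (AC_measurable aF) (AC_measurable aP)).
  move=> y /dom_le yL; rewrite -[(F - P) y]/(F y - P y) FP//; exact: prim_bound.
rewrite E (le_trans (ler_normB _ _))//.
have b1 : `|prim (f - phi) x * G x| <= s * d * M.
  by rewrite normrM ler_pM// ?HM// prim_bound.
have b2 : `|prim ((f - phi) * G + (F - P) * g) x| <= s * (M * d + s * d * N).
  rewrite (le_trans (prim_bound _ _))//; first exact: L2_add.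
  rewrite ler_wpM2l// (le_trans (L2norm_triangle _ _))// lerD//.
apply: (le_trans (lerD b1 b2)).
have -> : s * d * M + s * (M * d + s * d * N) = d * (K - 1) by rewrite /K; ring.
move: fphi; rewrite ltr_pdivlMr// => fphi.
by rewrite (le_trans _ (ltW fphi))// ler_wpM2l// lerBlDr lerDl.
Qed.

Lemma AC_eq F f g : AC F f -> f = g -> AC F g. Proof. by move=> + <-. Qed.

(** Density is applied to each factor in turn; what remains is the product of two primitives of test
    functions, where the classical rule and the fundamental theorem apply. *)
Lemma AC_mul F G f g : AC F f -> AC G g -> AC (F * G) (f * G + F * g).
Proof.
move=> aF aG; apply: AC_mul_dense aF => // c phi tphi.
rewrite mulrC; have aP : AC (fun x => c + prim phi x) phi by apply/AC_prim/L2_test_fun.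
apply: (@AC_eq _ (g * (fun x => c + prim phi x) + G * phi)); last by rewrite addrC mulrC [X in _ + X]mulrC.
apply: AC_mul_dense aG => // {}c' psi tpsi.
have aQ : AC (fun x => c' + prim psi x) psi by apply/AC_prim/L2_test_fun.
have cphi := smooth_continuous (test_fun_smooth tphi).
have cpsi := smooth_continuous (test_fun_smooth tpsi).
have cP : continuous (fun x => c + prim phi x).
  by move=> x; apply: cvgD; [exact: cvg_cst|exact/prim_continuous/L2_test_fun].
have cQ : continuous (fun x => c' + prim psi x).
  by move=> x; apply: cvgD; [exact: cvg_cst|exact/prim_continuous/L2_test_fun].
apply: AC_FTC.
- by apply: continuous_subspaceT => x; apply: cvgM; [exact: cQ|exact: cP].
- apply: continuous_subspaceT => x; apply: cvgD; apply: cvgM;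
    [exact: cpsi|exact: cP|exact: cQ|exact: cphi].
- move=> x xL.
  have dP : is_derive x 1 (fun x => c + prim phi x) (0 + phi x).
    by apply: is_deriveD; exact: prim_test_is_derive.
  have dQ : is_derive x 1 (fun x => c' + prim psi x) (0 + psi x).
    by apply: is_deriveD; exact: prim_test_is_derive.
  apply: is_derive_eq (is_deriveM dQ dP) _; rewrite !add0r /GRing.scale/=.
  by rewrite -[RHS]/(psi x * (c + prim phi x) + (c' + prim psi x) * phi x); ring.
Qed.

Lemma AC_ip_zero F f : AC F f -> F 0 = 0 -> F L = 0 -> ip L f (cst 1) = 0.
Proof. by move=> /AC_total -> -> ->; rewrite subrr. Qed.

End primitives.

(** * Calculus modulo equality in L^2 *)

Section L2_equality.
Context {R : realType}.
Variable L : R.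
Implicit Types f g h : R -> R.

(* That is, f = g almost everywhere on (0,L). *)
Definition L2eq f g := L2norm L (f - g) = 0.

Lemma L2eq_refl f : L2eq f f.
Proof. by rewrite /L2eq subrr L2norm0. Qed.

Lemma L2eq_sym f g : L2 L f -> L2 L g -> L2eq f g -> L2eq g f.
Proof. by move=> Lf Lg; rewrite /L2eq L2norm_distC. Qed.

Lemma L2norm_le0 f : L2norm L f <= 0 -> L2norm L f = 0.
Proof. by move=> f0; apply/eqP; rewrite eq_le f0 L2norm_ge0. Qed.

Lemma L2eq_trans g f h : L2 L f -> L2 L g -> L2 L h -> L2eq f g -> L2eq g h -> L2eq f h.
Proof.
move=> Lf Lg Lh fg gh; apply: L2norm_le0.
by rewrite (le_trans (L2norm_sub_triangle Lf Lh Lg))// fg gh addr0.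
Qed.

Lemma L2eq_add f f' g g' : L2 L f -> L2 L f' -> L2 L g -> L2 L g' ->
  L2eq f f' -> L2eq g g' -> L2eq (f + g) (f' + g').
Proof.
move=> Lf Lf' Lg Lg' ff gg; apply: L2norm_le0; rewrite opprD addrACA.
by rewrite (le_trans (L2norm_triangle (L2_sub Lf Lf') (L2_sub Lg Lg')))// ff gg addr0.
Qed.

Lemma L2eq_scale c f g : L2 L f -> L2 L g -> L2eq f g -> L2eq (c *: f) (c *: g).
Proof. by move=> Lf Lg fg; rewrite /L2eq -scalerBr L2normZ ?fg ?mulr0//; exact: L2_sub. Qed.

Lemma L2eq_opp f g : L2 L f -> L2 L g -> L2eq f g -> L2eq (- f) (- g).
Proof. by move=> Lf Lg fg; rewrite -(scaleN1r f) -(scaleN1r g); exact: L2eq_scale. Qed.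

Lemma L2eq_sub f f' g g' : L2 L f -> L2 L f' -> L2 L g -> L2 L g' ->
  L2eq f f' -> L2eq g g' -> L2eq (f - g) (f' - g').
Proof. by move=> Lf Lf' Lg Lg' ff gg; apply: L2eq_add => //; try exact: L2_opp; exact: L2eq_opp. Qed.

Lemma L2eq_ipl f g h : L2 L f -> L2 L g -> L2 L h -> L2eq f g -> ip L f h = ip L g h.
Proof. exact: eq_ip_L2norm0. Qed.

Lemma L2eq_ipr f g h : L2 L f -> L2 L g -> L2 L h -> L2eq f g -> ip L h f = ip L h g.
Proof. by move=> *; rewrite !(ipC L h); exact: L2eq_ipl. Qed.

Lemma L2eq_ip f f' g g' : L2 L f -> L2 L f' -> L2 L g -> L2 L g' -> L2eq f f' -> L2eq g g' ->
  ip L f g = ip L f' g'.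
Proof. by move=> Lf Lf' Lg Lg' ff gg; rewrite (L2eq_ipl Lf Lf')// (L2eq_ipr Lg Lg'). Qed.

Lemma L2eq_norm f g : L2 L f -> L2 L g -> L2eq f g -> L2norm L f = L2norm L g.
Proof. by move=> Lf Lg fg; rewrite !L2normE (L2eq_ip Lf Lg Lf Lg). Qed.

Lemma ip_mul1 f g : ip L (f * g) (cst 1) = ip L f g.
Proof. by apply: eq_Rintegral => x _; rewrite /= mulr1. Qed.

Lemma eq_L2eq f g : {in `]0, L[%classic, f =1 g} -> L2eq f g.
Proof.
move=> fg; rewrite /L2eq (@eq_L2norm _ _ _ 0) ?L2norm0// => x xD.
by rewrite -[LHS]/(f x - g x) fg// subrr.
Qed.

End L2_equality.
#[global] Hint Resolve L2eq_refl : core.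

(** * Weak derivatives and H^1_0 *)

Section weak_derivatives.
Context {R : realType}.
Variable L : R.
Hypothesis L_gt0 : 0 < L.
Local Notation mu := (@lebesgue_measure R).
Local Notation D := (`]0, L[%classic : set R).
Local Notation "f ~ g" := (L2eq L f g) (at level 70).
Implicit Types f g h phi F G : R -> R.

Lemma test_fun_out U phi x : test_fun U phi -> ~ U x -> phi x = 0.
Proof.
move=> [_ _ KU] Ux; apply: contrapT => /eqP px; apply: Ux; apply: KU.
by apply: subset_closure.
Qed.

Lemma test_fun_bnd phi : test_fun D phi -> phi 0 = 0 /\ phi L = 0.
Proof. by move=> t; split; apply: (test_fun_out t) => /=; rewrite in_itv/= ltxx// andbF. Qed.

Lemma test_fun_AC phi : test_fun D phi -> AC L phi (phi^`())%classic.
Proof.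
move=> t; have s := test_fun_smooth t; apply: AC_FTC => //.
- exact/continuous_subspaceT/smooth_continuous.
- exact/continuous_subspaceT/smooth_continuous/smooth_derive.
- by move=> x _; rewrite derive1E; apply/derivableP; exact: smooth_derivable.
Qed.

Lemma L2_test_derive phi : test_fun D phi -> L2 L (phi^`())%classic.
Proof. by move=> t; apply: L2_test_fun; exact: test_fun_derive. Qed.

Lemma is_wderiv_AC F f : AC L F f -> is_wderiv L F f.
Proof.
move=> aF phi t; have aphi := test_fun_AC t; have [p0 pL] := test_fun_bnd t.
have Lf := aF.1; have Lphi := L2_test_fun t.
change (ip L F (phi^`())%classic = - ip L f phi).
have := AC_ip_zero L_gt0 (AC_mul L_gt0 aF aphi).
rewrite -[(F * phi) 0]/(F 0 * phi 0) -[(F * phi) L]/(F L * phi L) p0 pL !mulr0 => /(_ erefl erefl).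
rewrite ipDl ?L2_cst//; last 2 first.
- by rewrite mulrC; exact: AC_L2_mul aphi Lf.
- exact: AC_L2_mul aF (L2_test_derive t).
by rewrite !ip_mul1 => /eqP; rewrite addrC addr_eq0 => /eqP.
Qed.

Lemma is_wderiv_unique f g g' : L2 L g -> L2 L g' -> is_wderiv L f g -> is_wderiv L f g' -> g ~ g'.
Proof.
move=> Lg Lg' fg fg'; apply: (L2norm0_test L_gt0); first exact: L2_sub.
move=> phi t; have Lphi := L2_test_fun t; rewrite ipBl//.
have /eqP := esym (fg phi t); rewrite (fg' phi t) eqr_opp => /eqP.
by rewrite -/(ip L g phi) -/(ip L g' phi) => ->; rewrite subrr.
Qed.

Lemma H1_wderiv f : H1 L f -> L2 L (wderiv L f) /\ is_wderiv L f (wderiv L f).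
Proof. by move=> [_ H]; exact: (xgetPex _ H). Qed.

Lemma wderiv_eq f g : L2 L f -> L2 L g -> is_wderiv L f g -> H1 L f /\ wderiv L f ~ g.
Proof.
move=> Lf Lg fg; have Hf : H1 L f by split => //; exists g.
split => //; have [L' H'] := H1_wderiv Hf; exact: is_wderiv_unique H' fg.
Qed.

Lemma is_wderiv_L2eq f f' g : L2 L f -> L2 L f' -> f ~ f' -> is_wderiv L f g -> is_wderiv L f' g.
Proof.
move=> Lf Lf' ff H phi t; rewrite -(H phi t); symmetry.
exact: (L2eq_ipl Lf Lf' (L2_test_derive t) ff).
Qed.

Lemma is_wderiv_lin c f f' g g' : L2 L f -> L2 L f' -> L2 L g -> L2 L g' ->
  is_wderiv L f f' -> is_wderiv L g g' -> is_wderiv L (c *: f + g) (c *: f' + g').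
Proof.
move=> Lf Lf' Lg Lg' ff gg phi t.
have Lphi := L2_test_fun t; have Ld := L2_test_derive t.
change (ip L (c *: f + g) (phi^`())%classic = - ip L (c *: f' + g') phi).
rewrite !ipDl ?ipZl//; try exact: L2_scale.
by rewrite /ip (ff phi t) (gg phi t) mulrN opprD.
Qed.

Lemma H1_lin c f g : H1 L f -> H1 L g ->
  H1 L (c *: f + g) /\ wderiv L (c *: f + g) ~ c *: wderiv L f + wderiv L g.
Proof.
move=> Hf Hg; have [Lf' f'] := H1_wderiv Hf; have [Lg' g'] := H1_wderiv Hg.
case: (Hf) (Hg) => Lf _ [Lg _].
apply: wderiv_eq; [by apply: L2_add; first exact: L2_scale
                 |by apply: L2_add; first exact: L2_scale|exact: is_wderiv_lin].
Qed.

Lemma H1_sub f g : H1 L f -> H1 L g ->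
  H1 L (f - g) /\ wderiv L (f - g) ~ wderiv L f - wderiv L g.
Proof.
move=> Hf Hg; have := H1_lin (-1) Hg Hf.
by rewrite !scaleN1r !(addrC (- _)).
Qed.

Lemma H1norm_ge f : L2norm L f <= H1norm L f /\ L2norm L (wderiv L f) <= H1norm L f.
Proof.
by split; rewrite -[X in X <= _]ger0_norm ?L2norm_ge0// -sqrtr_sqr /H1norm ler_wsqrtr//
  ?lerDl ?lerDr sqr_ge0.
Qed.

Lemma H1norm_le f (c : R) : L2norm L f <= c -> L2norm L (wderiv L f) <= c ->
  H1norm L f <= Num.sqrt 2 * c.
Proof.
move=> h1 h2; have c0 : 0 <= c := le_trans (L2norm_ge0 L f) h1.
rewrite -[c in leRHS]ger0_norm// -sqrtr_sqr -sqrtrM// /H1norm ler_wsqrtr//.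
have := L2norm_ge0 L f; have := L2norm_ge0 L (wderiv L f); nra.
Qed.

Lemma test_fun_H1 phi : test_fun D phi -> H1 L phi /\ wderiv L phi ~ (phi^`())%classic.
Proof.
move=> t; apply: wderiv_eq; [exact: L2_test_fun|exact: L2_test_derive|].
exact/is_wderiv_AC/test_fun_AC.
Qed.

(** Both claims hold for test functions, and both defects are bounded by a constant times the H^1
    distance from f to a test function. *)
Lemma H10_prim_wderiv f : H10 L f ->
  f ~ prim L (wderiv L f) /\ ip L (wderiv L f) (cst 1) = 0.
Proof.
move=> [Hf H]; have [Lg fg] := H1_wderiv Hf; have [Lf _] := Hf; set g := wderiv L f in Lg fg *.
have Lp := L2_prim L_gt0 Lg.
have key e : 0 < e -> L2norm L (f - prim L g) <= (1 + L) * e /\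
   `|ip L g (cst 1)| <= Num.sqrt L * e.
  move=> e0; have [phi [t fphi]] := H e e0.
  have [Hphi phi'] := test_fun_H1 t; have [Hd d'] := H1_sub Hf Hphi.
  have Lphi := L2_test_fun t; have Lphi' := L2_test_derive t.
  have [[Lwphi _] [Lwd _]] := (H1_wderiv Hphi, H1_wderiv Hd).
  have [n1 n2] := H1norm_ge (f - phi).
  have m1 : L2norm L (f - phi) <= e := ltW (le_lt_trans n1 fphi).
  have m2 : L2norm L (g - (phi^`())%classic) <= e.
    apply: le_trans (ltW (le_lt_trans n2 fphi)).
    rewrite (L2eq_norm Lwd (L2_sub Lg Lphi'))//.
    apply: (L2eq_trans Lwd (L2_sub Lg Lwphi) (L2_sub Lg Lphi')) => //.
    by apply: L2eq_sub.
  have [p0 pL] := test_fun_bnd t; have aphi := test_fun_AC t.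
  have E : phi ~ prim L (phi^`())%classic.
    apply: eq_L2eq => x /set_mem/dom_le/aphi.2 ->; by rewrite p0 add0r.
  have Lpp := L2_prim L_gt0 Lphi'.
  split.
    rewrite (le_trans (L2norm_sub_triangle Lf Lp Lphi))// mulrDl mul1r lerD//.
    rewrite (le_trans (L2norm_sub_triangle Lphi Lp Lpp))// E add0r.
    have -> : prim L (phi^`())%classic - prim L g = prim L ((phi^`())%classic - g).
      by apply/funext => x; rewrite primB.
    rewrite (le_trans (L2norm_prim L_gt0 _))//; first exact: L2_sub.
    by apply: ler_wpM2l; [exact: ltW|rewrite L2norm_distC].
  have z : ip L (phi^`())%classic (cst 1) = 0 by exact: (AC_ip_zero L_gt0 aphi).
  rewrite -[ip _ _ _]subr0 -z -ipBl//.
  rewrite -(primL _ (lexx L)) (le_trans (prim_bound L_gt0 _ _))//; first exact: L2_sub.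
  by apply: ler_wpM2l; first exact: sqrtr_ge0.
have lim0 (a c : R) : 0 <= c -> (forall e, 0 < e -> a <= c * e) -> a <= 0.
  move=> c0 ac; apply/ler_addgt0Pr => e e0; rewrite add0r.
  have c1 : 0 < c + 1 by rewrite ltr_wpDl.
  rewrite (le_trans (ac _ (divr_gt0 e0 c1)))// mulrA ler_pdivrMr//.
  by rewrite mulrC ler_pM2l// lerDl.
split.
  apply: L2norm_le0; apply: (@lim0 _ (1 + L)).
    by have L0 := L_gt0; lra.
  by move=> e /key[].
apply/eqP; rewrite -normr_le0; apply: (@lim0 _ (Num.sqrt L)); first exact: sqrtr_ge0.
by move=> e /key[].
Qed.

(** To the right of the support of psi the primitive equals the integral of psi, which is 0. *)
Lemma test_fun_prim psi : test_fun D psi -> ip L psi (cst 1) = 0 -> test_fun D (prim L psi).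
Proof.
move=> t i0.
have cL : L / 2 \in `]0, L[ by have L0 := L_gt0; rewrite in_itv/=; apply/andP; split; lra.
have [a [b [/itvP A /itvP B ab z]]] := test_fun_supp cL t.
apply: (@test_funI _ a b).
- by apply: (smooth_antiderivative (test_fun_smooth t)) => x; exact: prim_test_is_derive.
- move=> x; rewrite in_itv/= negb_and -!ltNge => /orP[xa|bx].
    rewrite /prim /ip (@eq_Rintegral _ _ _ _ _ (cst 0)) ?Rintegral_cst ?mul0r//.
    move=> y _; rewrite indicE; case: (boolP (y \in _)); rewrite ?mulr0// inE/= in_itv/= => yx.
    by rewrite z ?mul0r// in_itv/= leNgt (lt_trans yx).
  rewrite -i0; apply: eq_Rintegral => y _ /=; rewrite indicE; case: (boolP (y \in _)) => //.
  rewrite notin_setE/= in_itv/= => /negP; rewrite -leNgt => xy.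
  by rewrite z ?mul0r// in_itv/= negb_and orbC -ltNge (lt_le_trans bx).
- move=> x /=; rewrite !in_itv/= => /andP[h1 h2]; apply/andP; split.
    by rewrite (lt_le_trans _ h1)// A.
  by rewrite (le_lt_trans h2)// B.
Qed.

(** By Cauchy-Schwarz, a test function at distance less than sqrt(L) / 2 from the constant 1 has a
    nonzero integral; it is then normalized. *)
Lemma unit_mass_test : exists eta, test_fun D eta /\ ip L eta (cst 1) = 1.
Proof.
have s0 : 0 < Num.sqrt L by rewrite sqrtr_gt0.
have e0 : 0 < Num.sqrt L / 2 by rewrite divr_gt0.
have [phi [t Lphi H]] := L2_dense L_gt0 (L2_cst L 1) e0.
have c0 : ip L phi (cst 1) != 0.
  apply/negP => /eqP z.
  have : `|ip L (cst 1 - phi) (cst 1)| < L.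
    rewrite (le_lt_trans (cauchy_schwarz _ _))//; first exact: L2_sub.
    rewrite L2norm_cst ?(ltW L_gt0)// normr1 mul1r.
    apply: (@lt_trans _ _ (Num.sqrt L / 2 * Num.sqrt L)); first by rewrite ltr_pM2r.
    rewrite mulrAC -expr2 sqr_sqrtr ?(ltW L_gt0)//; have L0 := L_gt0; lra.
  rewrite ipBl// z subr0 -L2norm_sqr L2norm_cst ?(ltW L_gt0)// normr1 mul1r sqr_sqrtr ?(ltW L_gt0)//.
  by rewrite ger0_norm ?(ltW L_gt0)// ltxx.
exists ((ip L phi (cst 1))^-1 *: phi); split; first exact: test_fun_scale.
by rewrite ipZl// mulVf.
Qed.

(** Converse of [H10_prim_wderiv]. A test function psi close to g is corrected by a multiple of
    [eta] to have mean zero; its primitive is then a test function close to f in H^1. *)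
Lemma prim_H10 f g : L2 L f -> L2 L g -> ip L g (cst 1) = 0 -> f ~ prim L g ->
  H10 L f /\ wderiv L f ~ g.
Proof.
move=> Lf Lg g0 fg; have Lp := L2_prim L_gt0 Lg.
have [Hf f'] : H1 L f /\ wderiv L f ~ g.
  apply: wderiv_eq => //; apply: (is_wderiv_L2eq Lp Lf); first exact: L2eq_sym.
  have -> : prim L g = (fun x => 0 + prim L g x) by apply/funext => x; rewrite add0r.
  exact: is_wderiv_AC (AC_prim 0 Lg).
split => //; split => // e e0.
have [eta [teta eta1]] := unit_mass_test; have Leta := L2_test_fun teta.
(* The first factor is the cost of correcting the mean, 1 + L that of taking primitives, and sqrt 2
   comes from [H1norm_le]. *)
pose K := (1 + Num.sqrt L * L2norm L eta) * (1 + L) * Num.sqrt 2 + 1.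
have L0 := ltW L_gt0; have s0 : 0 <= Num.sqrt L by rewrite sqrtr_ge0.
have A0 : 0 <= 1 + Num.sqrt L * L2norm L eta.
  by rewrite addr_ge0// mulr_ge0// L2norm_ge0.
have K0 : 0 < K by rewrite ltr_wpDl// !mulr_ge0// ?sqrtr_ge0// addr_ge0.
have [psi [tpsi Lpsi gpsi]] := L2_dense L_gt0 Lg (divr_gt0 e0 K0).
set d := L2norm L (g - psi) in gpsi; have d0 : 0 <= d by exact: L2norm_ge0.
pose c := ip L psi (cst 1).
have cd : `|c| <= Num.sqrt L * d.
  rewrite /c -normrN -[- _]add0r -g0 -ipBl//.
  by rewrite -(primL _ (lexx L)) prim_bound//; exact: L2_sub.
pose chi := psi - c *: eta.
have tchi : test_fun D chi.
  by apply: test_fun_add => //; rewrite -scaleNr; exact: test_fun_scale.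
have Lchi := L2_test_fun tchi.
have chi0 : ip L chi (cst 1) = 0.
  by rewrite /chi ipBl ?ipZl ?eta1 ?mulr1 ?subrr//; exact: L2_scale.
have gchi : L2norm L (g - chi) <= (1 + Num.sqrt L * L2norm L eta) * d.
  have -> : g - chi = (g - psi) + c *: eta by rewrite /chi opprB addrA addrAC.
  have Le : L2 L (c *: eta) by exact: L2_scale.
  rewrite (le_trans (L2norm_triangle (L2_sub Lg Lpsi) Le))// mulrDl mul1r lerD//.
  rewrite L2normZ// mulrAC; apply: ler_wpM2r => //; exact: L2norm_ge0.
have tphi := test_fun_prim tchi chi0; have [Hphi phi'] := test_fun_H1 tphi.
have Lphi := L2_test_fun tphi.
exists (prim L chi); split => //.
have [Hd d'] := H1_sub Hf Hphi.
have [[Lwf _] [Lwphi _]] := (H1_wderiv Hf, H1_wderiv Hphi); have [Lwd _] := H1_wderiv Hd.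
have phi'' : wderiv L (prim L chi) ~ chi.
  have E : (prim L chi)^`()%classic = chi.
    apply/funext => x; rewrite derive1E.
    exact: (@derive_val _ _ _ _ _ _ _ (prim_test_is_derive L_gt0 x tchi)).
  by move: phi'; rewrite E.
have m2 : L2norm L (wderiv L (f - prim L chi)) = L2norm L (g - chi).
  apply: L2eq_norm => //; first exact: L2_sub.
  apply: (L2eq_trans Lwd (L2_sub Lwf Lwphi) (L2_sub Lg Lchi)) => //.
  exact: L2eq_sub.
have m1 : L2norm L (f - prim L chi) <= L * L2norm L (g - chi).
  rewrite (le_trans (L2norm_sub_triangle Lf Lphi Lp))// fg add0r.
  have -> : prim L g - prim L chi = prim L (g - chi) by apply/funext => x; rewrite primB.
  by apply: L2norm_prim => //; exact: L2_sub.
have dd : 0 <= L2norm L (g - chi) by exact: L2norm_ge0.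
apply: (@le_lt_trans _ _ (Num.sqrt 2 * ((1 + L) * L2norm L (g - chi)))).
  apply: H1norm_le; first by rewrite (le_trans m1)// mulrDl mul1r lerDr.
  by rewrite m2 mulrDl mul1r lerDl mulr_ge0.
have s2 : 0 <= Num.sqrt 2 :> R by rewrite sqrtr_ge0.
have L1 : 0 <= 1 + L by rewrite addr_ge0.
apply: (@le_lt_trans _ _ (Num.sqrt 2 * ((1 + L) * ((1 + Num.sqrt L * L2norm L eta) * d)))).
  by apply: ler_wpM2l => //; exact: ler_wpM2l.
move: gpsi; rewrite ltr_pdivlMr//; apply: le_lt_trans.
have -> : Num.sqrt 2 * ((1 + L) * ((1 + Num.sqrt L * L2norm L eta) * d)) = d * (K - 1).
  by rewrite /K; ring.
by apply: ler_wpM2l => //; rewrite lerBlDr lerDl.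
Qed.

Lemma H10_H1 f : H10 L f -> H1 L f. Proof. by case. Qed.
Lemma H10_L2 f : H10 L f -> L2 L f. Proof. by case=> -[]. Qed.
Lemma H10_L2_wderiv f : H10 L f -> L2 L (wderiv L f).
Proof. by move=> /H10_H1/H1_wderiv[]. Qed.

(** The absolutely continuous representative, whose end values play the part of the trace in
    integrations by parts. *)
Lemma H10_AC f : H10 L f -> exists F, [/\ AC L F (wderiv L f), F 0 = 0, F L = 0 & f ~ F].
Proof.
move=> Hf; have [fp z] := H10_prim_wderiv Hf; have Lw := H10_L2_wderiv Hf.
exists (prim L (wderiv L f)); split => //.
- have -> : prim L (wderiv L f) = (fun x => 0 + prim L (wderiv L f) x).
    by apply/funext => x; rewrite add0r.
  exact: AC_prim.
- by rewrite prim0.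
- by rewrite primL.
Qed.

Lemma H10_lin c f g : H10 L f -> H10 L g ->
  H10 L (c *: f + g) /\ wderiv L (c *: f + g) ~ c *: wderiv L f + wderiv L g.
Proof.
move=> Hf Hg; have [fp fz] := H10_prim_wderiv Hf; have [gp gz] := H10_prim_wderiv Hg.
have [Lf Lg] := (H10_L2 Hf, H10_L2 Hg); have [Lf' Lg'] := (H10_L2_wderiv Hf, H10_L2_wderiv Hg).
have Lcf := L2_scale c Lf; have Lcf' := L2_scale c Lf'.
have [Lpf Lpg] := (L2_prim L_gt0 Lf', L2_prim L_gt0 Lg').
apply: prim_H10; [exact: L2_add|exact: L2_add| |].
  by rewrite ipDl ?ipZl// fz gz mulr0 addr0.
have -> : prim L (c *: wderiv L f + wderiv L g) = c *: prim L (wderiv L f) + prim L (wderiv L g).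
  by apply/funext => x; rewrite primD// primZ.
by apply: L2eq_add => //; [exact: L2_scale|exact: L2eq_scale].
Qed.

Lemma H10_sub f g : H10 L f -> H10 L g ->
  H10 L (f - g) /\ wderiv L (f - g) ~ wderiv L f - wderiv L g.
Proof. by move=> Hf Hg; have := H10_lin (-1) Hg Hf; rewrite !scaleN1r !(addrC (- _)). Qed.

Lemma H10_0 : H10 L 0 /\ wderiv L 0 ~ 0.
Proof.
apply: prim_H10 => //; first by rewrite -(scale0r (0 : R -> R)) ipZl ?mul0r.
apply: eq_L2eq => x _; rewrite -[LHS]/(0 : R) /prim.
by rewrite -(scale0r (0 : R -> R)) ipZl ?mul0r//; exact: L2_ray.
Qed.

Lemma H10_scale c f : H10 L f -> H10 L (c *: f) /\ wderiv L (c *: f) ~ c *: wderiv L f.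
Proof.
move=> Hf; have [H0 z] := H10_0; have [H E] := H10_lin c Hf H0.
move: H E; rewrite addr0 => H E; split => //.
have Lf := H10_L2_wderiv Hf; have L0 := H10_L2_wderiv H0; have Lc := H10_L2_wderiv H.
have Lcf := L2_scale c Lf.
apply: (L2eq_trans Lc (L2_add Lcf L0) Lcf) => //.
by rewrite -[X in _ ~ X]addr0; exact: L2eq_add.
Qed.

End weak_derivatives.

(** * Wirtinger's inequality and the Poisson equation *)

Section wirtinger.
Context {R : realType}.
Variable L : R.
Hypothesis L_gt0 : 0 < L.
Local Notation D := (`]0, L[%classic : set R).
Implicit Types f g phi : R -> R.

(** Handles products of a compactly supported factor with one that is singular or uncontrolled at
    the ends, such as the cotangent in [wirtinger_test]. *)
Lemma continuous_supp (al be : R) f : 0 < al -> be < L ->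
  (forall x, 0 < x < L -> {for x, continuous f}) ->
  (forall x, x \notin `[al, be] -> f x = 0) -> continuous f.
Proof.
move=> a0 bL cf z x.
have [/andP[x1 x2]|xD] := boolP (0 < x < L); first by apply: cf; rewrite x1.
have xn : x \notin `[al, be].
  apply: contra xD; rewrite in_itv/= => /andP[h1 h2].
  by rewrite (lt_le_trans a0)// (le_lt_trans h2).
have nz : \near x, f x = 0.
  have : nbhs x (~` `[al, be]%classic).
    apply: open_nbhs_nbhs; split; last exact/negP.
    by apply: closed_openC; exact: interval_closed.
  by apply: filterS => y /negP; exact: z.
rewrite /continuous_at (z x xn).
by apply: cvg_near_cst.
Qed.

(* Integrates (phi' - w phi)^2 >= 0 with w(x) = k cot(k x), k = pi / L, which solves w' = - k^2 - w^2. *)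
Lemma wirtinger_test phi : test_fun D phi ->
  L2norm L phi <= L / pi * L2norm L (phi^`())%classic.
Proof.
move=> t; have s := test_fun_smooth t; have s' := smooth_derive s.
have cphi := smooth_continuous s; have cphi' := smooth_continuous s'.
have Lphi := L2_test_fun t; have Lphi' := L2_test_derive L_gt0 t.
have cL : L / 2 \in `]0, L[ by have L0 := L_gt0; rewrite in_itv/=; apply/andP; split; lra.
have [al [be [/itvP A /itvP B ab z]]] := test_fun_supp cL t.
set k : R := pi / L; have k0 : 0 < k by rewrite divr_gt0// pi_gt0.
have sin0 x : 0 < x < L -> 0 < sin (k * x).
  move=> /andP[x0 xL]; apply: sin_gt0_pi; apply/andP; split; first exact: mulr_gt0.
  by rewrite /k mulrAC ltr_pdivrMr// ltr_pM2l// pi_gt0.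
pose w x := k * (cos (k * x) / sin (k * x)).
have dw x : 0 < x < L -> is_derive x 1 w (- k ^+ 2 - w x ^+ 2).
  move=> /sin0 sx; have sx0 : sin (k * x) != 0 by rewrite gt_eqF.
  have dk : is_derive x 1 (fun x => k * x) k.
    by apply: is_derive_eq; rewrite /GRing.scale/= mulr1.
  have dc := @is_derive1_comp _ cos (fun x => k * x) x _ _ (is_derive_cos (k * x)) dk.
  have ds := @is_derive1_comp _ sin (fun x => k * x) x _ _ (is_derive_sin (k * x)) dk.
  have dsV := @is_deriveV _ (sin \o (fun x => k * x)) x _ 1 sx0 ds.
  apply: is_derive_eq (is_deriveZ k (is_deriveM dc dsV)) _.
  rewrite /w /GRing.scale/=.
  by have := cos2Dsin2 (k * x); move: sx0; set u := sin _; set v := cos _ => u0 uv; field : uv.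
pose H x := w x * (phi x * phi x).
pose h x := (- k ^+ 2 - w x ^+ 2) * (phi x * phi x) + w x * (2 * phi x * (phi^`())%classic x).
have dphi (x : R) : is_derive x 1 phi ((phi^`())%classic x).
  by rewrite derive1E; apply/derivableP; exact: smooth_derivable.
have cw x : 0 < x < L -> {for x, continuous w}.
  by move=> xL; apply/differentiable_continuous/derivable1_diffP; case: (dw x xL).
have dH x : 0 < x < L -> is_derive x 1 H (h x).
  move=> xL; apply: is_derive_eq (is_deriveM (dw x xL) (is_deriveM (dphi x) (dphi x))) _.
  by rewrite -[(phi * phi) x]/(phi x * phi x) /h /GRing.scale/=; ring.
have z' x : x \notin `[al, be] -> (phi^`())%classic x = 0.
  move=> xn; rewrite derive1E (@near_eq_derive _ _ _ phi (cst 0)) ?derive_cst//.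
  have : nbhs x (~` `[al, be]%classic).
    apply: open_nbhs_nbhs; split; last exact/negP.
    by apply: closed_openC; exact: interval_closed.
  by apply: filterS => y /negP; exact: z.
have [a0 bL] : 0 < al /\ be < L by rewrite A B.
have cH : continuous H.
  apply: (@continuous_supp al be) => //.
    by move=> x xL; apply: cvgM; [exact: cw|apply: cvgM; exact: cphi].
  by move=> x /z zx; rewrite /H zx !mulr0.
have ch : continuous h.
  apply: (@continuous_supp al be) => //.
    move=> x xL; apply: cvgD; apply: cvgM.
    - apply: cvgB; first exact: cvg_cst.
      by apply: (@continuous_comp _ _ _ w (fun y => y ^+ 2)); [exact: cw|exact: exprn_continuous].
    - by apply: cvgM; exact: cphi.
    - exact: cw.
    - by apply: cvgM; [apply: cvgM; [exact: cvg_cst|exact: cphi]|exact: cphi'].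
  by move=> x zx; rewrite /h z// z'// !mulr0 addr0.
have aH : AC L H h by apply: AC_FTC => //; exact: continuous_subspaceT.
have [p0 pL] := test_fun_bnd t.
have h0 : ip L h (cst 1) = 0 by apply: (AC_ip_zero L_gt0 aH); rewrite /H ?p0 ?pL !mulr0.
have key : k ^+ 2 * ip L phi phi <= ip L (phi^`())%classic (phi^`())%classic.
  have Lh := aH.1.
  pose u x := (phi^`())%classic x - w x * phi x.
  (* Completion of the square: phi'^2 = k^2 phi^2 + (w phi^2)' + (phi' - w phi)^2, where the middle
     term [h] integrates to 0. *)
  have E : ip L (phi^`())%classic (phi^`())%classic =
      \int[lebesgue_measure]_(x in D) (k ^+ 2 * (phi x * phi x) + h x + u x ^+ 2).
    by apply: eq_Rintegral => x _; rewrite /u /h; ring.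
  have ikp := integrableZl (measurable_dom L) (k ^+ 2) (L2_mul_integrable Lphi Lphi).
  have ih := L2_integrable Lh.
  have iu : lebesgue_measure.-integrable D (EFin \o (fun x => u x ^+ 2)).
    suff Lu : L2 L u by have [] := (L2P L u).1 Lu.
    apply: L2_continuous; apply: (@continuous_supp al be) => //.
      move=> x xL; apply: cvgB; first exact: cphi'.
      by apply: cvgM; [exact: cw|exact: cphi].
    by move=> x zx; rewrite /u z// z'// mulr0 subr0.
  have ikph : lebesgue_measure.-integrable D (EFin \o (fun x => k ^+ 2 * (phi x * phi x) + h x)).
    by have := integrableD (measurable_dom L) ikp ih; apply: eq_integrable.
  rewrite E RintegralD// RintegralD// RintegralZl//; last exact: L2_mul_integrable.
  have -> : \int[lebesgue_measure]_(x in D) h x = 0.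
    by rewrite -[RHS]h0; apply: eq_Rintegral => x _; rewrite mulr1.
  by rewrite addr0 lerDl; apply: Rintegral_ge0 => x _; exact: sqr_ge0.
have cP : 0 <= L / pi by rewrite divr_ge0 ?pi_ge0// ltW.
have e1 : 0 <= L2norm L phi by exact: L2norm_ge0.
have e2 : 0 <= L / pi * L2norm L (phi^`())%classic by apply: mulr_ge0 => //; exact: L2norm_ge0.
suff : L2norm L phi ^+ 2 <= (L / pi * L2norm L (phi^`())%classic) ^+ 2 by rewrite ler_pXn2r.
rewrite exprMn !L2norm_sqr.
have -> : (L / pi) ^+ 2 = (k ^+ 2)^-1.
  by rewrite /k !expr_div_n invf_div.
by rewrite mulrC ler_pdivlMr ?exprn_gt0// mulrC.
Qed.

Theorem wirtinger f : H10 L f -> L2norm L f <= L / pi * L2norm L (wderiv L f).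
Proof.
move=> Hf; have [Hf1 H] := Hf.
have c0 : 0 < L / pi by rewrite divr_gt0// pi_gt0.
have c1 : 0 < 1 + L / pi by rewrite addr_gt0.
apply/ler_addgt0Pr => e e0.
have [phi [t fphi]] := H (e / (1 + L / pi)) (divr_gt0 e0 c1).
have [Hphi phi'] := test_fun_H1 L_gt0 t; have [Hd d'] := H1_sub L_gt0 Hf1 Hphi.
have Lphi := L2_test_fun t; have Lphi' := L2_test_derive L_gt0 t.
have [[Lwphi _] [Lwd _]] := (H1_wderiv Hphi, H1_wderiv Hd); have [Lwf _] := H1_wderiv Hf1.
have Lf := H10_L2 Hf.
have [n1 n2] := H1norm_ge L (f - phi).
have E : L2norm L (wderiv L (f - phi)) = L2norm L (wderiv L f - (phi^`())%classic).
  apply: L2eq_norm => //; first exact: L2_sub.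
  apply: (L2eq_trans Lwd (L2_sub Lwf Lwphi) (L2_sub Lwf Lphi')) => //.
  exact: L2eq_sub.
have b1 : L2norm L f <= L2norm L (f - phi) + L2norm L phi.
  by have := L2norm_triangle (L2_sub Lf Lphi) Lphi; rewrite subrK.
have b2 : L2norm L (phi^`())%classic <= L2norm L (wderiv L f - (phi^`())%classic) + L2norm L (wderiv L f).
  have := L2norm_triangle (L2_sub Lphi' Lwf) Lwf; rewrite subrK => h.
  by rewrite L2norm_distC.
have b3 := wirtinger_test t.
move: fphi; rewrite ltr_pdivlMr// => fphi.
have b4 : L / pi * L2norm L (phi^`())%classic <= L / pi * H1norm L (f - phi) + L / pi * L2norm L (wderiv L f).
  rewrite -mulrDr ler_pM2l// (le_trans b2)// lerD2r -E//.
have : H1norm L (f - phi) * (1 + L / pi) = H1norm L (f - phi) + L / pi * H1norm L (f - phi) by ring.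
lra.
Qed.

Definition H1const := Num.sqrt 2 * (1 + L / pi).

Lemma H1const_ge0 : 0 <= H1const.
Proof. by rewrite mulr_ge0 ?sqrtr_ge0// addr_ge0// divr_ge0 ?pi_ge0// ltW. Qed.

Lemma H1norm_wderiv f : H10 L f -> H1norm L f <= H1const * L2norm L (wderiv L f).
Proof.
move=> Hf; rewrite /H1const -mulrA; have c0 : 0 <= L / pi by rewrite divr_ge0 ?pi_ge0// ltW.
have n0 := L2norm_ge0 L (wderiv L f); have W := wirtinger Hf.
by apply: H1norm_le; [rewrite (le_trans W)// mulrDl mul1r lerDr|rewrite mulrDl mul1r lerDl mulr_ge0].
Qed.

(** Used with c a dual norm: the H^1 norm on the right is at most [H1const] times the norm of the
    derivative, one factor of which cancels. *)
Lemma wderiv_energy_bound f (c : R) : H10 L f ->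
  `|ip L (wderiv L f) (wderiv L f)| <= c * H1norm L f -> 0 <= c ->
  L2norm L (wderiv L f) <= c * H1const.
Proof.
move=> Hf; rewrite -L2norm_sqr ger0_norm ?sqr_ge0// => h c0.
have n0 := L2norm_ge0 L (wderiv L f).
have := le_trans h (ler_wpM2l c0 (H1norm_wderiv Hf)).
rewrite mulrA; move: n0; rewrite le_eqVlt => /predU1P[<-|n0]; last by rewrite expr2 ler_pM2r.
by move=> _; apply: mulr_ge0 => //; exact: H1const_ge0.
Qed.

Lemma H10_ibp G F v : AC L G F -> H10 L v -> ip L G (wderiv L v) = - ip L F v.
Proof.
move=> aG Hv; have [V [aV V0 VL vV]] := H10_AC L_gt0 Hv.
have := AC_ip_zero L_gt0 (AC_mul L_gt0 aG aV).
rewrite -[(G * V) 0]/(G 0 * V 0) -[(G * V) L]/(G L * V L) V0 VL !mulr0 => /(_ erefl erefl).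
rewrite ipDl ?L2_cst//; last 2 first.
- by rewrite mulrC; exact: AC_L2_mul aV aG.1.
- exact: AC_L2_mul aG aV.1.
rewrite !ip_mul1 -(L2eq_ipr (H10_L2 Hv) (AC_L2 L_gt0 aV) aG.1 vV) => /eqP.
by rewrite addrC addr_eq0 => /eqP.
Qed.

(** h_x is the primitive of F whose additive constant c gives it mean zero, so that h vanishes at
    both ends. *)
Lemma poisson_solution F : L2 L F -> exists h c,
  H10 L h /\ L2eq L (wderiv L h) (fun x => c + prim L F x).
Proof.
move=> LF; pose c := - (ip L (prim L F) (cst 1) / L).
pose G x := c + prim L F x; have aG : AC L G F by exact: AC_prim.
have LG := AC_L2 L_gt0 aG.
exists (prim L G), c.
apply: (prim_H10 L_gt0) => //; first exact: L2_prim.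
change (ip L (cst c + prim L F) (cst 1) = 0).
rewrite ipDl//; last exact: L2_prim.
have -> : cst c = c *: cst 1 :> (R -> R) by apply/funext => x; rewrite -[RHS]/(c * 1) mulr1.
rewrite ipZl// -L2norm_sqr L2norm_cst ?(ltW L_gt0)// normr1 mul1r sqr_sqrtr ?(ltW L_gt0)//.
by rewrite /c mulNr divfK ?addNr// gt_eqF.
Qed.

Lemma poisson_weak F h c v : L2 L F -> H10 L h ->
  L2eq L (wderiv L h) (fun x => c + prim L F x) -> H10 L v ->
  ip L (wderiv L h) (wderiv L v) = - ip L F v.
Proof.
move=> LF Hh hG Hv; rewrite -(H10_ibp (AC_prim c LF) Hv).
have LG := AC_L2 L_gt0 (AC_prim c LF).
by apply: L2eq_ipl hG => //; exact: H10_L2_wderiv.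
Qed.

Lemma calLP a f g : L2 L (a * f + g) -> H10 L (calL L a f g) /\
  forall v, H10 L v -> ip L (wderiv L (calL L a f g)) (wderiv L v) = - ip L (a * f + g) v.
Proof.
move=> LF; set P := [set h | H10 L h /\
    Hm1_eq L (Hm1_dxx L h) (Hm1_of_L2 L (fun x => a x * f x + g x))].
have [Hh hF] : P (calL L a f g).
  apply: xgetPex; have [h [c [Hh hG]]] := poisson_solution LF.
  exists h; split => // v Hv; rewrite /Hm1_dxx /Hm1_of_L2.
  apply/eqP; rewrite eqr_oppLR; apply/eqP.
  exact: (poisson_weak LF Hh hG Hv).
split => // v Hv; have := hF v Hv; rewrite /Hm1_dxx /Hm1_of_L2 => /eqP.
by rewrite eqr_oppLR => /eqP.
Qed.

(** Regularity in H^2: testing with the difference of u and the explicit solution shows that they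
    have the same derivative. This makes u_x an admissible factor in the multiplier q u_x. *)
Lemma weak_poisson_AC F u : L2 L F -> H10 L u ->
  (forall v, H10 L v -> ip L (wderiv L u) (wderiv L v) = - ip L F v) ->
  exists m, AC L m F /\ L2eq L (wderiv L u) m.
Proof.
move=> LF Hu uF; have [h [c [Hh hG]]] := poisson_solution LF.
have [Hd d'] := H10_sub L_gt0 Hu Hh.
have [Lu Lh] := (H10_L2_wderiv Hu, H10_L2_wderiv Hh); have Ld := H10_L2_wderiv Hd.
exists (fun x => c + prim L F x); have aG := AC_prim c LF; split => //.
apply: (L2eq_trans Lu Lh (AC_L2 L_gt0 aG)) => //.
apply/eqP; rewrite /L2eq -sqrf_eq0 L2norm_sqr; apply/eqP.
have Ls := L2_sub Lu Lh.
rewrite -(L2eq_ipr Ld Ls Ls d') ipBl// uF// (poisson_weak LF Hh hG)//.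
by rewrite subrr.
Qed.

End wirtinger.

(** * Inequalities almost everywhere and multiplication by L^oo functions *)

Section almost_everywhere.
Context {R : realType}.
Variable L : R.
Local Notation mu := (@lebesgue_measure R).
Local Notation D := (`]0, L[%classic : set R).
Implicit Types f g a b : R -> R.

Lemma ae_onS (P Q : R -> Prop) : (forall x, D x -> P x -> Q x) -> ae_on L P -> ae_on L Q.
Proof.
move=> PQ; rewrite /ae_on; apply: (@filterS (measurableTypeR R)) => x H Dx.
by apply: PQ => //; exact: H.
Qed.

Lemma ae_onI (P Q : R -> Prop) : ae_on L P -> ae_on L Q -> ae_on L (fun x => P x /\ Q x).
Proof.
rewrite /ae_on; apply: (@filterS2 (measurableTypeR R)) => x HP HQ Dx.
by split; [exact: HP|exact: HQ].
Qed.

Lemma ae_Rintegral_le f g : mu.-integrable D (EFin \o f) -> mu.-integrable D (EFin \o g) ->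
  ae_on L (fun x => f x <= g x) ->
  \int[mu]_(x in D) f x <= \int[mu]_(x in D) g x.
Proof.
move=> fi gi fg.
have mf : measurable_fun D f by case/integrableP : fi => /measurable_EFinP.
have mg : measurable_fun D g by case/integrableP : gi => /measurable_EFinP.
rewrite -subr_ge0 -RintegralB//.
(* g - f agrees almost everywhere with its positive part, which is nonnegative everywhere. *)
have -> : \int[mu]_(x in D) (g x - f x) = \int[mu]_(x in D) (Num.max (g x - f x) 0).
  congr fine; apply: ae_eq_integral => //.
  - by apply/measurable_EFinP; exact: measurable_funB.
  - apply/measurable_EFinP.
    apply: (@measurable_maxr _ _ _ D (fun x => g x - f x) (cst 0)) => //.
    exact: measurable_funB.
  - by apply: ae_onS fg => x Dx H; rewrite max_l// subr_ge0.
by apply: Rintegral_ge0 => x _; rewrite le_max lexx orbT.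
Qed.

Lemma L2_ae_mul b f (M : R) : measurable_fun D b -> 0 <= M ->
  ae_on L (fun x => `|b x| <= M) -> L2 L f ->
  L2 L (b * f) /\ L2norm L (b * f) <= M * L2norm L f.
Proof.
move=> mb M0 bM Lf; have mf := L2_measurable Lf.
have mbf : measurable_fun D (b * f) by exact: (measurable_funM mb mf).
have [_ i2] := (L2P L (M *: f)).1 (L2_scale M Lf).
have Hae : ae_on L (fun x => (b * f) x ^+ 2 <= (M *: f) x ^+ 2).
  apply: ae_onS bM => x Dx H.
  rewrite -[(b * f) x]/(b x * f x) -[(M *: f) x]/(M * f x) !exprMn ler_wpM2r ?sqr_ge0//.
  by rewrite -[b x ^+ 2]real_normK ?num_real// ler_sqr ?nnegrE.
have Lbf : L2 L (b * f).
  apply/L2P; split => //; apply/integrableP; split.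
    by apply/measurable_EFinP; exact: measurable_funX.
  move/integrableP : i2 => [_]; apply: le_lt_trans.
  apply: ae_ge0_le_integral => //.
  - by do 2 apply: measurableT_comp => //; exact: measurable_funX.
  - do 2 apply: measurableT_comp => //; apply: measurable_funX.
    exact: (L2_measurable (L2_scale M Lf)).
  - apply: ae_onS Hae => x Dx H.
    by rewrite /= lee_fin ger0_norm ?sqr_ge0// [leRHS]ger0_norm ?sqr_ge0.
split => //; rewrite -[M in leRHS]ger0_norm// -L2normZ// !L2normE ler_wsqrtr//.
by apply: ae_Rintegral_le; [exact: L2_mul_integrable|
  exact: L2_mul_integrable (L2_scale M Lf) (L2_scale M Lf)|exact: Hae].
Qed.

Lemma LinfP a : Linf L a -> [/\ measurable_fun D a, 0 <= Linfnorm L a &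
  ae_on L (fun x => `|a x| <= Linfnorm L a)].
Proof.
rewrite /Linf inE => /andP[]; rewrite inE/= => ma; rewrite inE/= /finite_norm /Linfnorm unlock.
have muT : (0 < mu [set: R])%E by rewrite -set_itvNyy lebesgue_measure_itv/= ltry.
rewrite muT => afin; set N := ess_sup _ _ in afin *.
have N0 : (0 <= N)%E by apply: ess_sup_gee => //; apply: nearW => x /=.
have NE : N = (fine N)%:E by rewrite fineK// ge0_fin_numE.
split; [by apply/(measurable_restrictT _ (measurable_dom L))|exact: fine_ge0|].
have := ess_sup_ge mu (abse \o (EFin \o a \_ D)); rewrite -/N NE.
by apply: filterS => x /= + Dx; rewrite lee_fin patchE mem_set.
Qed.

Lemma Linf_mul a f : Linf L a -> L2 L f ->
  L2 L (a * f) /\ L2norm L (a * f) <= Linfnorm L a * L2norm L f.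
Proof. by move=> /LinfP[ma a0 aM]; exact: L2_ae_mul. Qed.

Lemma Linf_bounded b (M : R) : measurable_fun D b -> (forall x, D x -> `|b x| <= M) -> Linf L b.
Proof.
move=> mb bM; rewrite /Linf inE; apply/andP; split.
  by rewrite inE/=; apply/(measurable_restrictT _ (measurable_dom L)).
rewrite inE/= /finite_norm unlock.
have muT : (0 < mu [set: R])%E by rewrite -set_itvNyy lebesgue_measure_itv/= ltry.
rewrite muT; apply: (@le_lt_trans _ _ `|M|%:E); last exact: ltry.
apply/ess_supP; apply: nearW => x /=; rewrite lee_fin patchE; case: ifPn => [/set_mem Dx|_].
  by rewrite (le_trans (bM x Dx))// ler_norm.
by rewrite normr0.
Qed.

Lemma Linf_within_continuous b : {within `[0, L], continuous b} -> Linf L b.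
Proof.
move=> cb; have [M [_ HM]] := within_continuous_bounded cb.
apply: (@Linf_bounded _ M); last by move=> x /dom_le; exact: HM.
by apply: measurable_funS (within_continuous_measurable cb);
  [exact: measurable_itv|exact: subset_itv_oo_cc].
Qed.

End almost_everywhere.

(** * Two forms of the difference quotient *)

Section difference_quotients.
Context {R : realType}.
Implicit Types (f : R -> R) (t l : R).

Lemma cvg_shift_dnbhs t : (h + t) @[h --> (0:R)^'] --> t^'.
Proof.
move=> A; rewrite /dnbhs /within/= => /nbhs_ballP[e /= e0 H].
apply/nbhs_ballP; exists e => //= h; rewrite /ball/= sub0r normrN => he h0.
apply: H; last by rewrite -subr_eq0 addrK.
by rewrite /ball/= opprD addrCA subrr addr0 normrN.
Qed.

Lemma cvg_unshift_dnbhs t : (s - t) @[s --> t^'] --> (0:R)^'.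
Proof.
move=> A; rewrite /dnbhs /within/= => /nbhs_ballP[e /= e0 H].
apply/nbhs_ballP; exists e => //= s; rewrite /ball/= => se s0.
by apply: H; rewrite ?subr_eq0// /ball/= sub0r opprB.
Qed.

Lemma is_derive_quotient f t l :
  (s - t)^-1 * (f s - f t) @[s --> t^'] --> l -> is_derive t 1 f l.
Proof.
move=> H; have sh : h^-1 *: (f (h *: 1 + t) - f t) @[h --> 0^'] --> l.
  have : ((fun s => (s - t)^-1 * (f s - f t)) \o (fun h => h + t)) @ (0:R)^' --> l.
    by apply: cvg_comp H; exact: cvg_shift_dnbhs.
  apply: cvg_trans; apply: near_eq_cvg.
  by near=> h; rewrite /= addrK /GRing.scale/= mulr1.
by apply: DeriveDef; [apply/cvg_ex; exists l|exact/cvg_lim].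
Unshelve. all: by end_near. Qed.

Lemma is_derive_quotientP f t l : is_derive t 1 f l ->
  (s - t)^-1 * (f s - f t) @[s --> t^'] --> l.
Proof.
move=> [/cvg_ex[l' df] lE].
have ll : l' = l by rewrite -lE; symmetry; exact/cvg_lim.
rewrite ll in df.
have : ((fun h => h^-1 *: ((f \o shift t) (h *: 1) - f t)) \o (fun s => s - t)) @ t^' --> l.
  by apply: cvg_comp df; exact: cvg_unshift_dnbhs.
apply: cvg_trans; apply: near_eq_cvg.
by near=> s; rewrite /= /GRing.scale/= mulr1 subrK.
Unshelve. all: by end_near. Qed.

Lemma within_dnbhs_interior (T : topologicalType) (t : T) (A P : set T) :
  nbhs t A -> within A t^' P -> t^' P.
Proof. by move=> nA; apply: filterS2 nA => x Ax H; move=> /H; exact. Qed.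

End difference_quotients.

(** * One-sided differential calculus on [0, L] *)

Section C2_on_interval.
Context {R : realType}.
Variable L : R.
Hypothesis L_gt0 : 0 < L.
Implicit Types f g : R -> R.

Lemma derivableI_interior f x : derivableI L f -> 0 < x < L -> is_derive x 1 f (derivI L f x).
Proof.
move=> df xL; have x01 : x \in `[0, L].
  by move/andP: xL => [h1 h2]; rewrite in_itv/= !ltW.
have {}df : dquotI L f x @ within `[0, L] x^' --> derivI L f x := df x x01.
apply: is_derive_quotient => A /df; apply: within_dnbhs_interior.
apply: (@filterS _ _ _ `]0, L[%classic); first exact: subset_itv_oo_cc.
by apply: open_nbhs_nbhs; split => //; exact: interval_open.
Qed.

Lemma derivableI_continuous f : derivableI L f -> {within `[0, L], continuous f}.
Proof.
move=> df; apply/subspace_continuousP => x xL.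
have /cvgrPdist_lt/(_ 1 ltr01) H : dquotI L f x @ within `[0, L] x^' --> derivI L f x := df x xL.
set l := derivI L f x in H.
have l0 : 0 < `|l| + 1 by rewrite ltr_wpDl.
apply/cvgrPdist_lt => e e0.

have nx : nbhs x (fun y => `|x - y| < e / (`|l| + 1)).
  by apply: (@cvgr_dist_lt _ _ _ (nbhs x) _ id x) => //; rewrite divr_gt0.
have H2 : nbhs x (fun y => y != x -> `[0, L]%classic y -> `|l - dquotI L f x y| < 1) := H.
change (nbhs x (fun y => `[0, L]%classic y -> `|f x - f y| < e)).
move: H2 nx; apply: filterS2 => y {}H hy yL.
have [->|yx] := eqVneq y x; first by rewrite subrr normr0.
have {}H := H yx yL; rewrite /dquotI in H.
have E : f y - f x = (y - x) * ((y - x)^-1 * (f y - f x)).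
  by rewrite mulrA divff ?mul1r// subr_eq0.
rewrite distrC E normrM.
have h2 : `|(y - x)^-1 * (f y - f x)| <= `|l| + 1.
  rewrite -(subrK l ((y - x)^-1 * (f y - f x))) (le_trans (ler_normD _ _))//.
  by rewrite distrC addrC lerD2l ltW.
rewrite (le_lt_trans (ler_wpM2l (normr_ge0 _) h2))//.
by rewrite -ltr_pdivlMr// distrC.
Qed.

Lemma C2I_continuous f : C2I L f -> [/\ {within `[0, L], continuous f},
  {within `[0, L], continuous (derivI L f)} &
  {within `[0, L], continuous (derivI L (derivI L f))}].
Proof. by move=> [d1 d2 c]; split => //; exact: derivableI_continuous. Qed.

Lemma C2I_AC f : C2I L f -> AC L f (derivI L f) /\ AC L (derivI L f) (derivI L (derivI L f)).
Proof.
move=> Cf; have [c0 c1 c2] := C2I_continuous Cf; have [d1 d2 _] := Cf.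
split.
  by apply: (AC_FTC c0 c1) => x xL; exact: (derivableI_interior d1 xL).
by apply: (AC_FTC c1 c2) => x xL; exact: (derivableI_interior d2 xL).
Qed.

(** Every point of [0, L], end points included, is a limit of other points of the interval: one
    moves right from the left half and left from the right half. Hence the limit in [derivI] is
    unique. *)
Lemma within_itv_proper x : 0 <= x <= L -> ProperFilter (within `[0, L] x^').
Proof.
move=> /andP[x0 xL]; apply: Build_ProperFilter_ex => P.
rewrite /within /dnbhs /within/= => /nbhs_ballP[e /= e0 H].
have L0 := L_gt0.
have m0 : 0 < Num.min (e / 2) (L / 2) by rewrite lt_min !divr_gt0.
have me : Num.min (e / 2) (L / 2) < e by rewrite gt_min; apply/orP; left; lra.
have mL : Num.min (e / 2) (L / 2) <= L / 2 by rewrite ge_min lexx orbT.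
set m := Num.min _ _ in m0 me mL.
have [xL2|xL2] := leP x (L / 2).
  exists (x + m); apply: H; rewrite /ball/=.
  - by rewrite opprD addrA subrr sub0r normrN gtr0_norm.
  - by rewrite -subr_eq0 addrAC subrr add0r gt_eqF.
  - by rewrite in_itv/=; apply/andP; split; lra.
exists (x - m); apply: H; rewrite /ball/=.
- by rewrite opprB addrCA subrr addr0 gtr0_norm.
- by rewrite -subr_eq0 addrAC subrr add0r oppr_eq0 gt_eqF.
- by rewrite in_itv/=; apply/andP; split; lra.
Qed.

(** Equality is assumed on [0, L] only, so that the lemma also applies to f = [derivI L g], which
    agrees with g' there, and yields the second derivative. *)
Lemma derivI_smooth f g x : {in `[0, L], f =1 g} -> smooth g -> 0 <= x <= L ->
  (dquotI L f x @ within `[0, L] x^' --> (g^`())%classic x) /\ derivI L f x = (g^`())%classic x.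
Proof.
move=> fg sg xL; have pf := within_itv_proper xL.
have dg : is_derive x 1 g ((g^`())%classic x).
  by rewrite derive1E; apply/derivableP; exact: smooth_derivable.
have H : dquotI L f x @ within `[0, L] x^' --> (g^`())%classic x.
  have : (fun s => (s - x)^-1 * (g s - g x)) @ (within `[0, L]%classic x^') --> (g^`())%classic x.
    by apply: cvg_within_filter; exact: is_derive_quotientP.
  apply: cvg_trans; apply: near_eq_cvg.
  apply: (@filterS _ _ _ `[0, L]%classic); last exact: withinT.
  by move=> y yL; rewrite /dquotI !fg// in_itv.
by split => //; exact: cvg_lim.
Qed.

Lemma smooth_C2I g : smooth g -> C2I L g /\ forall x, 0 <= x <= L -> derivI L g x = (g^`())%classic x.
Proof.
move=> sg; have sg' := smooth_derive sg.
have D1 x : 0 <= x <= L -> derivI L g x = (g^`())%classic x.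
  by move=> xL; case: (derivI_smooth (fun _ _ => erefl) sg xL).
have gg : {in `[0, L], derivI L g =1 (g^`())%classic} by move=> x; rewrite in_itv/=; exact: D1.
split => //; split.
- move=> x; rewrite in_itv/= => xL; apply/cvg_ex; eexists.
  by case: (derivI_smooth (fun _ _ => erefl) sg xL) => + _; apply.
- move=> x; rewrite in_itv/= => xL; apply/cvg_ex; eexists.
  by case: (derivI_smooth gg sg' xL) => + _; apply.
- have : {within `[0, L], continuous ((g^`())^`())%classic}.
    by apply/continuous_subspaceT/smooth_continuous; exact: smooth_derive.
  apply: subspace_eq_continuous => x; rewrite inE/= in_itv/= => xL.
  by symmetry; case: (derivI_smooth gg sg' xL).
Qed.

Lemma C2I_Linf f : C2I L f -> [/\ Linf L f, Linf L (derivI L f) & Linf L (derivI L (derivI L f))].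
Proof. by move=> /C2I_continuous[c0 c1 c2]; split; exact: Linf_within_continuous. Qed.

Lemma Kc_ge q p : C2I L q -> C2I L p ->
  0 <= Kc L q p /\ forall x, 0 <= x <= L -> p x - 2^-1 * derivI L q x <= Kc L q p.
Proof.
move=> /C2I_continuous[_ cq _] /C2I_continuous[cp _ _].
have [M [M0 HM]] := within_continuous_bounded cq.
have [N [N0 HN]] := within_continuous_bounded cp.
have hs x : 0 <= x <= L -> Num.max (p x - 2^-1 * derivI L q x) 0 <= Kc L q p.
  move=> xL; apply: ub_le_sup; last by exists x => //=; rewrite in_itv.
  exists (N + M) => _ [y /= yL <-]; rewrite in_itv/= in yL.
  rewrite ge_max addr_ge0// andbT.
  have := HM y yL; have := HN y yL; rewrite !ler_norml; lra.
split; last by move=> x /hs; rewrite ge_max => /andP[].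
by have := hs 0; rewrite lexx ltW//= ge_max => /(_ isT)/andP[].
Qed.

End C2_on_interval.

(** * Comparison of M and E_0 with the energy *)

Section functional_bounds.
Context {R : realType}.
Variables (L : R) (a p q : R -> R).
Hypothesis L_gt0 : 0 < L.
Hypotheses (aL : Linf L a) (pL : Linf L p) (qL : Linf L q).
Local Notation mu := (@lebesgue_measure R).
Local Notation D := (`]0, L[%classic : set R).
Local Notation "'P'" := (L / pi).
Implicit Types f g : R -> R.

Lemma energyE f g : L2 L (wderiv L f) -> L2 L g ->
  energy L f g = 2^-1 * (L2norm L (wderiv L f) ^+ 2 + L2norm L g ^+ 2).
Proof.
move=> Lf Lg; rewrite /energy RintegralD//; last 2 first.
- by have [] := (L2P L _).1 Lf.
- by have [] := (L2P L _).1 Lg.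
by rewrite !L2norm_sqr !ip_sqr.
Qed.

Lemma MfunE f g : Mfun L q p f g = ip L (p * f) g + ip L (q * g) (wderiv L f).
Proof. by []. Qed.

Lemma P_gt0 : 0 < P. Proof. by rewrite divr_gt0// pi_gt0. Qed.

(** Cauchy-Schwarz, with Wirtinger's inequality for the term in p, which is the origin of L / pi;
    then x y <= (x^2 + y^2) / 2. *)
Lemma Mfun_bound f g : H10 L f -> L2 L g -> `|Mfun L q p f g| <= qpnorm L q p * energy L f g.
Proof.
move=> Hf Lg; have Lf := H10_L2 Hf; have Lf' := H10_L2_wderiv Hf.
rewrite MfunE energyE//.
have [Lpf Bpf] := Linf_mul pL Lf; have [Lqg Bqg] := Linf_mul qL Lg.
have [_ p0 _] := LinfP pL; have [_ q0 _] := LinfP qL.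
have W := wirtinger L_gt0 Hf.
have c1 := cauchy_schwarz Lpf Lg; have c2 := cauchy_schwarz Lqg Lf'.
have n1 := L2norm_ge0 L (wderiv L f); have n2 := L2norm_ge0 L g.
set x := L2norm L (wderiv L f) in n1 W c2 *; set y := L2norm L g in n2 c1 Bqg *.
have d1 : `|ip L (p * f) g| <= Linfnorm L p * (P * x) * y.
  rewrite (le_trans c1)// ler_wpM2r// (le_trans Bpf)// ler_wpM2l//.
have d2 : `|ip L (q * g) (wderiv L f)| <= Linfnorm L q * y * x by rewrite (le_trans c2)// ler_wpM2r.
rewrite (le_trans (ler_normD _ _))// (le_trans (lerD d1 d2))//.
have -> : Linfnorm L p * (P * x) * y + Linfnorm L q * y * x = qpnorm L q p * (x * y).
  by rewrite /qpnorm; ring.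
apply: ler_wpM2l; first by rewrite addr_ge0// mulr_ge0// ltW// P_gt0.
have : 0 <= (x - y) ^+ 2 by exact: sqr_ge0.
by rewrite sqrrB; lra.
Qed.

Lemma L2_source f g : L2 L f -> L2 L g -> L2 L (a * f + g).
Proof. by move=> Lf Lg; apply: L2_add => //; case: (Linf_mul aL Lf). Qed.

Lemma wderiv_poisson_bound F h : L2 L F -> H10 L h ->
  (forall v, H10 L v -> ip L (wderiv L h) (wderiv L v) = - ip L F v) ->
  L2norm L (wderiv L h) <= P * L2norm L F.
Proof.
move=> LF Hh hF; have W := wirtinger L_gt0 Hh; have Lh := H10_L2 Hh.
have n0 := L2norm_ge0 L (wderiv L h); have nF := L2norm_ge0 L F.
have : L2norm L (wderiv L h) ^+ 2 <= L2norm L F * L2norm L h.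
  rewrite L2norm_sqr hF// (le_trans (ler_norm _))// normrN.
  exact: cauchy_schwarz.
move: n0; rewrite le_eqVlt => /predU1P[<- _|n0].
  by rewrite mulr_ge0// ltW// P_gt0.
move=> h1; have := le_trans h1 (ler_wpM2l nF W).
by rewrite expr2 mulrA ler_pM2r// mulrC.
Qed.

Lemma energy0_bounds : exists C, 0 <= C /\ forall f g, H10 L f -> L2 L g ->
  0 <= energy0 L a f g <= C * energy L f g.
Proof.
have [_ a0 _] := LinfP aL; set N := Linfnorm L a in a0.
have P0 := ltW P_gt0; have P2 : 0 <= P ^+ 2 by exact: sqr_ge0.
(* With x, y the norms of f_x and g, the derivative of [calL] has norm at most P (N P x + y), whose
   square is at most the first term times x^2 + y^2; the last P^2 bounds the norm of f. *)
exists (2 * P ^+ 2 * (N ^+ 2 * P ^+ 2 + 1) + P ^+ 2).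
have K0 : 0 <= N ^+ 2 * P ^+ 2 by rewrite mulr_ge0// sqr_ge0.
split; first by apply: addr_ge0 => //; apply: mulr_ge0; [exact: mulr_ge0|exact: addr_ge0].
move=> f g Hf Lg; have Lf := H10_L2 Hf; have Lf' := H10_L2_wderiv Hf.
have LF := L2_source Lf Lg; have [Hh hF] := calLP L_gt0 LF.
have B := wderiv_poisson_bound LF Hh hF.
rewrite /energy0 !energyE//; last exact: H10_L2_wderiv.
have W := wirtinger L_gt0 Hf; have [Laf Baf] := Linf_mul aL Lf.
have T := L2norm_triangle Laf Lg.
have [n1 n2 n3 n4] : [/\ 0 <= L2norm L (wderiv L (calL L a f g)), 0 <= L2norm L f,
  0 <= L2norm L (wderiv L f) & 0 <= L2norm L g] by split; exact: L2norm_ge0.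
rewrite -/N in Baf.
set u := L2norm L (wderiv L (calL L a f g)) in B n1 *.
set v := L2norm L f in W Baf n2 *; set x := L2norm L (wderiv L f) in W n3 *.
set y := L2norm L g in T n4 *.
apply/andP; split; first by rewrite mulr_ge0// addr_ge0// sqr_ge0.
have b1 : u <= P * (N * (P * x) + y).
  rewrite (le_trans B)// ler_wpM2l// (le_trans T)// lerD2r (le_trans Baf)// ler_wpM2l//.
have b2 : u ^+ 2 <= (P * (N * (P * x) + y)) ^+ 2 by rewrite ler_sqr ?nnegrE// (le_trans n1).
have b3 : v ^+ 2 <= (P * x) ^+ 2 by rewrite ler_sqr ?nnegrE// (le_trans n2).
have b4 : (P * (N * (P * x) + y)) ^+ 2 <= P ^+ 2 * (2 * (N * (P * x)) ^+ 2 + 2 * y ^+ 2).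
  rewrite exprMn; apply: ler_wpM2l => //.
  by have : 0 <= (N * (P * x) - y) ^+ 2 by [exact: sqr_ge0]; rewrite sqrrB sqrrD; lra.
have b5 : P ^+ 2 * (2 * (N * (P * x)) ^+ 2 + 2 * y ^+ 2) + (P * x) ^+ 2 <=
   (2 * P ^+ 2 * (N ^+ 2 * P ^+ 2 + 1) + P ^+ 2) * (x ^+ 2 + y ^+ 2).
  rewrite -subr_ge0.
  have -> : (2 * P ^+ 2 * (N ^+ 2 * P ^+ 2 + 1) + P ^+ 2) * (x ^+ 2 + y ^+ 2) -
    (P ^+ 2 * (2 * (N * (P * x)) ^+ 2 + 2 * y ^+ 2) + (P * x) ^+ 2) =
    2 * P ^+ 2 * x ^+ 2 + 2 * P ^+ 2 * (N ^+ 2 * P ^+ 2) * y ^+ 2 + P ^+ 2 * y ^+ 2 by ring.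
  have [x2 y2] : 0 <= x ^+ 2 /\ 0 <= y ^+ 2 by split; exact: sqr_ge0.
  apply: addr_ge0; last exact: mulr_ge0.
  apply: addr_ge0; apply: mulr_ge0 => //; first exact: mulr_ge0.
  by apply: mulr_ge0 => //; exact: mulr_ge0.
lra.
Qed.

End functional_bounds.

(** * Multiplier inequality and dissipation *)

Section multipliers.
Context {R : realType}.
Variable L : R.
Hypothesis L_gt0 : 0 < L.
Local Notation mu := (@lebesgue_measure R).
Local Notation D := (`]0, L[%classic : set R).
Local Notation "f ~ g" := (L2eq L f g) (at level 70).
Implicit Types f g h b u w : R -> R.

Lemma AC_ip3 F G H f g h : AC L F f -> AC L G g -> AC L H h ->
  ip L (f * G) H + ip L (F * g) H + ip L (F * G) h = F L * G L * H L - F 0 * G 0 * H 0.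
Proof.
move=> aF aG aH; have aFG := AC_mul L_gt0 aF aG.
have := AC_total L_gt0 (AC_mul L_gt0 aFG aH).
have L1 : L2 L (f * G) by rewrite mulrC; exact: AC_L2_mul aG aF.1.
have L2' : L2 L (F * g) := AC_L2_mul L_gt0 aF aG.1.
have LH := AC_L2 L_gt0 aH.
rewrite ipDl ?L2_cst//; last 2 first.
- by rewrite mulrC; exact: AC_L2_mul aH (L2_add L1 L2').
- exact: AC_L2_mul aFG aH.1.
by rewrite !ip_mul1 ipDl// => ->.
Qed.

Lemma L2eq_mul b f g : Linf L b -> L2 L f -> L2 L g -> f ~ g -> b * f ~ b * g.
Proof.
move=> Lb Lf Lg fg; apply: L2norm_le0.
have -> : b * f - b * g = b * (f - g) by rewrite mulrBr.
by have [_ h] := Linf_mul Lb (L2_sub Lf Lg); rewrite (le_trans h)// fg mulr0.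
Qed.

Lemma ip_mulAC b f g : ip L (b * f) g = ip L (b * g) f.
Proof. by apply: eq_Rintegral => x _; rewrite -[(b * f) x]/(b x * f x) -[(b * g) x]/(b x * g x); ring. Qed.

(** Integrates the derivatives of p u u_x, p' u^2, q u_x^2 and q w^2. Only the third leaves boundary
    terms, q(L) u_x(L)^2 - q(0) u_x(0)^2 <= 0; the others vanish because u and w do at the ends.
    Here F stands for u_xx. *)
Lemma multiplier_inequality p p' p'' q q' u w F :
  AC L p p' -> AC L p' p'' -> AC L q q' -> Linf L p'' -> Linf L q' ->
  0 <= q 0 -> q L <= 0 ->
  H10 L u -> H10 L w -> L2 L F ->
  (forall v, H10 L v -> ip L (wderiv L u) (wderiv L v) = - ip L F v) ->
  ip L (p * u) F + ip L (p * w) w + ip L (q * F) (wderiv L u) + ip L (q * w) (wderiv L w) <=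
  - ip L (p * wderiv L u) (wderiv L u) - 2^-1 * ip L (q' * wderiv L u) (wderiv L u)
  + ip L (p * w) w - 2^-1 * ip L (q' * w) w + 2^-1 * ip L (p'' * u) u.
Proof.
move=> ap ap' aq Lp'' Lq' q0 qL Hu Hw LF uF.
have Lp : Linf L p by apply/Linf_within_continuous/(AC_within_continuous L_gt0 ap).
have Lp' : Linf L p' by apply/Linf_within_continuous/(AC_within_continuous L_gt0 ap').
have Lq : Linf L q by apply/Linf_within_continuous/(AC_within_continuous L_gt0 aq).
have [M [aM mM]] := weak_poisson_AC L_gt0 LF Hu uF.
have [U [aU U0 UL uU]] := H10_AC L_gt0 Hu; have [W [aW W0 WL wW]] := H10_AC L_gt0 Hw.
have [Lu Lw] := (H10_L2 Hu, H10_L2 Hw).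
have [Lm Lz] := (H10_L2_wderiv Hu, H10_L2_wderiv Hw).
have [[LU LW] LM] := (AC_L2 L_gt0 aU, AC_L2 L_gt0 aW, AC_L2 L_gt0 aM).
set m := wderiv L u in aU mM Lm uF *; set z := wderiv L w in aW Lz *; clearbody m z.
have Lb b f : Linf L b -> L2 L f -> L2 L (b * f) by move=> Hb Hf; have [] := Linf_mul Hb Hf.
have E1 := AC_ip3 ap aU aM; rewrite U0 UL !mulr0 !mul0r subrr in E1.
have E2 := AC_ip3 ap' aU aU; rewrite U0 UL !mulr0 subrr in E2.
have E3 := AC_ip3 aq aM aM.
have E4 := AC_ip3 aq aW aW; rewrite W0 WL !mulr0 subrr in E4.
have M0 : q L * M L * M L - q 0 * M 0 * M 0 <= 0.
  rewrite -!mulrA subr_le0 (@le_trans _ _ 0)//; first by rewrite mulr_le0_ge0// -expr2 sqr_ge0.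
  by rewrite mulr_ge0// -expr2 sqr_ge0.
(* The integrations by parts were made on the continuous representatives U, W, M; the following
   identities return to u, w and the weak derivatives. *)
have r1 : ip L (p' * U) M = ip L (p' * u) m.
  by apply: (L2eq_ip (Lb _ _ Lp' LU) (Lb _ _ Lp' Lu) LM Lm); [apply: L2eq_mul => //|]; apply: L2eq_sym.
have r2 : ip L (p * m) M = ip L (p * m) m.
  by apply: (L2eq_ipr LM Lm (Lb _ _ Lp Lm)); apply: L2eq_sym.
have r3 : ip L (p * U) F = ip L (p * u) F.
  by apply: (L2eq_ipl (Lb _ _ Lp LU) (Lb _ _ Lp Lu) LF); apply: L2eq_mul => //; apply: L2eq_sym.
have r4 : ip L (p'' * U) U = ip L (p'' * u) u.
  by apply: (L2eq_ip (Lb _ _ Lp'' LU) (Lb _ _ Lp'' Lu) LU Lu); [apply: L2eq_mul => //|]; apply: L2eq_sym.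
have r5 : ip L (p' * m) U = ip L (p' * u) m.
  by rewrite (ip_mulAC p' u m); apply: (L2eq_ipr LU Lu (Lb _ _ Lp' Lm)); apply: L2eq_sym.
have r6 : ip L (p' * U) m = ip L (p' * u) m by rewrite (ip_mulAC p' U m) r5.
have r7 : ip L (q' * M) M = ip L (q' * m) m.
  by apply: (L2eq_ip (Lb _ _ Lq' LM) (Lb _ _ Lq' Lm) LM Lm); [apply: L2eq_mul => //|]; apply: L2eq_sym.
have r8 : ip L (q * F) M = ip L (q * F) m.
  by apply: (L2eq_ipr LM Lm (Lb _ _ Lq LF)); apply: L2eq_sym.
have r9 : ip L (q * M) F = ip L (q * F) m by rewrite (ip_mulAC q M F) r8.
have s1 : ip L (q' * W) W = ip L (q' * w) w.
  by apply: (L2eq_ip (Lb _ _ Lq' LW) (Lb _ _ Lq' Lw) LW Lw); [apply: L2eq_mul => //|]; apply: L2eq_sym.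
have s2 : ip L (q * W) z = ip L (q * w) z.
  by apply: (L2eq_ipl (Lb _ _ Lq LW) (Lb _ _ Lq Lw) Lz); apply: L2eq_mul => //; apply: L2eq_sym.
have s3 : ip L (q * z) W = ip L (q * w) z := etrans (ip_mulAC q z W) s2.
rewrite r1 r2 r3 in E1; rewrite r4 r5 r6 in E2; rewrite r7 r8 r9 in E3; rewrite s1 s2 s3 in E4.
lra.
Qed.

(** A list of triples (c, f, g) encodes the sum of the c <f, g>, so that one induction merges the
    eleven integrals of [dissipation] into a single one and leaves a pointwise inequality. *)
Fixpoint all_L2 (s : seq (R * (R -> R) * (R -> R))) : Prop :=
  if s is t :: s' then [/\ L2 L t.1.2, L2 L t.2 & all_L2 s'] else True.

Lemma ip_comb (s : seq (R * (R -> R) * (R -> R))) : all_L2 s ->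
  mu.-integrable D (EFin \o (fun x => \sum_(t <- s) t.1.1 * (t.1.2 x * t.2 x))) /\
  \sum_(t <- s) t.1.1 * ip L t.1.2 t.2 = \int[mu]_(x in D) (\sum_(t <- s) t.1.1 * (t.1.2 x * t.2 x)).
Proof.
elim: s => [_|[[c f] g] s IH /= [Lf Lg /IH[{}IH1 IH2]]].
  have -> : (fun x : R => \sum_(t <- [::] : seq (R * (R -> R) * (R -> R)))
      t.1.1 * (t.1.2 x * t.2 x)) = cst (0 : R).
    by apply/funext => x; rewrite big_nil.
  split; first exact: (L2_integrable (L2_cst L 0)).
  by rewrite big_nil Rintegral_cst// mul0r.
have E : (fun x => \sum_(t <- (c, f, g) :: s) t.1.1 * (t.1.2 x * t.2 x)) =
    (fun x => c * (f x * g x) + \sum_(t <- s) t.1.1 * (t.1.2 x * t.2 x)).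
  by apply/funext => x; rewrite big_cons.
have i1 := L2_mul_integrable Lf Lg.
have i2 := integrableZl (measurable_dom L) c i1.
rewrite E; split.
  by have := integrableD (measurable_dom L) i2 IH1; apply: eq_integrable.
by rewrite big_cons IH2 RintegralD// RintegralZl.
Qed.

Lemma ip_comb_le0 (s : seq (R * (R -> R) * (R -> R))) : all_L2 s ->
  ae_on L (fun x => \sum_(t <- s) t.1.1 * (t.1.2 x * t.2 x) <= 0) ->
  \sum_(t <- s) t.1.1 * ip L t.1.2 t.2 <= 0.
Proof.
move=> /ip_comb[i ->] H; have i0 := L2_integrable (L2_cst L 0).
apply: le_trans (ae_Rintegral_le i i0 H) _.
by rewrite /= Rintegral_cst// mul0r.
Qed.

Lemma derivI_zero f (al be : R) : derivableI L f -> 0 <= al -> be <= L ->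
  (forall x, al < x < be -> f x = 0) -> forall x, al < x < be -> derivI L f x = 0.
Proof.
move=> df al0 beL z x /andP[ax xb].
have xL : 0 < x < L by rewrite (le_lt_trans al0)// (lt_le_trans xb).
have := derivableI_interior df xL => -[_ <-].
rewrite (@near_eq_derive _ _ _ f (cst 0)) ?derive_cst//.
near=> y; apply: z; apply/andP; split; near: y; [exact: lt_nbhsr|exact: lt_nbhsl].
Unshelve. all: by end_near. Qed.

(** Discards x0 and x1, which belong neither to ]x0, x1[ nor to the open outer intervals on which
    the derivatives of p are known to vanish. *)
Lemma ae_neq (c : R) : ae_on L (fun x => x != c).
Proof.
exists [set c]; split; [exact: measurable_set1|exact: lebesgue_measure_set1|].
by move=> x /= /not_implyP[_ /negP]; rewrite negbK => /eqP.
Qed.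

(** The letters are values at one point: m for u_x, w for u_t, q1 for q', P2 for p''. The cross
    terms are split by Young's inequality, and the condition e1 C3 <= 1 / 2 lets them, together with
    the positive part of (p - q' / 2) w^2, spend at most half of the damping A w^2. Half of the
    coefficient dp of m^2 is spent as well, whence the constants e1 dp / 2 and amin / 2. *)
Lemma pointwise_dissipation (A m w u P Q q1 P2 Na Np Nq N2 K amin dp dq e1 : R) :
  0 <= A -> A <= Na -> `|P| <= Np -> `|Q| <= Nq -> `|P2| <= N2 ->
  0 < amin -> 0 < dp -> dp < dq / 2 -> 0 < e1 -> 0 <= K -> P - 2^-1 * q1 <= K ->
  let C2 := Na * (Nq ^+ 2 / (4 * (dp / 2)) + Np ^+ 2 / 2) in
  let C1 := 2^-1 * (1 + N2) in
  e1 * (K / amin + C2) <= 2^-1 ->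
  (P = 0 /\ P2 = 0 /\ dq <= q1) \/ (amin <= A /\ dp <= P + 2^-1 * q1) ->
  - (A * w * w) + e1 * (- (P * m * m) - 2^-1 * (q1 * m * m) + P * w * w - 2^-1 * (q1 * w * w)
      + 2^-1 * (P2 * u * u) - P * u * (A * w) - Q * (A * w) * m) - e1 * C1 / amin * (A * u * u)
  <= - (e1 * dp / 2) * (m * m) - Num.min (amin / 2) (e1 * dq / 2) * (w * w).
Proof.
move=> A0 AN PN QN P2N am0 dp0 dpq e10 K0 PK C2 C1 eC cases.
set d2 := Num.min _ _.
have d2a : d2 <= amin / 2 by rewrite ge_min lexx.
have d2b : d2 <= e1 * dq / 2 by rewrite ge_min lexx orbT.
have [m2 w2 u2] : [/\ 0 <= m * m, 0 <= w * w & 0 <= u * u] by rewrite -!expr2 !sqr_ge0.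
have Na0 : 0 <= Na by exact: le_trans AN.
have sq (x y : R) : `|x| <= y -> x * x <= y ^+ 2.
  by move=> xy; rewrite -expr2 -real_normK ?num_real// ler_sqr ?nnegrE// (le_trans _ xy).
have AA : A * A <= Na * A by rewrite ler_wpM2r.
(* Young: |Q A w m| <= (dp/2) m^2 + Q^2 A^2 w^2 / (2 dp) *)
have c1 : - (Q * (A * w) * m) <= dp / 2 * (m * m) + Na * (Nq ^+ 2 / (4 * (dp / 2))) * A * (w * w).
  have h : (Q * Q) * (A * A) * (w * w) <= Nq ^+ 2 * (Na * A) * (w * w).
    apply: ler_wpM2r => //; apply: ler_pM => //; [by rewrite -expr2 sqr_ge0|exact: mulr_ge0|exact: sq].
  have y : 0 <= (dp * m + Q * A * w) ^+ 2 by exact: sqr_ge0.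
  have -> : Na * (Nq ^+ 2 / (4 * (dp / 2))) * A * (w * w) = (Nq ^+ 2 * (Na * A) * (w * w)) / (2 * dp).
    by field; rewrite gt_eqF.
  have -> : dp / 2 * (m * m) = (dp * dp * (m * m)) / (2 * dp) by field; rewrite gt_eqF.
  rewrite -mulrDl ler_pdivlMr ?mulr_gt0//.
  have -> : - (Q * (A * w) * m) * (2 * dp) = dp * dp * (m * m) + (Q * Q) * (A * A) * (w * w) - (dp * m + Q * A * w) ^+ 2 by ring.
  lra.
have C2e : C2 = Na * (Nq ^+ 2 / (4 * (dp / 2))) + Na * (Np ^+ 2 / 2) by rewrite /C2; ring.
set c2a := Na * (Nq ^+ 2 / (4 * (dp / 2))) in c1 C2e.
set c2b := Na * (Np ^+ 2 / 2) in C2e.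
have c2b0 : 0 <= c2b by rewrite /c2b; apply: mulr_ge0 => //; apply: divr_ge0 => //; exact: sqr_ge0.
have Aw : 0 <= A * (w * w) by exact: mulr_ge0.
have Ka : 0 <= K / amin by rewrite divr_ge0// ltW.
have C10 : 0 <= C1 by rewrite mulr_ge0 ?invr_ge0 ?addr_ge0// (le_trans _ P2N).
have C0u : 0 <= e1 * C1 / amin * (A * u * u).
  apply: mulr_ge0; first by apply: divr_ge0; [apply: mulr_ge0 => //|]; exact: ltW.
  by rewrite -mulrA; exact: mulr_ge0.
have e1c : e1 * (- (Q * (A * w) * m)) <= e1 * (dp / 2 * (m * m) + c2a * A * (w * w)).
  by rewrite ler_pM2l.
have eCA : e1 * (K / amin + C2) * (A * (w * w)) <= 2^-1 * (A * (w * w)) by rewrite ler_wpM2r.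
(* Outside the interval of guaranteed damping only q acts: q' >= dq controls both squares, and dp <
   dq / 2 leaves dp / 2 for m^2 after Young's inequality. The term in E_0 is merely nonpositive
   there. *)
case: cases => [[-> [-> qd]]|[amA pd]].
  have h1 : e1 * (dq * (m * m)) <= e1 * (q1 * (m * m)) by rewrite ler_pM2l// ler_wpM2r.
  have h2 : e1 * (dq * (w * w)) <= e1 * (q1 * (w * w)) by rewrite ler_pM2l// ler_wpM2r.
  have h3 : d2 * (w * w) <= e1 * dq / 2 * (w * w) by rewrite ler_wpM2r.
  have h4 : e1 * (dp * (m * m)) <= e1 * (dq / 2 * (m * m)) by rewrite ler_pM2l// ler_wpM2r// ltW.
  have h5 : 0 <= e1 * (c2b * (A * (w * w))) by apply: mulr_ge0; [exact: ltW|exact: mulr_ge0].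
  have h6 : 0 <= e1 * (K / amin * (A * (w * w))) by apply: mulr_ge0; [exact: ltW|exact: mulr_ge0].
  rewrite C2e in eCA; set X := e1 * C1 / amin * _ in C0u *.
  have -> : e1 * (- (0 * m * m) - 2^-1 * (q1 * m * m) + 0 * w * w - 2^-1 * (q1 * w * w) +
     2^-1 * (0 * u * u) - 0 * u * (A * w) - Q * (A * w) * m) =
     - 2^-1 * (e1 * (q1 * (m * m))) - 2^-1 * (e1 * (q1 * (w * w))) + e1 * (- (Q * (A * w) * m)) by ring.
  have E1 : e1 * (dp / 2 * (m * m) + c2a * A * (w * w)) = 2^-1 * (e1 * (dp * (m * m))) + e1 * (c2a * (A * (w * w))) by ring.
  have E2 : e1 * (K / amin + (c2a + c2b)) * (A * (w * w)) = e1 * (K / amin * (A * (w * w))) + e1 * (c2a * (A * (w * w))) + e1 * (c2b * (A * (w * w))) by ring.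
  have E3 : - (e1 * dp / 2) * (m * m) = - (2^-1 * (e1 * (dp * (m * m)))) by ring.
  have E4 : e1 * (dq / 2 * (m * m)) = 2^-1 * (e1 * (dq * (m * m))) by ring.
  have E5 : e1 * dq / 2 * (w * w) = 2^-1 * (e1 * (dq * (w * w))) by ring.
  have E6 : A * w * w = A * (w * w) by ring.
  rewrite E1 in e1c; rewrite E2 in eCA; rewrite E4 in h4; rewrite E5 in h3; rewrite E3 E6.
  lra.
have h1 : e1 * (dp * (m * m)) <= e1 * ((P + 2^-1 * q1) * (m * m)) by rewrite ler_pM2l// ler_wpM2r.
have h2 : e1 * ((P - 2^-1 * q1) * (w * w)) <= e1 * (K * (w * w)) by rewrite ler_pM2l// ler_wpM2r.
(* Where A >= amin, a term in w^2 is paid by the damping at the price of a factor 1 / amin; this is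
   the share K / amin of C3. *)
have h3 : e1 * (K * (w * w)) <= e1 * (K / amin * (A * (w * w))).
  rewrite ler_pM2l//.
  have -> : K / amin * (A * (w * w)) = (K * (w * w)) * (A / amin) by field; rewrite gt_eqF.
  rewrite -[leLHS]mulr1; apply: ler_wpM2l; first exact: mulr_ge0.
  by rewrite ler_pdivlMr// mul1r.
have h4 : d2 * (w * w) <= amin / 2 * (w * w) by rewrite ler_wpM2r.
have h5 : amin * (w * w) <= A * (w * w) by rewrite ler_wpM2r.
have h6 : P2 * (u * u) <= N2 * (u * u) by rewrite ler_wpM2r// (le_trans (ler_norm _)).
(* Young's inequality with equal weights. Its u^2 / 2 and the N2 u^2 / 2 from p'' add up to C1 u^2,
   which the E_0 term absorbs because C0 A >= e1 C1. *)
have h7 : - (P * u * (A * w)) <= 2^-1 * (u * u) + c2b * (A * (w * w)).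
  have h : (P * P) * (A * A) * (w * w) <= Np ^+ 2 * (Na * A) * (w * w).
    apply: ler_wpM2r => //; apply: ler_pM => //; [by rewrite -expr2 sqr_ge0|exact: mulr_ge0|exact: sq].
  have y : 0 <= (u + P * A * w) ^+ 2 by exact: sqr_ge0.
  have -> : c2b * (A * (w * w)) = 2^-1 * (Np ^+ 2 * (Na * A) * (w * w)) by rewrite /c2b; field.
  have -> : - (P * u * (A * w)) = 2^-1 * ((u * u) + (P * P) * (A * A) * (w * w) - (u + P * A * w) ^+ 2) by field.
  lra.
have h8 : e1 * C1 * (u * u) <= e1 * C1 / amin * (A * u * u).
  have -> : e1 * C1 / amin * (A * u * u) = (e1 * C1 * (u * u)) * (A / amin) by field; rewrite gt_eqF.
  rewrite -[leLHS]mulr1; apply: ler_wpM2l; first by rewrite mulr_ge0// mulr_ge0// ltW.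
  by rewrite ler_pdivlMr// mul1r.
have h9 : e1 * (2^-1 * (P2 * (u * u)) - (P * u * (A * w))) <= e1 * C1 * (u * u) + e1 * (c2b * (A * (w * w))).
  have -> : e1 * C1 * (u * u) + e1 * (c2b * (A * (w * w))) = e1 * (C1 * (u * u) + c2b * (A * (w * w))) by ring.
  rewrite ler_pM2l//.
  have -> : C1 * (u * u) = 2^-1 * (u * u) + 2^-1 * (N2 * (u * u)) by rewrite /C1; ring.
  lra.
rewrite C2e in eCA; set X := e1 * C1 / amin * _ in C0u h8 *.
have -> : e1 * (- (P * m * m) - 2^-1 * (q1 * m * m) + P * w * w - 2^-1 * (q1 * w * w) +
   2^-1 * (P2 * u * u) - P * u * (A * w) - Q * (A * w) * m) =
   - (e1 * ((P + 2^-1 * q1) * (m * m))) + e1 * ((P - 2^-1 * q1) * (w * w))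
   + e1 * (2^-1 * (P2 * (u * u)) - (P * u * (A * w))) + e1 * (- (Q * (A * w) * m)) by ring.
have E1 : e1 * (dp / 2 * (m * m) + c2a * A * (w * w)) = 2^-1 * (e1 * (dp * (m * m))) + e1 * (c2a * (A * (w * w))) by ring.
have E2 : e1 * (K / amin + (c2a + c2b)) * (A * (w * w)) = e1 * (K / amin * (A * (w * w))) + e1 * (c2a * (A * (w * w))) + e1 * (c2b * (A * (w * w))) by ring.
have E3 : - (e1 * dp / 2) * (m * m) = - (2^-1 * (e1 * (dp * (m * m)))) by ring.
have E4 : amin / 2 * (w * w) = 2^-1 * (amin * (w * w)) by ring.
have E6 : A * w * w = A * (w * w) by ring.
rewrite E1 in e1c; rewrite E2 in eCA; rewrite E4 in h4; rewrite E3 E6.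
lra.
Qed.

End multipliers.

(** Linear arithmetic of [dissipation], with variables in place of the inner products. The nested
    sum with its final 0 is the unfolded list; [pointwise_algebra] does the same under the
    integral. *)
Lemma dissipation_algebra (R : realFieldType) (e C d1 d2 puF pww qFm qwz pmm q1m q1w p2u aww puaw qawm auu mm ww : R) :
  e * (puF + pww + qFm + qwz) <= e * (- pmm - 2^-1 * q1m + pww - 2^-1 * q1w + 2^-1 * p2u) ->
  -1 * aww + (- e * pmm + (- e / 2 * q1m + (e * pww + (- e / 2 * q1w + (e / 2 * p2u +
    (- e * puaw + (- e * qawm + (- C * auu + (d1 * mm + (d2 * ww + 0)))))))))) <= 0 ->
  - aww + e * (puF - puaw + pww + (qFm - qawm) + qwz) - C * auu <= - d1 * mm - d2 * ww.
Proof.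
have -> : e * (puF + pww + qFm + qwz) = e * puF + e * pww + e * qFm + e * qwz by ring.
have -> : e * (- pmm - 2^-1 * q1m + pww - 2^-1 * q1w + 2^-1 * p2u) =
  - (e * pmm) - 2^-1 * (e * q1m) + e * pww - 2^-1 * (e * q1w) + 2^-1 * (e * p2u) by ring.
have -> : e * (puF - puaw + pww + (qFm - qawm) + qwz) =
  e * puF - e * puaw + e * pww + (e * qFm - e * qawm) + e * qwz by ring.
lra.
Qed.

Lemma pointwise_algebra (R : realFieldType) (e C d1 d2 A m w u P Q q1 P2 : R) :
  - (A * w * w) + e * (- (P * m * m) - 2^-1 * (q1 * m * m) + P * w * w - 2^-1 * (q1 * w * w)
      + 2^-1 * (P2 * u * u) - P * u * (A * w) - Q * (A * w) * m) - C * (A * u * u)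
    <= - d1 * (m * m) - d2 * (w * w) ->
  -1 * (A * w * w) + (- e * (P * m * m) + (- e / 2 * (q1 * m * m) + (e * (P * w * w) +
    (- e / 2 * (q1 * w * w) + (e / 2 * (P2 * u * u) + (- e * (P * u * (A * w)) +
    (- e * (Q * (A * w) * m) + (- C * (A * u * u) + (d1 * (m * m) + (d2 * (w * w) + 0))))))))))
  <= 0.
Proof.
move: (A * w * w) (P * m * m) (q1 * m * m) (P * w * w) (q1 * w * w) (P2 * u * u)
  (P * u * (A * w)) (Q * (A * w) * m) (A * u * u) (m * m) (w * w) => {A m w u P Q q1 P2}.
move=> i1 i2 i3 i4 i5 i6 i7 i8 i9 i10 i11 h; rewrite -subr_le0 in h; apply: le_trans h.
by rewrite le_eqVlt; apply/orP; left; apply/eqP; field.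
Qed.

(** * The dissipation estimate for admissible weights *)

Section dissipation.
Context {R : realType}.
Variables (L : R) (a p q : R -> R) (x0 x1 amin dq dp e1 : R).
Hypotheses (L_gt0 : 0 < L) (a_Linf : Linf L a) (a_ge0 : ae_on L (fun x => 0 <= a x))
  (x0_ge0 : 0 <= x0) (x0_lt_x1 : x0 < x1) (x1_le_L : x1 <= L) (amin_gt0 : 0 < amin)
  (a_ge_amin : ae_on L (fun x => x \in `]x0, x1[ -> amin <= a x))
  (adm : admissible L x0 x1 q p dq dp)
  (e1_gt0 : 0 < e1) (e1_lt : e1 < Num.min (1 / (2 * C3c L a q p amin dp)) (qpnorm L q p)^-1).
Local Notation D := (`]0, L[%classic : set R).
Implicit Types f g u w : R -> R.

Let Cq : C2I L q. Proof. by case: adm. Qed.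
Let Cp : C2I L p. Proof. by case: adm. Qed.

Lemma C2_functions_Linf : [/\ Linf L q, Linf L (derivI L q), Linf L p & Linf L (derivI L (derivI L p))].
Proof. by have [? ? _] := C2I_Linf Cq; have [? _ ?] := C2I_Linf Cp. Qed.

Lemma e1_bounds : e1 * C3c L a q p amin dp <= 2^-1 /\ e1 * qpnorm L q p < 1.
Proof.
move: e1_lt; rewrite lt_min => /andP[h1 h2]; split.
  (* Positivity is read off the hypotheses: 0 < e1 < 1 / (2 C3) would fail for C3 <= 0, the inverse
     of 0 being 0. The same applies to [qpnorm] below. *)
  have c3 : 0 < C3c L a q p amin dp.
    have := lt_trans e1_gt0 h1; rewrite div1r invr_gt0 pmulr_rgt0//.
  by move: h1; rewrite ltr_pdivlMr ?mulr_gt0// => h1; lra.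
have qp : 0 < qpnorm L q p by have := lt_trans e1_gt0 h2; rewrite invr_gt0.
by move: h2; rewrite -div1r ltr_pdivlMr.
Qed.

Lemma p_zero_outside x : 0 < x < L -> x != x0 -> x != x1 -> x \notin `]x0, x1[ ->
  [/\ p x = 0, derivI L (derivI L p) x = 0 & dq <= derivI L q x].
Proof.
move=> /andP[xp xL] n0 n1; rewrite in_itv/= negb_and -!leNgt => xx.
have [_ _ [_ _ _ qd] [pz _ _]] := adm; have [d1 d2 _] := Cp.
have [xx0|xx1] : x < x0 \/ x1 < x.
- by case/orP: xx => h; [left|right]; rewrite lt_neqAle h ?n0// eq_sym n1.
- have x0L : x0 <= L by rewrite (le_trans (ltW x0_lt_x1)).
  have z1 y : 0 < y < x0 -> derivI L p y = 0.
    apply: (derivI_zero d1) => // z /andP[z0 zx]; apply: pz; left.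
    by rewrite in_itv/= !ltW.
  split; [by apply: pz; left; rewrite in_itv/= !ltW| |by apply: qd; left; rewrite in_itv/= !ltW].
  by apply: (derivI_zero d2 _ _ z1) => //; rewrite xp.
- have x10 : 0 <= x1 by rewrite (le_trans x0_ge0)// ltW.
  have z1 y : x1 < y < L -> derivI L p y = 0.
    apply: (derivI_zero d1) => // z /andP[z0 zx]; apply: pz; right.
    by rewrite in_itv/= !ltW.
  split; [by apply: pz; right; rewrite in_itv/= !ltW| |by apply: qd; right; rewrite in_itv/= !ltW].
  by apply: (derivI_zero d2 _ _ z1) => //; rewrite xx1.
Qed.

(** For a solution of the wave equation, w = u_t and F = u_xx, so that F - a w is w_t. The left side
    is then the time derivative of V(u, w). *)
Lemma dissipation u w F : H10 L u -> H10 L w -> L2 L F ->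
  (forall v, H10 L v -> ip L (wderiv L u) (wderiv L v) = - ip L F v) ->
  - ip L (a * w) w
  + e1 * (ip L (p * u) (F - a * w) + ip L (p * w) w
          + ip L (q * (F - a * w)) (wderiv L u) + ip L (q * w) (wderiv L w))
  - C0c L p amin e1 * ip L (a * u) u
  <= - (e1 * dp / 2) * ip L (wderiv L u) (wderiv L u)
     - Num.min (amin / 2) (e1 * dq / 2) * ip L w w.
Proof.
move=> Hu Hw LF uF.
have [Lq Lq' Lp Lp''] := C2_functions_Linf.
have [aq _] := C2I_AC Cq; have [ap ap'] := C2I_AC Cp.
have [_ _ [q0 qL dq0 qd] [pz /andP[dp0 dpq] pd]] := adm.
have MI := multiplier_inequality L_gt0 ap ap' aq Lp'' Lq' q0 qL Hu Hw LF uF.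
have [Lu Lw] := (H10_L2 Hu, H10_L2 Hw); have Lm := H10_L2_wderiv Hu.
set m := wderiv L u in MI Lm *; set z := wderiv L w in MI *.
set p2 := derivI L (derivI L p) in MI Lp''; set q1 := derivI L q in MI Lq' qd pd.
have Lb b f : Linf L b -> L2 L f -> L2 L (b * f) by move=> Hb Hf; have [] := Linf_mul Hb Hf.
have Law := Lb _ _ a_Linf Lw; have Lau := Lb _ _ a_Linf Lu.
have -> : q * (F - a * w) = q * F - q * (a * w) by rewrite mulrBr.
rewrite (ipBr LF Law (Lb _ _ Lp Lu)) (ipBl (Lb _ _ Lq LF) (Lb _ _ Lq Law) Lm).
set d1 := e1 * dp / 2; set d2 := Num.min _ _; set C0 := C0c L p amin e1.
pose S : seq (R * (R -> R) * (R -> R)) := [:: (-1, a * w, w); (- e1, p * m, m);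
  (- e1 / 2, q1 * m, m); (e1, p * w, w); (- e1 / 2, q1 * w, w); (e1 / 2, p2 * u, u);
  (- e1, p * u, a * w); (- e1, q * (a * w), m); (- C0, a * u, u); (d1, m, m); (d2, w, w)].
have LS : all_L2 L S by rewrite /=; repeat split => //; apply: Lb => //; exact: Lb.
have : \sum_(t <- S) t.1.1 * ip L t.1.2 t.2 <= 0; last first.
  rewrite /S !big_cons big_nil /=.
  move=> H; exact: (dissipation_algebra (ler_wpM2l (ltW e1_gt0) MI) H).
apply: ip_comb_le0 => //.
have [_ _ aN] := LinfP a_Linf; have [_ _ pN] := LinfP Lp; have [_ _ qN] := LinfP Lq.
have [_ _ p2N] := LinfP Lp''.
have [K0 KP] := Kc_ge L_gt0 Cq Cp; have [e13 _] := e1_bounds.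
have := ae_onI (ae_onI (ae_onI a_ge0 a_ge_amin) (ae_onI aN pN))
  (ae_onI (ae_onI qN p2N) (ae_onI (ae_neq L x0) (ae_neq L x1))).
apply: ae_onS => x Dx [[[ax0 axm] [axN pxN]] [[qxN p2xN] [n0 n1]]].
rewrite /S !big_cons big_nil /=.
have xL : 0 < x < L by move: Dx; rewrite /= in_itv.
have xL' : 0 <= x <= L by case/andP: xL => ? ?; rewrite !ltW.
rewrite -[(a * w) x]/(a x * w x) -[(p * m) x]/(p x * m x) -[(q1 * m) x]/(q1 x * m x)
  -[(p * w) x]/(p x * w x) -[(q1 * w) x]/(q1 x * w x) -[(p2 * u) x]/(p2 x * u x)
  -[(p * u) x]/(p x * u x) -[(q * (a * w)) x]/(q x * (a x * w x)) -[(a * u) x]/(a x * u x).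
have axN' : a x <= Linfnorm L a by rewrite (le_trans (ler_norm _)).
have cases : (p x = 0 /\ p2 x = 0 /\ dq <= q1 x) \/ (amin <= a x /\ dp <= p x + 2^-1 * q1 x).
  have [xi|xo] := boolP (x \in `]x0, x1[).
    right; split; first exact: axm.
    by apply: pd; exact: subset_itv_oo_cc.
  by left; have [? ? ?] := p_zero_outside xL n0 n1 xo.
have := pointwise_dissipation (m x) (w x) (u x) ax0 axN' pxN qxN p2xN amin_gt0 dp0 dpq e1_gt0 K0
   (KP x xL') e13 cases.
exact: pointwise_algebra.
Qed.

Lemma C0c_ge0 : 0 <= C0c L p amin e1.
Proof.
have [_ _ _ Lp''] := C2_functions_Linf; have [_ n0 _] := LinfP Lp''.
apply: divr_ge0; last exact: ltW.
by apply: mulr_ge0; [exact: ltW|apply: mulr_ge0 => //; exact: addr_ge0].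
Qed.

Lemma energy_ge0 f g : H10 L f -> L2 L g -> 0 <= energy L f g.
Proof.
move=> Hf Lg; rewrite energyE//; last exact: H10_L2_wderiv.
by apply: mulr_ge0 => //; apply: addr_ge0; exact: sqr_ge0.
Qed.

Lemma lyapunov_bounds : 0 < 1 - e1 * qpnorm L q p /\
  exists C5 : R, 0 < C5 /\ forall f g, H10 L f -> L2 L g ->
    (1 - e1 * qpnorm L q p) * energy L f g <= lyapunov L a q p amin e1 f g <= C5 * energy L f g.
Proof.
have [_ e1q] := e1_bounds; have [Lq _ Lp _] := C2_functions_Linf.
split; first by rewrite subr_gt0.
have [C [C0 HC]] := energy0_bounds L_gt0 a_Linf.
(* The three terms bound E, e1 M and C0 E_0 by the energy; the lower bound drops E_0 >= 0. *)
exists (1 + e1 * qpnorm L q p + C0c L p amin e1 * C).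
have c0 := C0c_ge0.
have qp : 0 <= qpnorm L q p.
  have [_ n1 _] := LinfP Lq; have [_ n2 _] := LinfP Lp.
  by apply: addr_ge0 => //; apply: mulr_ge0 => //; exact/ltW/P_gt0.
have eq0 : 0 <= e1 * qpnorm L q p by apply: mulr_ge0 => //; exact: ltW.
split; first by apply: ltr_wpDr; [exact: mulr_ge0|exact: ltr_wpDr].
move=> f g Hf Lg; have M := Mfun_bound L_gt0 Lp Lq Hf Lg.
have /andP[E0 E1] := HC f g Hf Lg; have E := energy_ge0 Hf Lg.
rewrite /lyapunov; move: M; rewrite ler_norml => /andP[M1 M2].
have h1 := ler_wpM2l (ltW e1_gt0) M1; have h2 := ler_wpM2l (ltW e1_gt0) M2.
have h3 := ler_wpM2l c0 E1; have h4 := mulr_ge0 c0 E0.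
move: h1 h2 h3 h4; move: (energy L f g) (energy0 L a f g) (Mfun L q p f g) (qpnorm L q p)
  (C0c L p amin e1) => e e0 M k c.
rewrite mulrN !mulrA !mulrDl mulNr mul1r.
move: (e1 * M) (c * e0) (e1 * k * e) (c * C * e) => x y z r h1 h2 h3 h4.
by apply/andP; split; lra.
Qed.

End dissipation.

(** * Curves in L^2 and H^1_0 *)

Section L2_curves.
Context {R : realType}.
Variable L : R.
Local Notation mu := (@lebesgue_measure R).
Implicit Types f g : R -> R.

(** Membership in L^2 is asked only along the filter, since a weak solution is controlled for t >= 0
    only. *)
Definition cvgL2 {I : Type} (F : set_system I) (u : I -> R -> R) (f : R -> R) :=
  [/\ \forall i \near F, L2 L (u i), L2 L f & L2norm L (u i - f) @[i --> F] --> 0].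

Section filter.
Context {I : Type} {F : set_system I} {FF : Filter F}.
Implicit Types u v : I -> R -> R.

Lemma squeeze0 (a b : I -> R) : (\forall i \near F, 0 <= a i <= b i) ->
  b i @[i --> F] --> 0 -> a i @[i --> F] --> 0.
Proof.
move=> ab b0; apply: (squeeze_cvgr ab) => //; exact: cvg_cst.
Qed.

Lemma cvgL2_cst f : L2 L f -> cvgL2 F (fun=> f) f.
Proof.
move=> Lf; split => //; first exact: nearW.
by rewrite subrr L2norm0; exact: cvg_cst.
Qed.

Lemma cvgL2_add u v f g : cvgL2 F u f -> cvgL2 F v g -> cvgL2 F (fun i => u i + v i) (f + g).
Proof.
move=> [Lu Lf uf] [Lv Lg vg]; split; last 2 first.
- exact: L2_add.
- apply: (@squeeze0 _ (fun i => L2norm L (u i - f) + L2norm L (v i - g))); last first.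
    by rewrite -(addr0 (0:R)); exact: cvgD.
  near=> i; rewrite L2norm_ge0/= opprD addrACA L2norm_triangle//; apply: L2_sub => //; by near: i.
by near=> i; apply: L2_add; near: i.
Unshelve. all: by end_near. Qed.

Lemma cvgL2_scale (c : I -> R) (l : R) u f : c i @[i --> F] --> l -> cvgL2 F u f ->
  cvgL2 F (fun i => c i *: u i) (l *: f).
Proof.
move=> cl [Lu Lf uf]; split; last 2 first.
- exact: L2_scale.
- apply: (@squeeze0 _ (fun i => `|c i| * L2norm L (u i - f) + `|c i - l| * L2norm L f)); last first.
    rewrite -(addr0 (0:R)); apply: cvgD.
      by rewrite -(mulr0 `|l|); apply: cvgM => //; exact: cvg_norm.
    rewrite -(mul0r (L2norm L f)); apply: cvgM; last exact: cvg_cst.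
    by rewrite -(normr0 R) -(subrr l); apply: cvg_norm; apply: cvgB => //; exact: cvg_cst.
  near=> i; rewrite L2norm_ge0/=.
  have Lui : L2 L (u i) by near: i.
  have -> : c i *: u i - l *: f = c i *: (u i - f) + (c i - l) *: f.
    by rewrite scalerBr scalerBl addrA subrK.
  have L1 := L2_sub Lui Lf.
  by rewrite (le_trans (L2norm_triangle (L2_scale _ L1) (L2_scale _ Lf)))// !L2normZ.
by near=> i; apply: L2_scale; near: i.
Unshelve. all: by end_near. Qed.

Lemma cvgL2_scalec (c : R) u f : cvgL2 F u f -> cvgL2 F (fun i => c *: u i) (c *: f).
Proof. by apply: cvgL2_scale; exact: cvg_cst. Qed.

Lemma cvgL2_sub u v f g : cvgL2 F u f -> cvgL2 F v g -> cvgL2 F (fun i => u i - v i) (f - g).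
Proof.
move=> uf vg; rewrite -(scaleN1r g).
have -> : (fun i => u i - v i) = (fun i => u i + (-1) *: v i).
  by apply/funext => i; rewrite scaleN1r.
by apply: cvgL2_add => //; exact: cvgL2_scalec.
Qed.

Lemma cvgL2_Linf a u f : Linf L a -> cvgL2 F u f -> cvgL2 F (fun i => a * u i) (a * f).
Proof.
move=> La [Lu Lf uf]; split; last 2 first.
- by have [] := Linf_mul La Lf.
- apply: (@squeeze0 _ (fun i => Linfnorm L a * L2norm L (u i - f))); last first.
    by rewrite -(mulr0 (Linfnorm L a)); apply: cvgM => //; exact: cvg_cst.
  near=> i; rewrite L2norm_ge0/= -mulrBr.
  have Lui : L2 L (u i) by near: i.
  by have [] := Linf_mul La (L2_sub Lui Lf).
near=> i; have Lui : L2 L (u i) by near: i.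
by have [] := Linf_mul La Lui.
Unshelve. all: by end_near. Qed.

Lemma cvgL2_norm u f : cvgL2 F u f -> L2norm L (u i) @[i --> F] --> L2norm L f.
Proof.
move=> [Lu Lf uf]; apply/cvgrPdist_le => e e0.
have /cvgrPdist_le/(_ e e0) := uf; apply: filterS2 Lu => i Lui.
rewrite sub0r normrN (ger0_norm (L2norm_ge0 _ _)) => h; apply: le_trans h.
rewrite ler_distl; apply/andP; split.
  by have := L2norm_triangle (L2_sub Lui Lf) Lf; rewrite subrK; lra.
by have := L2norm_triangle (L2_sub Lf Lui) Lui; rewrite subrK L2norm_distC//; lra.
Qed.

Lemma cvgL2_ip u v f g : cvgL2 F u f -> cvgL2 F v g -> ip L (u i) (v i) @[i --> F] --> ip L f g.
Proof.
move=> uf vg; have [Lu Lf uf0] := uf; have [Lv Lg vg0] := vg; have vn := cvgL2_norm vg.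
apply/subr_cvg0/norm_cvg0P.
apply: (@squeeze0 _ (fun i => L2norm L (u i - f) * L2norm L (v i) + L2norm L f * L2norm L (v i - g))); last first.
  rewrite -(addr0 (0:R)); apply: cvgD.
    by rewrite -(mul0r (L2norm L g)); exact: cvgM.
  by rewrite -(mulr0 (L2norm L f)); apply: cvgM => //; exact: cvg_cst.
near=> i; rewrite normr_ge0/=.
have Lui : L2 L (u i) by near: i.
have Lvi : L2 L (v i) by near: i.
have Luf := L2_sub Lui Lf; have Lvg := L2_sub Lvi Lg.
have -> : ip L (u i) (v i) - ip L f g = ip L (u i - f) (v i) + ip L f (v i - g).
  by rewrite ipBl// ipBr// addrA subrK.
by rewrite (le_trans (ler_normD _ _))// lerD// cauchy_schwarz.
Unshelve. all: by end_near. Qed.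

Lemma cvgL2_eq u v f : (\forall i \near F, L2 L (v i) /\ L2eq L (v i) (u i)) -> cvgL2 F u f -> cvgL2 F v f.
Proof.
move=> vu [Lu Lf uf]; split => //; first by apply: filterS vu => i [].
apply: cvg_trans uf; apply: near_eq_cvg.
near=> i; have [Lvi vui] : L2 L (v i) /\ L2eq L (v i) (u i) by near: i.
have Lui : L2 L (u i) by near: i.
apply: L2eq_norm; [exact: L2_sub|exact: L2_sub|apply: L2eq_sub => //].
by apply: L2eq_sym.
Unshelve. all: by end_near. Qed.

Lemma cvgL2_eql u f g : L2 L g -> L2eq L f g -> cvgL2 F u f -> cvgL2 F u g.
Proof.
move=> Lg fg [Lu Lf uf]; split => //; apply: cvg_trans uf; apply: near_eq_cvg.
near=> i; have Lui : L2 L (u i) by near: i.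
by apply: L2eq_norm; [exact: L2_sub|exact: L2_sub|apply: L2eq_sub].
Unshelve. all: by end_near. Qed.

End filter.

Lemma cvgL2_within (I : Type) (F : set_system I) (A : set I) u f : Filter F ->
  F A -> cvgL2 (within A F) u f -> cvgL2 F u f.
Proof.
move=> FF FA.
have sub P : within A F P -> F P by apply: filterS2 FA => x Ax; exact.
by move=> [Lu Lf uf]; split => //; [exact: sub|move=> P /uf; exact: sub].
Qed.

Definition diffL2 (t : R) (u : R -> R -> R) (f : R -> R) :=
  cvgL2 t^' (fun s => (s - t)^-1 *: (u s - u t)) f.

Lemma diffL2_cvg t u f : L2 L (u t) -> diffL2 t u f -> cvgL2 t^' u (u t).
Proof.
move=> Lut du.
have H : cvgL2 t^' (fun s => (s - t) *: ((s - t)^-1 *: (u s - u t)) + u t) (0 *: f + u t).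
  apply: cvgL2_add; last exact: cvgL2_cst.
  apply: cvgL2_scale => //; rewrite -(subrr t); apply: cvgB; last exact: cvg_cst.
  by apply: cvg_within_filter; exact: cvg_id.
rewrite scale0r add0r in H; case: H => Lu Lut' H; split => //.
  apply: filterS2 (nbhs_dnbhs_neq t) Lu => s st.
  by rewrite scalerA divff ?subr_eq0// scale1r subrK.
apply: cvg_trans H; apply: near_eq_cvg; near=> s.
rewrite scalerA divff; last by rewrite subr_eq0; near: s; exact: nbhs_dnbhs_neq.
by rewrite scale1r subrK.
Unshelve. all: by end_near. Qed.

Lemma diffL2_ip t u v f g : L2 L (u t) -> L2 L (v t) -> diffL2 t u f -> diffL2 t v g ->
  is_derive t 1 (fun s => ip L (u s) (v s)) (ip L f (v t) + ip L (u t) g).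
Proof.
move=> Lut Lvt du dv; have [Lv _ _] := diffL2_cvg Lvt dv; have [Lu _ _] := diffL2_cvg Lut du.
apply: is_derive_quotient.
have H : ip L ((s - t)^-1 *: (u s - u t)) (v s) + ip L (u t) ((s - t)^-1 *: (v s - v t))
    @[s --> t^'] --> ip L f (v t) + ip L (u t) g.
  apply: cvgD; first exact: cvgL2_ip du (diffL2_cvg Lvt dv).
  by apply: cvgL2_ip dv; exact: cvgL2_cst.
apply: cvg_trans H; apply: near_eq_cvg; near=> s.
have Lus : L2 L (u s) by near: s.
have Lvs : L2 L (v s) by near: s.
have L1 := L2_sub Lus Lut; have L2' := L2_sub Lvs Lvt.
rewrite /= ipZl// ipZr// ipBl// ipBr//; ring.
Unshelve. all: by end_near. Qed.

Lemma diffL2_Linf t a u f : Linf L a -> diffL2 t u f -> diffL2 t (fun s => a * u s) (a * f).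
Proof.
move=> La du; rewrite /diffL2.
have -> : (fun s => (s - t)^-1 *: (a * u s - a * u t)) = (fun s => a * ((s - t)^-1 *: (u s - u t))).
  by apply/funext => s; rewrite -mulrBr; apply/funext => x; exact: mulrCA.
exact: cvgL2_Linf La du.
Qed.

Lemma diffL2_cst t f : diffL2 t (fun=> f) 0.
Proof.
rewrite /diffL2.
have -> : (fun s => (s - t)^-1 *: (f - f)) = fun=> 0.
  by apply/funext => s; rewrite subrr scaler0.
by apply: cvgL2_cst; exact: L2_0.
Qed.

(* Mean value inequality, obtained by pairing the curve with its own increment. *)
Lemma diffL2_lipschitz (al be B : R) u u' : al < be ->
  (forall t, al <= t <= be -> L2 L (u t)) ->
  (forall t, al < t < be -> diffL2 t u (u' t) /\ L2norm L (u' t) <= B) ->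
  cvgL2 al^'+ u (u al) -> cvgL2 be^'- u (u be) ->
  L2norm L (u be - u al) <= (be - al) * B.
Proof.
move=> ab Lu du ca cb; set e := u be - u al.
have Le : L2 L e by apply: L2_sub; apply: Lu; rewrite lexx ltW.
pose G s := ip L (u s) e.
have dG t : al < t < be -> is_derive t 1 G (ip L (u' t) e).
  move=> tab; have [dt _] := du t tab; have [_ Lu't _] := dt.
  have Lut : L2 L (u t) by apply: Lu; case/andP: tab => ? ?; rewrite !ltW.
  apply: is_derive_eq (diffL2_ip Lut Le dt (diffL2_cst t e)) _.
  by rewrite -(scale0r (0 : R -> R)) ipZr// mul0r addr0.
have cG : {within `[al, be], continuous G}.
  apply/(continuous_within_itvP G ab); split.
  - move=> t; rewrite in_itv/= => tab.
    by apply/differentiable_continuous/derivable1_diffP; case: (dG t tab).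
  - by apply: cvgL2_ip ca _; exact: cvgL2_cst.
  - by apply: cvgL2_ip cb _; exact: cvgL2_cst.
have dG' t : t \in `]al, be[ -> is_derive t 1 G (ip L (u' t) e) by rewrite in_itv/=; exact: dG.
have [c] := MVT ab dG' cG.
rewrite in_itv/= => cab; have [[_ Lc _] Bc] := du c cab.
have -> : G be - G al = L2norm L e ^+ 2.
  by rewrite L2norm_sqr /G -ipBl//; apply: Lu; rewrite lexx ltW.
move=> E; have := cauchy_schwarz Lc Le; have e0 := L2norm_ge0 L e.
have ba : 0 < be - al by rewrite subr_gt0.
move=> cs; have : L2norm L e ^+ 2 <= (be - al) * B * L2norm L e.
  rewrite E mulrC -mulrA ler_pM2l// (le_trans (ler_norm _))// (le_trans cs)// ler_wpM2r//.
move: e0; rewrite le_eqVlt => /predU1P[<- _|e0]; last by rewrite expr2 ler_pM2r.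
by apply: mulr_ge0; [exact: ltW|exact: le_trans (L2norm_ge0 _ _) Bc].
Qed.

End L2_curves.

(** * The dual norm, the Poisson problem and its dependence on time *)

Section poisson.
Context {R : realType}.
Variables (L : R).
Hypothesis L_gt0 : 0 < L.
Implicit Types u v f g h : R -> R.
Local Notation "f ~ g" := (L2eq L f g) (at level 70).

Lemma H1norm_scale c v : H10 L v -> H1norm L (c *: v) = `|c| * H1norm L v.
Proof.
move=> Hv; have [Hcv E] := H10_scale L_gt0 c Hv.
have Lv := H10_L2_wderiv Hv; have Lcv := H10_L2_wderiv Hcv.
rewrite /H1norm (L2normZ c (H10_L2 Hv)) (L2eq_norm Lcv (L2_scale _ Lv) E) (L2normZ c Lv).
by rewrite !exprMn -mulrDr sqrtrM ?sqr_ge0// sqrtr_sqr normr_id.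
Qed.

Lemma Hm1_scale c F : Hm1 L F -> Hm1 L (c *: F).
Proof.
move=> [lF [C HC]]; split.
  move=> d u v Hu Hv; rewrite -[LHS]/(c * F (d *: u + v)) lF// -[(c *: F) u]/(c * F u).
  by rewrite -[(c *: F) v]/(c * F v) mulrDr mulrCA.
exists (`|c| * C) => v Hv; rewrite -[(c *: F) v]/(c * F v) normrM -mulrA.
by apply: ler_wpM2l => //; exact: HC.
Qed.

Lemma Hm1_add F G : Hm1 L F -> Hm1 L G -> Hm1 L (F + G).
Proof.
move=> [lF [C HC]] [lG [C' HC']]; split.
  move=> d u v Hu Hv; rewrite -[LHS]/(F (d *: u + v) + G (d *: u + v)) lF// lG//.
  by rewrite -[(F + G) u]/(F u + G u) -[(F + G) v]/(F v + G v) mulrDr addrACA.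
exists (C + C') => v Hv; rewrite -[(F + G) v]/(F v + G v) mulrDl.
by rewrite (le_trans (ler_normD _ _))// lerD ?HC ?HC'.
Qed.

Lemma Hm1_sub F G : Hm1 L F -> Hm1 L G -> Hm1 L (F - G).
Proof. by move=> hF hG; rewrite -(scaleN1r G); apply: Hm1_add => //; exact: Hm1_scale. Qed.

Lemma Hm1_of_L2P g : L2 L g -> Hm1 L (Hm1_of_L2 L g).
Proof.
move=> Lg; split.
  move=> d u v /H10_L2 Lu /H10_L2 Lv.
  rewrite -[LHS]/(ip L g (d *: u + v)) ipDr//; last exact: L2_scale.
  by rewrite ipZr.
exists (L2norm L g) => v Hv; have Lv := H10_L2 Hv; have [n1 _] := H1norm_ge L v.
rewrite -[Hm1_of_L2 L g v]/(ip L g v) (le_trans (cauchy_schwarz Lg Lv))//.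
by apply: ler_wpM2l => //; exact: L2norm_ge0.
Qed.

Lemma Hm1_has_ubound F : Hm1 L F ->
  has_ubound [set `|F w| | w in [set w | H10 L w /\ H1norm L w <= 1]].
Proof.
move=> [_ [C HC]]; exists `|C| => _ [w [Hw w1] <-]; rewrite (le_trans (HC w Hw))//.
have n0 : 0 <= H1norm L w by exact: sqrtr_ge0.
rewrite (le_trans (ler_norm _))// normrM (ger0_norm n0) -[leRHS]mulr1.
exact: ler_wpM2l.
Qed.

Lemma Hm1norm_ge0 F : Hm1 L F -> 0 <= Hm1norm L F.
Proof.
move=> hF; apply: le_trans (normr_ge0 (F 0)) (ub_le_sup (Hm1_has_ubound hF) _).
have [H0 _] := H10_0 L_gt0; exists 0 => //; split => //.
by rewrite -(scale0r (0 : R -> R)) H1norm_scale// normr0 mul0r ler01.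
Qed.

Lemma Hm1norm_bound F v : Hm1 L F -> H10 L v -> `|F v| <= Hm1norm L F * H1norm L v.
Proof.
move=> hF Hv; have [lF [C HC]] := hF; have [H0 _] := H10_0 L_gt0.
have F0 : F 0 = 0.
  by have := lF 1 0 0 H0 H0; rewrite scale1r addr0 mul1r => /eqP; rewrite -subr_eq0 opprD addNKr oppr_eq0 => /eqP.
have FZ c w : H10 L w -> F (c *: w) = c * F w.
  by move=> Hw; have := lF c w 0 Hw H0; rewrite F0 !addr0.
(* A v of norm 0 cannot be normalized, but the boundedness of F gives F v = 0. *)
have [n0|n0] := eqVneq (H1norm L v) 0.
  by have := HC v Hv; rewrite n0 !mulr0.
have np : 0 < H1norm L v by rewrite lt_neqAle eq_sym n0 sqrtr_ge0.
rewrite -ler_pdivrMr//.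
have [Hw _] := H10_scale L_gt0 (H1norm L v)^-1 Hv.
apply: (ub_le_sup (Hm1_has_ubound hF)); exists ((H1norm L v)^-1 *: v).
  by split => //; rewrite H1norm_scale// gtr0_norm ?invr_gt0// mulVf.
by rewrite FZ// normrM gtr0_norm ?invr_gt0// mulrC.
Qed.

Definition poisson u F := H10 L u /\
  forall v, H10 L v -> ip L (wderiv L u) (wderiv L v) = - ip L F v.

Lemma L2eq_comb c u v f w1 w2 w3 :
  L2 L u -> L2 L v -> L2 L f -> L2 L w1 -> L2 L w2 -> L2 L w3 ->
  w1 ~ u - v -> w2 ~ c *: w1 -> w3 ~ w2 - f -> w3 ~ c *: (u - v) - f.
Proof.
move=> Lu Lv Lf L1 L2' L3 E1 E2 E3; have Luv := L2_sub Lu Lv.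
have E4 := L2eq_trans L2' (L2_scale c L1) (L2_scale c Luv) E2 (L2eq_scale c L1 Luv E1).
apply: (L2eq_trans L3 (L2_sub L2' Lf) (L2_sub (L2_scale c Luv) Lf) E3).
exact: (L2eq_sub L2' (L2_scale c Luv) Lf Lf E4 (L2eq_refl L f)).
Qed.

Lemma H10_comb c u v f : H10 L u -> H10 L v -> H10 L f -> H10 L (c *: (u - v) - f) /\
  wderiv L (c *: (u - v) - f) ~ c *: (wderiv L u - wderiv L v) - wderiv L f.
Proof.
move=> Hu Hv Hf; have [H1 E1] := H10_sub L_gt0 Hu Hv; have [H2 E2] := H10_scale L_gt0 c H1.
have [H3 E3] := H10_sub L_gt0 H2 Hf; split; first exact: H3.
exact: (L2eq_comb (H10_L2_wderiv Hu) (H10_L2_wderiv Hv) (H10_L2_wderiv Hf)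
  (H10_L2_wderiv H1) (H10_L2_wderiv H2) (H10_L2_wderiv H3) E1 E2 E3).
Qed.

(** With c = 1 / (s - t) this is the error of a difference quotient against a candidate derivative
    f. The case f = 0 gives the quotient itself; c = 1 with v = 0 gives a difference. *)
Lemma poisson_comb c u v f F G K : L2 L F -> L2 L G -> L2 L K ->
  poisson u F -> poisson v G -> poisson f K ->
  poisson (c *: (u - v) - f) (c *: (F - G) - K).
Proof.
move=> LF LG LK [Hu uF] [Hv vG] [Hf fK]; have [H E] := H10_comb c Hu Hv Hf; split => // w Hw.
have [Lu Lv Lf] := And3 (H10_L2_wderiv Hu) (H10_L2_wderiv Hv) (H10_L2_wderiv Hf).
have [Lw Lw'] := (H10_L2 Hw, H10_L2_wderiv Hw).
have [Luv LFG] := (L2_sub Lu Lv, L2_sub LF LG).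
rewrite (L2eq_ipl (H10_L2_wderiv H) (L2_sub (L2_scale c Luv) Lf) Lw' E).
rewrite !ipBl ?ipZl ?ipBl//; try exact: L2_scale.
by rewrite uF// vG// fK//; ring.
Qed.

Lemma ip0l f : ip L 0 f = 0.
Proof.
rewrite /ip (@eq_Rintegral _ _ _ _ _ (cst 0)) ?Rintegral_cst ?mul0r// => x _.
exact: mul0r.
Qed.

Lemma poisson0 : poisson 0 0.
Proof.
have [H0 E0] := H10_0 L_gt0; split => // v Hv.
by rewrite (L2eq_ipl (H10_L2_wderiv H0) (L2_0 L) (H10_L2_wderiv Hv) E0) !ip0l oppr0.
Qed.

Section filter.
Context {I : Type} {F : set_system I} {FF : Filter F}.

Lemma cvgL2_wderiv (u : I -> R -> R) f : (\forall i \near F, H10 L (u i)) -> H10 L f ->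
  cvgL2 L F (fun i => wderiv L (u i)) (wderiv L f) -> cvgL2 L F u f.
Proof.
move=> Hu Hf [Lu Lf uf]; split; [|exact: H10_L2|].
  by apply: filterS Hu => i; exact: H10_L2.
apply: (@squeeze0 _ _ _ _ _ (fun i => L / pi * L2norm L (wderiv L (u i) - wderiv L f))); last first.
  by rewrite -(mulr0 (L / pi)); apply: cvgM => //; exact: cvg_cst.
near=> i; rewrite L2norm_ge0/=.
have Hui : H10 L (u i) by near: i.
have [H E] := H10_sub L_gt0 Hui Hf.
have := wirtinger L_gt0 H; rewrite (L2eq_norm _ _ E)//; first exact: H10_L2_wderiv.
by apply: L2_sub => //; exact: H10_L2_wderiv.
Unshelve. all: by end_near. Qed.

(** The solution operator is linear and bounded from L^2 to H^1_0, by [wderiv_poisson_bound]. *)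
Lemma cvgL2_poisson (u G : I -> R -> R) f K : (\forall i \near F, poisson (u i) (G i)) ->
  poisson f K -> cvgL2 L F G K -> cvgL2 L F (fun i => wderiv L (u i)) (wderiv L f).
Proof.
move=> uG fK [LG LK GK]; have Lf := H10_L2_wderiv fK.1; split => //.
  by apply: filterS uG => i [H _]; exact: H10_L2_wderiv.
apply: (@squeeze0 _ _ _ _ _ (fun i => L / pi * L2norm L (G i - K))); last first.
  by rewrite -(mulr0 (L / pi)); apply: cvgM => //; exact: cvg_cst.
near=> i; rewrite L2norm_ge0/=.
have p1 : poisson (u i) (G i) by near: i.
have LGi : L2 L (G i) by near: i.
have := poisson_comb 1 LGi (L2_0 L) LK p1 poisson0 fK; rewrite !subr0 !scale1r => -[H p].
have [_ E] := H10_sub L_gt0 p1.1 fK.1.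
have := wderiv_poisson_bound L_gt0 (L2_sub LGi LK) H p.
by rewrite (L2eq_norm _ _ E)//; [exact: H10_L2_wderiv|apply: L2_sub => //; exact: H10_L2_wderiv p1.1].
Unshelve. all: by end_near. Qed.

End filter.

Lemma H10_quot c u v : H10 L u -> H10 L v -> H10 L (c *: (u - v)) /\
  wderiv L (c *: (u - v)) ~ c *: (wderiv L u - wderiv L v).
Proof.
move=> Hu Hv; have [H1 E1] := H10_sub L_gt0 Hu Hv.
have [H2 E2] := H10_scale L_gt0 c H1; split; first exact: H2.
have L1 := H10_L2_wderiv H1; have L2' := H10_L2_wderiv H2.
have L3 := L2_sub (H10_L2_wderiv Hu) (H10_L2_wderiv Hv).
exact: (L2eq_trans L2' (L2_scale _ L1) (L2_scale _ L3) E2 (L2eq_scale _ L1 L3 E1)).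
Qed.

Lemma diffL2_quot t (u : R -> R -> R) f : (\forall s \near t^', H10 L (u s)) -> H10 L (u t) -> H10 L f ->
  (\forall s \near t^', H10 L ((s - t)^-1 *: (u s - u t))) /\
  (cvgL2 L t^' (fun s => wderiv L ((s - t)^-1 *: (u s - u t))) (wderiv L f) <->
   diffL2 L t (fun s => wderiv L (u s)) (wderiv L f)).
Proof.
move=> Hus Hut Hf; have [H0 _] := H10_0 L_gt0; have Lt := H10_L2_wderiv Hut.
have H s (Hs : H10 L (u s)) := H10_quot (s - t)^-1 Hs Hut.
split; first by apply: filterS Hus => s /H[].
split; apply: cvgL2_eq; apply: filterS Hus => s Hs; have [H1 E1] := H s Hs.
  have L1 := L2_scale (s - t)^-1 (L2_sub (H10_L2_wderiv Hs) Lt).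
  by split => //; apply: L2eq_sym => //; exact: H10_L2_wderiv.
by split => //; exact: H10_L2_wderiv.
Qed.

Lemma diffL2_wderiv t (u : R -> R -> R) f : (\forall s \near t^', H10 L (u s)) -> H10 L (u t) -> H10 L f ->
  diffL2 L t (fun s => wderiv L (u s)) (wderiv L f) -> diffL2 L t u f.
Proof.
move=> Hus Hut Hf; have [Hq [_ Q]] := diffL2_quot Hus Hut Hf => /Q.
exact: cvgL2_wderiv.
Qed.

(** The solution operator commutes with differentiation in time: the quotient of the solutions
    solves the problem with the quotient of the sources. *)
Lemma diffL2_poisson t (u G : R -> R -> R) f K : (\forall s \near t^', poisson (u s) (G s)) ->
  (\forall s \near t^', L2 L (G s)) -> poisson (u t) (G t) -> L2 L (G t) -> L2 L K ->
  poisson f K -> diffL2 L t G K -> diffL2 L t (fun s => wderiv L (u s)) (wderiv L f).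
Proof.
move=> us LG ut LGt LK fK dG.
have Hus : \forall s \near t^', H10 L (u s) by apply: filterS us => s [].
have [_ [Q _]] := diffL2_quot Hus ut.1 fK.1; apply: Q.
apply: cvgL2_poisson fK dG; apply: filterS2 us LG => s us LGs.
by have := poisson_comb (s - t)^-1 LGs LGt (L2_0 L) us ut poisson0; rewrite !subr0.
Qed.

Lemma diffL2_shift t k (u : R -> R -> R) f : diffL2 L (t + k) u f -> diffL2 L t (fun s => u (s + k)) f.
Proof.
have sh : (s + k) @[s --> t^'] --> (t + k)^'.
  move=> A /cvg_shift_dnbhs H; have := @cvg_unshift_dnbhs _ t _ H.
  suff -> : (fun s => s + k) = (fun h : R => h + (t + k)) \o (fun s => s - t) by [].
  by apply/funext => s /=; rewrite addrA subrK.
have E : (fun s => (s - t)^-1 *: (u (s + k) - u (t + k))) =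
    (fun s => (s - (t + k))^-1 *: (u s - u (t + k))) \o (fun s => s + k).
  by apply/funext => s /=; congr (_^-1 *: _); rewrite opprD addrACA subrr addr0.
move=> [Lu Lf uf]; rewrite /diffL2 E; split => //; first exact: sh _ Lu.
exact: cvg_comp sh uf.
Qed.

Lemma diffL2_sub t (u v : R -> R -> R) f g : diffL2 L t u f -> diffL2 L t v g ->
  diffL2 L t (fun s => u s - v s) (f - g).
Proof.
move=> du dv; rewrite /diffL2.
have -> : (fun s => (s - t)^-1 *: (u s - v s - (u t - v t))) =
    (fun s => (s - t)^-1 *: (u s - u t) - (s - t)^-1 *: (v s - v t)).
  by apply/funext => s; rewrite -[RHS]scalerBr; congr (_ *: _); apply/funext => x; rewrite -[LHS]/(u s x - v s x - (u t x - v t x)) -[RHS]/(u s x - u t x - (v s x - v t x)); ring.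
exact: cvgL2_sub.
Qed.

Lemma diffL2_scale t c (u : R -> R -> R) f : diffL2 L t u f -> diffL2 L t (fun s => c *: u s) (c *: f).
Proof.
move=> du; rewrite /diffL2.
have -> : (fun s => (s - t)^-1 *: (c *: u s - c *: u t)) = (fun s => c *: ((s - t)^-1 *: (u s - u t))).
  by apply/funext => s; rewrite -scalerBr !scalerA mulrC.
exact: cvgL2_scalec.
Qed.

Lemma diffL2_add t (u v : R -> R -> R) f g : diffL2 L t u f -> diffL2 L t v g ->
  diffL2 L t (fun s => u s + v s) (f + g).
Proof.
move=> du dv; rewrite /diffL2.
have -> : (fun s => (s - t)^-1 *: (u s + v s - (u t + v t))) =
    (fun s => (s - t)^-1 *: (u s - u t) + (s - t)^-1 *: (v s - v t)).
  by apply/funext => s; rewrite -scalerDr opprD addrACA.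
exact: cvgL2_add.
Qed.

Lemma diffL2_eq t (u v : R -> R -> R) f : (\forall s \near t^', [/\ L2 L (v s), L2 L (u s) & v s ~ u s]) ->
  L2 L (v t) -> L2 L (u t) -> v t ~ u t -> diffL2 L t u f -> diffL2 L t v f.
Proof.
move=> vu Lvt Lut vut; apply: cvgL2_eq; apply: filterS vu => s [Lv Lu vus]; split.
  by apply: L2_scale; exact: L2_sub.
apply: L2eq_scale; [exact: L2_sub|exact: L2_sub|exact: L2eq_sub].
Qed.

End poisson.

(** * Distributional inequalities *)

Section distributions.
Context {R : realType}.
Implicit Types (B : R) (f g phi : R -> R).

(** Brings time integrals into a bounded interval, where the L^2 theory developed for the space
    variable applies. *)
Lemma test_fun_halfline phi : test_fun `]0, +oo[ phi -> exists B, 0 < B /\ test_fun `]0, B[ phi.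
Proof.
move=> tphi; have c1 : (1 : R) \in `]0, +oo[ by rewrite in_itv/= ltr01.
have [al [be []]] := test_fun_supp c1 tphi.
rewrite !in_itv/= !andbT => a0 b0 ab z; exists (be + 1); split; first by rewrite addr_gt0.
apply: (@test_funI _ al be) => //; first exact: test_fun_smooth tphi.
move=> x /=; rewrite !in_itv/= => /andP[ax xb]; apply/andP; split.
  exact: lt_le_trans ax.
by rewrite (le_lt_trans xb)// ltrDl.
Qed.

Lemma dist_ofE B f phi : (forall x, x \notin `]0, B[ -> phi x = 0) -> dist_of f phi = ip B f phi.
Proof.
move=> z; rewrite /dist_of /ip Rintegral_mkcond [RHS]Rintegral_mkcond.
congr Rintegral; apply/funext => x; rewrite !patchE.
have [xi|xi] := boolP (x \in `]0, B[).
  rewrite !mem_set//=; move: xi; rewrite !in_itv/= => /andP[-> ]//.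
have -> : (x \in `]0, B[%classic) = false by apply/negP => /set_mem; exact/negP.
by case: ifP => // _; rewrite z ?mulr0.
Qed.

Lemma continuous_mul_test B f phi : test_fun `]0, B[ phi ->
  (forall t, 0 < t -> {for t, continuous f}) -> continuous (f * phi).
Proof.
move=> tphi cf; have [B0|B0] := leP B 0.
  have -> : f * phi = cst 0.
    apply/funext => x; rewrite -[LHS]/(f x * phi x) (test_fun_out tphi) ?mulr0//=.
    by rewrite in_itv/= => /andP[h1 h2]; have := lt_trans h1 h2; rewrite ltNge B0.
  by move=> x; exact: cst_continuous.
have cB : B / 2 \in `]0, B[ by rewrite in_itv/=; apply/andP; split; lra.
have [al [be [ai bi _ z]]] := test_fun_supp cB tphi.
have [a0 bB] : 0 < al /\ be < B by rewrite (itvP ai) (itvP bi).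
apply: (continuous_supp a0 bB) => x.
  move=> /andP[x0 _]; apply: continuousM; first exact: cf.
  by apply: smooth_continuous; exact: test_fun_smooth tphi.
by move=> xi; rewrite -[LHS]/(f x * phi x) z// mulr0.
Qed.

(* W = G phi - \int (g phi + G phi') is nonincreasing and vanishes at 0. *)
Lemma dist_le_of_derive B (G G' g phi : R -> R) : test_fun `]0, B[ phi -> (forall t, 0 <= phi t) ->
  (forall t : R, 0 < t -> is_derive t 1 G (G' t)) -> (forall t, 0 < t -> G' t <= g t) ->
  (forall t, 0 < t -> {for t, continuous g}) -> 0 < B ->
  - ip B G (phi^`())%classic <= ip B g phi.
Proof.
move=> tphi phi0 dG Gg cg B0; have tphi' := test_fun_derive B0 tphi.
have cG t : 0 < t -> {for t, continuous G}.
  by move=> t0; apply/differentiable_continuous/derivable1_diffP; case: (dG t t0).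
have c1 := continuous_mul_test tphi cg; have c2 := continuous_mul_test tphi' cG.
pose f := g * phi + G * (phi^`())%classic.
have cf : continuous f by move=> x; apply: continuousD; [exact: c1|exact: c2].
have Lf := L2_continuous B cf.
pose W := G * phi - prim B f.
have [p0 pB] := test_fun_bnd tphi.
have dW t : t \in `]0, B[ -> is_derive t 1 W ((G' t - g t) * phi t).
  rewrite in_itv/= => t0B; have /andP[t0 tB] := t0B.
  have dp := prim_is_derive cf t0B; have dGt := dG t t0.
  have dphi : is_derive t 1 phi ((phi^`())%classic t).
    by rewrite derive1E; apply: derivableP; exact: smooth_derivable (test_fun_smooth tphi).
  apply: is_derive_eq.
  rewrite -[f t]/(g t * phi t + G t * (phi^`())%classic t) /GRing.scale/=; ring.
have cW : {within `[0, B], continuous W}.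
  apply: continuous_subspaceT => x; apply: continuousB; last exact: prim_continuous.
  by apply: (continuous_mul_test tphi).
have [c] := MVT B0 dW cW.
rewrite in_itv/= => /andP[c0 cB]; rewrite subr0.
have -> : W B = - (ip B g phi + ip B G (phi^`())%classic).
  rewrite -[W B]/(G B * phi B - prim B f B) pB mulr0 add0r primL//.
  have := ipDl (L2_continuous B c1) (L2_continuous B c2) (L2_cst B 1).
  by rewrite !ip_mul1 => ->.
have -> : W 0 = 0.
  by rewrite -[W 0]/(G 0 * phi 0 - prim B f 0) p0 mulr0 prim0// subrr.
move=> E; have : (G' c - g c) * phi c * B <= 0.
  apply: mulr_le0_ge0; last exact: ltW.
  by apply: mulr_le0_ge0 => //; rewrite subr_le0 Gg.
by rewrite -E; lra.
Qed.

(** The bound on the support [al, be] of phi makes M phi a dominating function; bounds near t = 0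
    play no part, as phi vanishes there. *)
Lemma ip_continuous_cvg B (f_ : nat -> R -> R) f phi : 0 < B -> test_fun `]0, B[ phi ->
  (forall n t, 0 < t -> {for t, continuous (f_ n)}) ->
  (forall t, 0 < t -> {for t, continuous f}) ->
  (forall al be, 0 < al -> exists M : R, forall n t, al <= t <= be -> `|f_ n t| <= M) ->
  (forall t, 0 < t -> f_ n t @[n --> \oo] --> f t) ->
  ip B (f_ n) phi @[n --> \oo] --> ip B f phi.
Proof.
move=> B0 tphi cf_ cf bd ff.
have cB : B / 2 \in `]0, B[ by rewrite in_itv/=; apply/andP; split; lra.
have [al [be [ai bi _ z]]] := test_fun_supp cB tphi.
have a0 : 0 < al by rewrite (itvP ai).
have [M HM] := bd al be a0.
have Lphi := L2_test_fun tphi.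
have Lf_ n : L2 B (f_ n * phi) by apply/L2_continuous/(continuous_mul_test tphi)/cf_.
have Lf : L2 B (f * phi) by exact/L2_continuous/(continuous_mul_test tphi)/cf.
have [_ cv] : L2 B (f * phi) /\ L2norm B (f * phi - f_ n * phi) @[n --> \oo] --> 0.
  apply: (@L2_dominated _ _ _ _ (M *: phi)) => //; first exact: L2_scale.
  - exact: L2_measurable.
  - move=> n x _; rewrite -[(f_ n * phi) x]/(f_ n x * phi x) -[(M *: phi) x]/(M * phi x).
    have [xi|xi] := boolP (x \in `[al, be]); last by rewrite z// !mulr0.
    rewrite !normrM; apply: ler_wpM2r => //; rewrite (le_trans _ (ler_norm _))// HM//.
  - move=> x; rewrite /= in_itv/= => /andP[x0 _].
    by apply: cvgM; [exact: ff|exact: cvg_cst].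
have H : cvgL2 B \oo (fun n => f_ n * phi) (f * phi).
  split => //; first exact: nearW.
  by apply: cvg_trans cv; apply: near_eq_cvg; apply: nearW => n; rewrite L2norm_distC.
have : ip B (f_ n * phi) (cst 1) @[n --> \oo] --> ip B (f * phi) (cst 1).
  by apply: (cvgL2_ip H); apply: cvgL2_cst; exact: L2_cst.
by rewrite ip_mul1; under eq_fun do rewrite ip_mul1.
Qed.

Lemma ip_le_test B f g phi : test_fun `]0, B[ phi -> (forall t, 0 <= phi t) ->
  (forall t, 0 < t -> {for t, continuous f}) -> (forall t, 0 < t -> {for t, continuous g}) ->
  (forall t, 0 < t -> f t <= g t) -> ip B f phi <= ip B g phi.
Proof.
move=> tphi phi0 cf cg fg.
have Lf : L2 B (f * phi) by exact/L2_continuous/(continuous_mul_test tphi)/cf.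
have Lg : L2 B (g * phi) by exact/L2_continuous/(continuous_mul_test tphi)/cg.
have E : ip B (g * phi - f * phi) (cst 1) = ip B g phi - ip B f phi.
  by rewrite ipBl ?ip_mul1//; exact: L2_cst.
rewrite -subr_ge0 -E; apply: Rintegral_ge0 => x; rewrite /= in_itv/= => /andP[x0 _].
rewrite mulr1 -[X in 0 <= X]/(g x * phi x - f x * phi x) -mulrBl.
by apply: mulr_ge0 => //; rewrite subr_ge0 fg.
Qed.

End distributions.

(** Combines the Poisson equations of h at times s and t with the weak equation at t, z being the
    value of y_tt on Q. The right side pairs Q with the quotient errors of a y and of y_t. *)
Lemma ip_quot_identity (R : realType) (L c z : R) (ms mt m fs ft f ws wt Q Q' : R -> R) :
  L2 L ms -> L2 L mt -> L2 L m -> L2 L fs -> L2 L ft -> L2 L f -> L2 L ws -> L2 L wt ->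
  L2 L Q -> L2 L Q' ->
  ip L ms Q' = - ip L (fs + ws) Q -> ip L mt Q' = - ip L (ft + wt) Q ->
  z + ip L m Q' + ip L f Q = 0 ->
  ip L (c *: (ms - mt) - m) Q' = - ip L (c *: (fs - ft) - f) Q - (c * (ip L ws Q - ip L wt Q) - z).
Proof.
move=> Lms Lmt Lm Lfs Lft Lf Lws Lwt LQ LQ' Es Et W.
have [Lmst Lfst] := (L2_sub Lms Lmt, L2_sub Lfs Lft).
rewrite (ipBl (L2_scale _ Lmst) Lm LQ') (ipZl _ Lmst LQ') (ipBl Lms Lmt LQ') Es Et.
rewrite (ipBl (L2_scale _ Lfst) Lf LQ) (ipZl _ Lfst LQ) (ipBl Lfs Lft LQ).
rewrite (ipDl Lfs Lws LQ) (ipDl Lft Lwt LQ).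
have -> : ip L m Q' = - z - ip L f Q 
  by move: (ip L m Q') (ip L f Q) W => u v W; lra.
ring.
Qed.

(** * Dissipation along weak solutions *)

Section weak_solutions.
Context {R : realType}.
Variables (L : R) (a y0 y1 : R -> R) (y yt : R -> R -> R).
Hypotheses (L_gt0 : 0 < L) (a_Linf : Linf L a) (sol : weak_solution L a y0 y1 y yt).
Local Notation "f ~ g" := (L2eq L f g) (at level 70).
Local Notation h := (fun t => calL L a (y t) (yt t)).

Lemma sol_H10 t : 0 <= t -> H10 L (y t).
Proof. by move: t; case: sol => -[]. Qed.

Lemma sol_L2 t : 0 <= t -> L2 L (yt t).
Proof. by move: t; case: sol => _ []. Qed.

Lemma poisson_calL f g : L2 L f -> L2 L g -> poisson L (calL L a f g) (a * f + g).
Proof. by move=> Lf Lg; apply: calLP => //; exact: L2_source. Qed.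

Lemma sol_poisson t : 0 <= t -> poisson L (h t) (a * y t + yt t).
Proof. by move=> t0; apply: poisson_calL; [exact/H10_L2/sol_H10|exact: sol_L2]. Qed.

Lemma near_gt0 (t : R) : 0 < t -> \forall s \near t, 0 < s.
Proof. exact: lt_nbhsr. Qed.

Lemma near_dnbhs_gt0 (t : R) : 0 < t -> \forall s \near t^', 0 < s.
Proof. by move=> /near_gt0; exact: nbhs_dnbhs. Qed.

Lemma near_halfline (t : R) : 0 < t -> nbhs t (`[0, +oo[%classic : set R).
Proof. by move=> /near_gt0; apply: filterS => s s0; rewrite /= in_itv/= andbT ltW. Qed.

Lemma nearW_within (T : Type) (F : set_system T) (A P : set T) : Filter F ->
  (forall s, A s -> P s) -> \forall s \near within A F, P s.
Proof. by move=> FF AP; rewrite near_withinE; exact: nearW. Qed.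

Lemma sol_diff t : 0 < t -> diffL2 L t y (yt t).
Proof.
move=> t0; have t0' := ltW t0; case: sol => _ _ d _ _; split.
- near=> s; apply: L2_scale; apply: L2_sub; apply/H10_L2/sol_H10 => //.
  by apply: ltW; near: s; exact: near_dnbhs_gt0.
- exact: sol_L2.
- by move=> A /(d t t0'); apply: within_dnbhs_interior; exact: near_halfline.
Unshelve. all: by end_near. Qed.

Lemma sol_cvg (t : R) : 0 <= t -> cvgL2 L (within `[0, +oo[ (nbhs t)) yt (yt t) /\
  cvgL2 L (within `[0, +oo[ (nbhs t)) (fun s => wderiv L (y s)) (wderiv L (y t)).
Proof.
move=> t0; case: sol => -[Hy cy] [Lyt cyt] _ _ _; split; split.
- by apply: nearW_within => s; rewrite /= in_itv/= andbT; exact: Lyt.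
- exact: Lyt.
- exact: cyt.
- by apply: nearW_within => s; rewrite /= in_itv/= andbT => /Hy/H10_L2_wderiv.
- exact/H10_L2_wderiv/Hy.
- apply: (@squeeze0 _ _ _ _ _ (fun s => H1norm L (y s - y t))); last exact: cy.
  apply: nearW_within => s; rewrite /= in_itv/= andbT => s0; rewrite L2norm_ge0/=.
  have [H E] := H10_sub L_gt0 (Hy s s0) (Hy t t0).
  rewrite -(L2eq_norm _ _ E); last 2 first.
  - exact: H10_L2_wderiv.
  - by apply: L2_sub; exact/H10_L2_wderiv/Hy.
  by have [] := H1norm_ge L (y s - y t).
Qed.

(* calL (y, y_t) is a primitive in time of y, for the topology of H^1_0. *)
Lemma sol_calL_diff t : 0 < t -> diffL2 L t (fun s => wderiv L (h s)) (wderiv L (y t)).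
Proof.
move=> t0; have t0' := ltW t0; case: (sol) => _ _ _ _ [ytt [Hytt _ dytt weak]].
have [_ a0 _] := LinfP a_Linf; have c0 := H1const_ge0 L_gt0.
pose q s := (s - t)^-1 *: (y s - y t) - yt t.
pose G s := (s - t)^-1 *: (Hm1_of_L2 L (yt s) - Hm1_of_L2 L (yt t)) - ytt t.
have [Hyt Lyt] := (sol_H10 t0', sol_L2 t0').
have HG s : 0 < s -> Hm1 L (G s).
  move=> s0; apply: Hm1_sub (Hytt t t0'); apply: Hm1_scale; apply: Hm1_sub; apply: Hm1_of_L2P => //.
  exact/sol_L2/ltW.
have Lq s : 0 < s -> L2 L (q s).
  move=> s0; apply: L2_sub => //; apply: L2_scale; apply: L2_sub; last exact: H10_L2.
  exact/H10_L2/sol_H10/ltW.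
(* The error of the quotient of h is controlled by two quantities that tend to 0 by the definition
   of a weak solution: the L^2 error for y and the H^{-1} error for y_t. *)
have bound s : 0 < s ->
    L2norm L ((s - t)^-1 *: (wderiv L (h s) - wderiv L (h t)) - wderiv L (y t))
    <= (Linfnorm L a * L2norm L (q s) + Hm1norm L (G s)) * H1const L.
  move=> s0; have s0' := ltW s0; have [Hs ps] := sol_poisson s0'; have [Ht pt] := sol_poisson t0'.
  have [HQ EQ] := H10_comb L_gt0 (s - t)^-1 Hs Ht Hyt.
  set Q := _ - y t in HQ EQ.
  have Ls := H10_L2_wderiv Hs; have Lt := H10_L2_wderiv Ht; have Ly := H10_L2_wderiv Hyt.
  have LQ := H10_L2_wderiv HQ; have Lst := L2_sub Ls Lt.
  rewrite -(L2eq_norm LQ (L2_sub (L2_scale _ Lst) Ly) EQ).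
  have n0 : 0 <= H1norm L Q by exact: sqrtr_ge0.
  have [Laq Baq] := Linf_mul a_Linf (Lq s s0).
  apply: wderiv_energy_bound => //; last first.
    apply: addr_ge0; first by apply: mulr_ge0 => //; exact: L2norm_ge0.
    exact/Hm1norm_ge0/HG.
  have Lys := H10_L2 (sol_H10 s0'); have Lyts := sol_L2 s0'.
  have [Lays _] := Linf_mul a_Linf Lys; have [Layt _] := Linf_mul a_Linf (H10_L2 Hyt).
  have [Laytt _] := Linf_mul a_Linf Lyt.
  have LQ0 := H10_L2 HQ.
  (* The error Q serves as its own test function. *)
  have E : ip L (wderiv L Q) (wderiv L Q) = - ip L (a * q s) Q - G s Q.
    rewrite (L2eq_ipl LQ (L2_sub (L2_scale _ Lst) Ly) LQ EQ).
    have W : ytt t Q + ip L (wderiv L (y t)) (wderiv L Q) + ip L (a * yt t) Q = 0 := weak Q t HQ t0'.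
    have -> : a * q s = (s - t)^-1 *: (a * y s - a * y t) - a * yt t.
      apply/funext => x; rewrite -[LHS]/(a x * ((s - t)^-1 * (y s x - y t x) - yt t x)).
      by rewrite -[RHS]/((s - t)^-1 * (a x * y s x - a x * y t x) - a x * yt t x); ring.
    exact: (ip_quot_identity _ Ls Lt Ly Lays Layt Laytt Lyts Lyt LQ0 LQ (ps Q HQ) (pt Q HQ) W).
  have [n1 _] := H1norm_ge L Q.
  have B1 := le_trans (cauchy_schwarz Laq LQ0) (ler_pM (L2norm_ge0 L _) (L2norm_ge0 L _) Baq n1).
  have B2 := Hm1norm_bound L_gt0 (HG s s0) HQ.
  by rewrite E; apply: le_trans (ler_normB _ _) _; rewrite normrN mulrDl; exact: lerD.
have Lh s : 0 < s -> L2 L (wderiv L (h s)).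
  by move=> s0; have [H _] := sol_poisson (ltW s0); exact: H10_L2_wderiv.
split; [|exact: H10_L2_wderiv|].
  near=> s; apply: L2_scale; apply: L2_sub; apply: Lh => //.
  by near: s; exact: near_dnbhs_gt0.
apply: (@squeeze0 _ _ _ _ _ (fun s => (Linfnorm L a * L2norm L (q s) + Hm1norm L (G s)) * H1const L)).
  near=> s; rewrite L2norm_ge0/=; apply: bound.
  by near: s; exact: near_dnbhs_gt0.
rewrite -(mul0r (H1const L)); apply: cvgM; last exact: cvg_cst.
rewrite -(addr0 (0 : R)); apply: cvgD.
  rewrite -(mulr0 (Linfnorm L a)); apply: cvgM; first exact: cvg_cst.
  by case: (sol_diff t0).
by move=> A /(dytt t t0'); apply: within_dnbhs_interior; exact: near_halfline.
Unshelve. all: by end_near. Qed.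

End weak_solutions.

(** * Continuity and time derivative of V *)

Section lyapunov.
Context {R : realType}.
Variables (L : R) (a p q : R -> R) (amin e1 d1 d2 : R).
Hypotheses (L_gt0 : 0 < L) (a_Linf : Linf L a) (p_Linf : Linf L p) (q_Linf : Linf L q).
Local Notation "f ~ g" := (L2eq L f g) (at level 70).
Local Notation V := (lyapunov L a q p amin e1).
Local Notation Dis u w := (- d1 * ip L (wderiv L u) (wderiv L u) - d2 * ip L w w).

Lemma lyapunovE f g : H10 L f -> L2 L g ->
  let c := wderiv L (calL L a f g) in let m := wderiv L f in
  V f g = 2^-1 * (ip L m m + ip L g g) + e1 * (ip L (p * f) g + ip L (q * g) m)
    + C0c L p amin e1 * (2^-1 * (ip L c c + ip L f f)).
Proof.
move=> Hf Lg c m; have [Hc _] := poisson_calL L_gt0 a_Linf (H10_L2 Hf) Lg.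
rewrite /lyapunov /energy0 !energyE ?MfunE ?L2norm_sqr//.
- exact: H10_L2_wderiv.
- exact: H10_L2.
- exact: H10_L2_wderiv.
Qed.

Lemma cvg_lyapunov_comb (I : Type) (G : set_system I) {FG : Filter G}
    (A B C D E F : I -> R) (A' B' C' D' E' F' e C0 : R) :
  A i @[i --> G] --> A' -> B i @[i --> G] --> B' -> C i @[i --> G] --> C' ->
  D i @[i --> G] --> D' -> E i @[i --> G] --> E' -> F i @[i --> G] --> F' ->
  (2^-1 * (A i + B i) + e * (C i + D i) + C0 * (2^-1 * (E i + F i))) @[i --> G] -->
    2^-1 * (A' + B') + e * (C' + D') + C0 * (2^-1 * (E' + F')).
Proof.
move=> cA cB cC cD cE cF.
have k (c : R) : (fun _ : I => c) i @[i --> G] --> c by exact: cvg_cst.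
exact: (cvgD (cvgD (cvgM (k _) (cvgD cA cB)) (cvgM (k _) (cvgD cC cD))) (cvgM (k _) (cvgM (k _) (cvgD cE cF)))).
Qed.

Lemma lyapunov_cvg (I : Type) (F : set_system I) (u w : I -> R -> R) f g : Filter F ->
  (\forall i \near F, H10 L (u i)) -> H10 L f ->
  cvgL2 L F (fun i => wderiv L (u i)) (wderiv L f) -> cvgL2 L F w g ->
  V (u i) (w i) @[i --> F] --> V f g.
Proof.
move=> FF Hu Hf cm cw; have [Lw Lg _] := cw.
have cu : cvgL2 L F u f by exact: (@cvgL2_wderiv R L L_gt0 I F FF u f Hu Hf cm).
have cc : cvgL2 L F (fun i => wderiv L (calL L a (u i) (w i))) (wderiv L (calL L a f g)).
  apply: (cvgL2_poisson L_gt0 (G := fun i => a * u i + w i) _ (poisson_calL L_gt0 a_Linf (H10_L2 Hf) Lg)).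
    by near=> i; apply: poisson_calL => //; [apply: H10_L2|]; near: i.
  by apply: cvgL2_add => //; exact: cvgL2_Linf.
rewrite (lyapunovE Hf Lg).
have H := cvg_lyapunov_comb (FG := FF) (e := e1) (C0 := C0c L p amin e1) (cvgL2_ip cm cm) (cvgL2_ip cw cw)
  (cvgL2_ip (cvgL2_Linf p_Linf cu) cw) (cvgL2_ip (cvgL2_Linf q_Linf cw) cm)
  (cvgL2_ip cc cc) (cvgL2_ip cu cu).
apply: cvg_trans (H FF FF FF FF FF FF FF FF) => {H}; apply: near_eq_cvg; near=> i.
by symmetry; apply: lyapunovE; near: i.
Unshelve. all: by end_near. Qed.

Lemma is_derive_lyapunov_comb (A B C D E F : R -> R) (A' B' C' D' E' F' e C0 t : R) :
  is_derive t 1 A A' -> is_derive t 1 B B' -> is_derive t 1 C C' -> is_derive t 1 D D' ->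
  is_derive t 1 E E' -> is_derive t 1 F F' ->
  is_derive t 1 (fun s => 2^-1 * (A s + B s) + e * (C s + D s) + C0 * (2^-1 * (E s + F s)))
    (2^-1 * (A' + B') + e * (C' + D') + C0 * (2^-1 * (E' + F'))).
Proof.
move=> dA dB dC dD dE dF.
exact: (is_deriveD (is_deriveD (is_deriveZ _ (is_deriveD dA dB)) (is_deriveZ _ (is_deriveD dC dD)))
  (is_deriveZ _ (is_deriveZ _ (is_deriveD dE dF)))).
Qed.

Hypothesis diss : forall u w F, H10 L u -> H10 L w -> L2 L F ->
  (forall v, H10 L v -> ip L (wderiv L u) (wderiv L v) = - ip L F v) ->
  - ip L (a * w) w
  + e1 * (ip L (p * u) (F - a * w) + ip L (p * w) w
          + ip L (q * (F - a * w)) (wderiv L u) + ip L (q * w) (wderiv L w))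
  - C0c L p amin e1 * ip L (a * u) u <= Dis u w.

(** The hypotheses say u_t = w, w_t = om and u_xx = a w + om. Testing the Poisson equation of u with
    w gives E' = - \int a w^2, and testing that of calL(u, w) with u gives E_0' = - \int a u^2. *)
Lemma lyapunov_derive t (u w : R -> R -> R) (om : R -> R) :
  (\forall s \near t, H10 L (u s) /\ H10 L (w s)) -> poisson L (u t) (a * w t + om) ->
  diffL2 L t (fun s => wderiv L (u s)) (wderiv L (w t)) -> diffL2 L t w om ->
  derivable (fun s => V (u s) (w s)) t 1 /\ 'D_1 (fun s => V (u s) (w s)) t <= Dis (u t) (w t).
Proof.
move=> Huw put dm dw; have [Hut Hwt] := nbhs_singleton Huw.
have Huw' := nbhs_dnbhs Huw.
have Hu : \forall s \near t^', H10 L (u s) by apply: filterS Huw' => s [].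
have [Lut Lwt] := (H10_L2 Hut, H10_L2 Hwt); have [Lmt Lzt] := (H10_L2_wderiv Hut, H10_L2_wderiv Hwt).
have [_ Lom _] := dw.
have du := diffL2_wderiv L_gt0 Hu Hut Hwt dm.
have pc s : H10 L (u s) /\ H10 L (w s) -> poisson L (calL L a (u s) (w s)) (a * u s + w s).
  by move=> [/H10_L2 Lu /H10_L2 Lw]; exact: poisson_calL.
have dG : diffL2 L t (fun s => a * u s + w s) (a * w t + om).
  by apply: diffL2_add => //; exact: diffL2_Linf.
have [_ LF _] := dG.
(* The source a u + w of calL(u, w) has time derivative a w + om, the source of u; hence calL(u, w)
   has derivative u. *)
have dc : diffL2 L t (fun s => wderiv L (calL L a (u s) (w s))) (wderiv L (u t)).
  have h1 : \forall s \near t^', poisson L (calL L a (u s) (w s)) (a * u s + w s).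
    by apply: filterS Huw' => s; exact: pc.
  have h2 : \forall s \near t^', L2 L (a * u s + w s).
    by apply: filterS Huw' => s [/H10_L2 Lu /H10_L2 Lw]; exact: L2_source.
  exact: (@diffL2_poisson _ L L_gt0 t (fun s => calL L a (u s) (w s)) (fun s => a * u s + w s)
    (u t) (a * w t + om) h1 h2 (pc t (conj Hut Hwt)) (L2_source a_Linf Lut Lwt) LF put dG).
have Hct := (pc t (conj Hut Hwt)).1; have Lct := H10_L2_wderiv Hct.
have Lb b f : Linf L b -> L2 L f -> L2 L (b * f) by move=> Hb Hf; have [] := Linf_mul Hb Hf.
have dV := is_derive_lyapunov_comb e1 (C0c L p amin e1)
  (diffL2_ip Lmt Lmt dm dm) (diffL2_ip Lwt Lwt dw dw)
  (diffL2_ip (Lb _ _ p_Linf Lut) Lwt (diffL2_Linf p_Linf du) dw)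
  (diffL2_ip (Lb _ _ q_Linf Lwt) Lmt (diffL2_Linf q_Linf dw) dm)
  (diffL2_ip Lct Lct dc dc) (diffL2_ip Lut Lut du du).
set dv := (X in is_derive _ _ _ X) in dV.
have {dV}dV : is_derive t 1 (fun s => V (u s) (w s)) dv.
  apply: is_derive_near dV; apply: filterS Huw => s [Hus /H10_L2 Lws].
  by symmetry; exact: lyapunovE.
case: dV => dV ->; rewrite {}/dv; split => //.
have := diss Hut Hwt LF put.2.
have -> : a * w t + om - a * w t = om by rewrite addrAC subrr add0r.
apply: le_trans; rewrite le_eqVlt; apply/orP; left; apply/eqP.
have Law := Lb _ _ a_Linf Lwt; have Lau := Lb _ _ a_Linf Lut.
rewrite (ipC L (wderiv L (w t)) (wderiv L (u t))) (ipC L om (w t)).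
rewrite (ipC L (wderiv L (u t)) (wderiv L (calL _ _ _ _))) (ipC L (w t) (u t)).
rewrite put.2// (pc t (conj Hut Hwt)).2// (ipDl Law Lom Lwt) (ipDl Lau Lwt Lut).
rewrite (ipC L (w t) (u t)) (ipC L om (w t)); move: (ip L (a * w t) (w t)) (ip L (w t) om) (ip L (a * u t) (u t)) (ip L (u t) (w t))
  (ip L (p * w t) (w t)) (ip L (p * u t) om) (ip L (q * om) _) (ip L (q * w t) _) (C0c _ _ _ _).
by move=> *; field.
Qed.

End lyapunov.

(** * Difference quotients in time and their uniform bounds *)

Section time_quotients.
Context {R : realType}.
Implicit Types (L t : R) (u : R -> R -> R).

(** The quotients are taken along the steps k = 1 / (n + 1), all positive, because dominated
    convergence concerns sequences. *)
Lemma cvg_add_harmonic t : (t + n.+1%:R^-1) @[n --> \oo] --> t^'.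
Proof.
move=> A; rewrite /dnbhs /within/= => /nbhs_ballP[e /= e0 H].
have := near_infty_natSinv_lt (PosNum e0); apply: filterS => n /= ne.
have n0 : 0 < n.+1%:R^-1 :> R by rewrite invr_gt0.
apply: H; first by rewrite /ball/= opprD addrA subrr sub0r normrN gtr0_norm.
by rewrite -subr_eq0 addrAC subrr add0r gt_eqF.
Qed.

Lemma diffL2_harmonic L t u f : diffL2 L t u f ->
  cvgL2 L \oo (fun n => n.+1%:R *: (u (t + n.+1%:R^-1) - u t)) f.
Proof.
move=> [Lu Lf uf].
have -> : (fun n => n.+1%:R *: (u (t + n.+1%:R^-1) - u t)) =
    (fun s => (s - t)^-1 *: (u s - u t)) \o (fun n => t + n.+1%:R^-1).
  by apply/funext => n /=; rewrite addrAC subrr add0r invrK.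
split => //; first exact: (cvg_add_harmonic Lu).
exact: cvg_comp (@cvg_add_harmonic t) uf.
Qed.

Lemma diffL2_lipschitz_closed L (al be B : R) u (u' : R -> R -> R) : al < be ->
  (forall t, al <= t <= be -> L2 L (u t) /\ diffL2 L t u (u' t)) ->
  (forall t, al <= t <= be -> L2norm L (u' t) <= B) ->
  L2norm L (u be - u al) <= (be - al) * B.
Proof.
move=> ab du Bu; have [al_ be_] : al <= al <= be /\ al <= be <= be by rewrite !lexx ltW.
have oc t : al < t < be -> al <= t <= be by move=> /andP[? ?]; rewrite !ltW.
have sub (t : R) : t^'+ `=>` t^' /\ t^'- `=>` t^'.
  split=> A; rewrite /dnbhs /at_right /at_left /within/=; apply: filterS => x H xt; apply: H.
    by rewrite gt_eqF.
  by rewrite lt_eqF.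
apply: (diffL2_lipschitz (u' := u') ab).
- by move=> t /du[].
- by move=> t /oc tab; split; [have [] := du t tab|exact: Bu].
- have [La da] := du al al_; have [c1 c2 c3] := diffL2_cvg La da.
  by split => //; [exact: (sub al).1|move=> A /c3; exact: (sub al).1].
- have [Lb db] := du be be_; have [c1 c2 c3] := diffL2_cvg Lb db.
  by split => //; [exact: (sub be).2|move=> A /c3; exact: (sub be).2].
Qed.

Lemma quot_norm_le L (t k B : R) u u' : 0 < k ->
  (forall s, t <= s <= t + k -> L2 L (u s) /\ diffL2 L s u (u' s)) ->
  (forall s, t <= s <= t + k -> L2norm L (u' s) <= B) ->
  L2norm L (k^-1 *: (u (t + k) - u t)) <= B.
Proof.
move=> k0 du Bu; have tk : t < t + k by rewrite ltrDl.
have := diffL2_lipschitz_closed tk du Bu.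
have Lu : L2 L (u (t + k) - u t).
  by apply: L2_sub; [have [] := du (t + k)|have [] := du t] => //; rewrite lexx ltW.
by rewrite addrAC subrr add0r L2normZ// gtr0_norm ?invr_gt0// ler_pdivrMl.
Qed.

End time_quotients.

(** * From difference quotients to the weak solution *)

Section distributional_dissipation.
Context {R : realType}.
Variables (L : R) (a p q y0 y1 : R -> R) (y yt : R -> R -> R) (amin e1 d1 d2 C5 : R).
Hypotheses (L_gt0 : 0 < L) (a_Linf : Linf L a) (p_Linf : Linf L p) (q_Linf : Linf L q).
Hypothesis sol : weak_solution L a y0 y1 y yt.
Local Notation "f ~ g" := (L2eq L f g) (at level 70).
Local Notation V := (lyapunov L a q p amin e1).
Local Notation Dis u w := (- d1 * ip L (wderiv L u) (wderiv L u) - d2 * ip L w w).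
Local Notation h := (fun t => calL L a (y t) (yt t)).

Hypothesis diss : forall u w F, H10 L u -> H10 L w -> L2 L F ->
  (forall v, H10 L v -> ip L (wderiv L u) (wderiv L v) = - ip L F v) ->
  - ip L (a * w) w
  + e1 * (ip L (p * u) (F - a * w) + ip L (p * w) w
          + ip L (q * (F - a * w)) (wderiv L u) + ip L (q * w) (wderiv L w))
  - C0c L p amin e1 * ip L (a * u) u <= Dis u w.
Hypothesis V_bound : forall f g, H10 L f -> L2 L g -> `|V f g| <= C5 * energy L f g.
Hypotheses (d1_ge0 : 0 <= d1) (d2_ge0 : 0 <= d2) (C5_ge0 : 0 <= C5).

(** As h_t = y, [uk] approximates y; [wk] is the exact time derivative of [uk] and approximates y_t,
    and [ok] is that of [wk]. *)
Let uk (k t : R) : R -> R := k^-1 *: (h (t + k) - h t).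
Let wk (k t : R) : R -> R := k^-1 *: (y (t + k) - y t).
Let ok (k t : R) : R -> R := k^-1 *: (yt (t + k) - yt t).

Let sH t : 0 < t -> H10 L (y t). Proof. by move=> /ltW; exact: (sol_H10 sol). Qed.
Let sL t : 0 < t -> L2 L (yt t). Proof. by move=> /ltW; exact: (sol_L2 sol). Qed.
Let sP t : 0 < t -> poisson L (h t) (a * y t + yt t).
Proof. by move=> /ltW; exact: (sol_poisson L_gt0 a_Linf sol). Qed.
Let sS t : 0 < t -> L2 L (a * y t + yt t).
Proof. by move=> t0; apply: L2_source => //; [exact/H10_L2/sH|exact: sL]. Qed.

Lemma quot_H10 k t : 0 < k -> 0 < t ->
  [/\ H10 L (uk k t), wderiv L (uk k t) ~ k^-1 *: (wderiv L (h (t + k)) - wderiv L (h t)),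
    H10 L (wk k t) & wderiv L (wk k t) ~ k^-1 *: (wderiv L (y (t + k)) - wderiv L (y t))].
Proof.
move=> k0 t0; have tk0 : 0 < t + k by exact: addr_gt0.
have [h1 h2] := H10_quot L_gt0 k^-1 (sP tk0).1 (sP t0).1.
have [h3 h4] := H10_quot L_gt0 k^-1 (sH tk0) (sH t0).
by split; [exact: h1|exact: h2|exact: h3|exact: h4].
Qed.

(** This is the damped wave equation for [uk], all its terms being in L^2. *)
Lemma quot_poisson k t : 0 < k -> 0 < t -> poisson L (uk k t) (a * wk k t + ok k t).
Proof.
move=> k0 t0; have tk0 : 0 < t + k by exact: addr_gt0.
have := poisson_comb L_gt0 k^-1 (sS tk0) (sS t0) (L2_0 L) (sP tk0) (sP t0) (poisson0 L_gt0).
rewrite !subr0; congr (poisson L _ _); apply/funext => x.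
rewrite -[LHS]/(k^-1 * ((a x * y (t + k) x + yt (t + k) x) - (a x * y t x + yt t x))).
by rewrite -[RHS]/(a x * (k^-1 * (y (t + k) x - y t x)) + k^-1 * (yt (t + k) x - yt t x)); ring.
Qed.

Lemma quot_diff k t : 0 < k -> 0 < t ->
  diffL2 L t (fun s => wderiv L (uk k s)) (wderiv L (wk k t)) /\ diffL2 L t (wk k) (ok k t).
Proof.
move=> k0 t0; have tk0 : 0 < t + k by exact: addr_gt0.
have dsub (f : R -> R -> R) f' : (forall s, 0 < s -> diffL2 L s f (f' s)) ->
    diffL2 L t (fun s => k^-1 *: (f (s + k) - f s)) (k^-1 *: (f' (t + k) - f' t)).
  by move=> df; apply: diffL2_scale; apply: diffL2_sub; [apply: diffL2_shift|]; exact: df.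
split; last by apply: dsub => s s0; exact: (sol_diff sol s0).
have [H1 E1 H2 E2] := quot_H10 k0 t0.
have Lh s : 0 < s -> L2 L (wderiv L (h s)) by move=> s0; exact: H10_L2_wderiv (sP s0).1.
have Lq s : 0 < s -> L2 L (k^-1 *: (wderiv L (h (s + k)) - wderiv L (h s))).
  by move=> s0; apply: L2_scale; apply: L2_sub; apply: Lh => //; exact: addr_gt0.
have D := dsub _ _ (fun s s0 => sol_calL_diff L_gt0 a_Linf sol s0).
have L3 : L2 L (k^-1 *: (wderiv L (y (t + k)) - wderiv L (y t))).
  by apply: L2_scale; apply: L2_sub; apply: H10_L2_wderiv; exact: sH.
apply: (cvgL2_eql (H10_L2_wderiv H2) (L2eq_sym (H10_L2_wderiv H2) L3 E2)).
apply: (diffL2_eq (u := fun s => k^-1 *: (wderiv L (h (s + k)) - wderiv L (h s)))) D.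
- near=> s; have s0 : 0 < s by near: s; exact: near_dnbhs_gt0.
  have [H3 E3 _ _] := quot_H10 k0 s0; split; [exact: H10_L2_wderiv H3|exact: Lq|exact: E3].
- exact: H10_L2_wderiv H1.
- exact: Lq.
- exact: E1.
Unshelve. all: by end_near. Qed.

Lemma quot_cvg t : 0 < t ->
  cvgL2 L \oo (fun n => wderiv L (uk n.+1%:R^-1 t)) (wderiv L (y t)) /\
  cvgL2 L \oo (fun n => wk n.+1%:R^-1 t) (yt t).
Proof.
move=> t0; have n0 n : 0 < n.+1%:R^-1 :> R by rewrite invr_gt0.
split; last first.
  have -> : (fun n => wk n.+1%:R^-1 t) = (fun n => n.+1%:R *: (y (t + n.+1%:R^-1) - y t)).
    by apply/funext => n; rewrite /wk invrK.
  exact: diffL2_harmonic (sol_diff sol t0).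
have := diffL2_harmonic (sol_calL_diff L_gt0 a_Linf sol t0); apply: cvgL2_eq.
apply: nearW => n; have [H1 E1 _ _] := quot_H10 (n0 n) t0.
by rewrite invrK in E1; split => //; exact: H10_L2_wderiv.
Qed.

Let sC (t : R) : 0 < t -> cvgL2 L (nbhs t) yt (yt t) /\ cvgL2 L (nbhs t) (fun s => wderiv L (y s)) (wderiv L (y t)).
Proof.
move=> t0; have [c1 c2] := sol_cvg L_gt0 sol (ltW t0).
by split; [apply: cvgL2_within c1|apply: cvgL2_within c2]; exact: near_halfline.
Qed.

Lemma locally_bounded (f : R -> R) al be : 0 < al -> (forall t, 0 < t -> {for t, continuous f}) ->
  exists M, 0 <= M /\ forall t, al <= t <= be -> `|f t| <= M.
Proof.
move=> a0 cf; apply: within_continuous_bounded.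
apply: continuous_in_subspaceT => t; rewrite inE/= in_itv/= => /andP[alt _].
by apply: cf; exact: lt_le_trans alt.
Qed.

Lemma quot_bound al be : 0 < al -> exists M : R, forall k t, 0 < k <= 1 -> al <= t <= be ->
  ip L (wderiv L (uk k t)) (wderiv L (uk k t)) <= M /\ ip L (wk k t) (wk k t) <= M.
Proof.
move=> a0.
(* A step k <= 1 from a time in [al, be] stays in [al, be + 1]. The bounds on y_t and y_x there
   control the quotients of y and h by the mean value inequality. *)
have [M1 [M10 B1]] := locally_bounded (be + 1) a0 (fun t t0 => cvgL2_norm (sC t0).1).
have [M2 [M20 B2]] := locally_bounded (be + 1) a0 (fun t t0 => cvgL2_norm (sC t0).2).
have sq (f : R -> R) (M N : R) : 0 <= M -> 0 <= N -> L2norm L f <= M -> ip L f f <= M ^+ 2 + N ^+ 2.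
  move=> M0 N0 fM; rewrite -L2norm_sqr (le_trans (_ : _ <= M ^+ 2))//.
    by rewrite ler_sqr ?nnegrE// L2norm_ge0.
  by rewrite lerDl sqr_ge0.
exists (M2 ^+ 2 + M1 ^+ 2) => k t /andP[k0 k1] /andP[alt tb].
have pos s : t <= s <= t + k -> 0 < s /\ al <= s <= be + 1.
  move=> /andP[ts sk]; have als := le_trans alt ts; split; first exact: lt_le_trans als.
  by rewrite als/= (le_trans sk)// lerD.
have t0 : 0 < t by exact: lt_le_trans alt.
have [H1 E1 H2 E2] := quot_H10 k0 t0; split.
  apply: sq => //.
  have Lh s : 0 < s -> L2 L (wderiv L (h s)) by move=> s0; exact: H10_L2_wderiv (sP s0).1.
  have tk0 : 0 < t + k by exact: addr_gt0.
  rewrite (L2eq_norm (H10_L2_wderiv H1) (L2_scale _ (L2_sub (Lh _ tk0) (Lh _ t0))) E1).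
  apply: (quot_norm_le (u := fun s => wderiv L (h s)) (u' := fun s => wderiv L (y s))) k0 _ _ => s /pos[s0 sab].
    by split; [exact: Lh|exact: (sol_calL_diff L_gt0 a_Linf sol s0)].
  by have := B2 s sab; rewrite ger0_norm ?L2norm_ge0.
rewrite addrC; apply: sq => //.
apply: (quot_norm_le (u := y) (u' := yt)) k0 _ _ => s /pos[s0 sab].
  by split; [exact/H10_L2/sH|exact: (sol_diff sol)].
by have := B1 s sab; rewrite ger0_norm ?L2norm_ge0.
Qed.

Lemma sol_V_continuous t : 0 < t -> {for t, continuous (fun s => V (y s) (yt s))}.
Proof.
move=> t0; have [c1 c2] := sC t0; apply: lyapunov_cvg => //; last exact: sH.
by near=> s; apply: sH; near: s; exact: near_gt0.
Unshelve. all: by end_near. Qed.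

Lemma sol_Dis_continuous t : 0 < t -> {for t, continuous (fun s => Dis (y s) (yt s))}.
Proof.
move=> t0; have [c1 c2] := sC t0.
have H1 := cvgL2_ip c1 c1; have H2 := cvgL2_ip c2 c2.
by apply: cvgB; apply: cvgM; [exact: cvg_cst|exact: H2|exact: cvg_cst|exact: H1].
Qed.

Lemma quot_V_derive k t : 0 < k -> 0 < t ->
  derivable (fun s => V (uk k s) (wk k s)) t 1 /\
  'D_1 (fun s => V (uk k s) (wk k s)) t <= Dis (uk k t) (wk k t).
Proof.
move=> k0 t0; have [d1' d2'] := quot_diff k0 t0.
apply: (lyapunov_derive L_gt0 a_Linf p_Linf q_Linf diss _ (quot_poisson k0 t0)) => //.
near=> s; have s0 : 0 < s by near: s; exact: near_gt0.
by have [? _ ? _] := quot_H10 k0 s0.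
Unshelve. all: by end_near. Qed.

Lemma quot_Dis_continuous k t : 0 < k -> 0 < t -> {for t, continuous (fun s => Dis (uk k s) (wk k s))}.
Proof.
move=> k0 t0; have [D1 D2] := quot_diff k0 t0; have [H1 _ H2 _] := quot_H10 k0 t0.
have c (f : R -> R -> R) f' : L2 L (f t) -> diffL2 L t f f' -> {for t, continuous (fun s => ip L (f s) (f s))}.
  move=> Lf df; apply/differentiable_continuous/derivable1_diffP.
  by case: (diffL2_ip Lf Lf df df).
have C1 := c _ _ (H10_L2_wderiv H1) D1; have C2 := c _ _ (H10_L2 H2) D2.
by apply: cvgB; apply: cvgM; [exact: cvg_cst|exact: C1|exact: cvg_cst|exact: C2].
Qed.

Lemma sol_dissipation B phi : 0 < B -> test_fun `]0, B[ phi -> (forall t, 0 <= phi t) ->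
  - ip B (fun t => V (y t) (yt t)) (phi^`())%classic <= ip B (fun t => Dis (y t) (yt t)) phi.
Proof.
move=> B0 tphi phi0; have tphi' := test_fun_derive B0 tphi.
have n0 n : 0 < n.+1%:R^-1 :> R by rewrite invr_gt0.
have n1 n : 0 < (n.+1%:R^-1 : R) <= 1 by apply/andP; split; [rewrite invr_gt0|rewrite invf_le1// ler1n].
pose Vn n t := V (uk n.+1%:R^-1 t) (wk n.+1%:R^-1 t).
pose Dn n t := Dis (uk n.+1%:R^-1 t) (wk n.+1%:R^-1 t).
have cV n t : 0 < t -> {for t, continuous (Vn n)}.
  move=> t0; apply/differentiable_continuous/derivable1_diffP.
  by have [] := quot_V_derive (n0 n) t0.
have cD n t : 0 < t -> {for t, continuous (Dn n)} by move=> t0; exact: quot_Dis_continuous.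
(* Both limits are combined in one nonnegative sequence, so that the inequality survives. *)
have key n : 0 <= ip B (Dn n) phi + ip B (Vn n) (phi^`())%classic.
  rewrite addrC -[ip B (Vn n) _]opprK addrC subr_ge0.
  apply: (dist_le_of_derive (G' := fun t => 'D_1 (Vn n) t)) => //.
  - by move=> t t0; apply: derivableP; have [] := quot_V_derive (n0 n) t0.
  - by move=> t t0; have [] := quot_V_derive (n0 n) t0.
  - exact: cD.
have cvV : ip B (Vn n) (phi^`())%classic @[n --> \oo] --> ip B (fun t => V (y t) (yt t)) (phi^`())%classic.
  apply: (ip_continuous_cvg B0 tphi' cV); first exact: sol_V_continuous.
    move=> al be a0; have [M HM] := quot_bound be a0.
    exists (C5 * (2^-1 * (M + M))) => n t tab; have [b1 b2] := HM _ _ (n1 n) tab.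
    have t0 : 0 < t by case/andP: tab => alt _; exact: lt_le_trans alt.
    have [H1 _ H2 _] := quot_H10 (n0 n) t0; have H2' := H10_L2 H2.
    apply: (le_trans (V_bound H1 H2')); rewrite (energyE (H10_L2_wderiv H1) H2') !L2norm_sqr.
    by apply: ler_wpM2l => //; apply: ler_wpM2l => //; exact: lerD.
  move=> t t0; have [c1 c2] := quot_cvg t0.
  apply: lyapunov_cvg => //; last exact: sH.
  by apply: nearW => n; have [] := quot_H10 (n0 n) t0.
have cvD : ip B (Dn n) phi @[n --> \oo] --> ip B (fun t => Dis (y t) (yt t)) phi.
  apply: (ip_continuous_cvg B0 tphi cD); first exact: sol_Dis_continuous.
    move=> al be a0; have [M HM] := quot_bound be a0.
    exists (d1 * M + d2 * M) => n t tab; have [b1 b2] := HM _ _ (n1 n) tab.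
    rewrite /Dn mulNr -opprD normrN ger0_norm; last by rewrite addr_ge0// mulr_ge0// ip_ge0.
    by rewrite lerD// ler_wpM2l.
  move=> t t0; have [c1 c2] := quot_cvg t0.
  have H1 := cvgL2_ip c1 c1; have H2 := cvgL2_ip c2 c2.
  by apply: cvgB; apply: cvgM; [exact: cvg_cst|exact: H1|exact: cvg_cst|exact: H2].
have cv : ip B (Dn n) phi + ip B (Vn n) (phi^`())%classic @[n --> \oo] -->
    ip B (fun t => Dis (y t) (yt t)) phi + ip B (fun t => V (y t) (yt t)) (phi^`())%classic.
  exact: cvgD cvD cvV.
have : 0 <= ip B (fun t => Dis (y t) (yt t)) phi + ip B (fun t => V (y t) (yt t)) (phi^`())%classic.
  by apply: (cvgr_to_ge cv); apply: nearW => n; exact: key.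
by rewrite -[X in _ + X]opprK subr_ge0.
Qed.

End distributional_dissipation.

(** * Admissible weights *)

Section weights.
Context {R : realType}.
Variables (L x0 x1 : R).
Hypotheses (L_gt0 : 0 < L) (x0_ge0 : 0 <= x0) (x0_lt_x1 : x0 < x1) (x1_le_L : x1 <= L).

(* With theta a smooth step from 0 at x0 to 1 at x1, q = x - L theta and p = (L / 2) theta' give
   p + q' / 2 = 1 / 2 identically. *)
Lemma admissible_exists : exists (q p : R -> R) (dq dp : R), admissible L x0 x1 q p dq dp.
Proof.
have l0 : 0 < x1 - x0 by rewrite subr_gt0.
have [eta [teta eta1]] := unit_mass_test l0; have seta := test_fun_smooth teta.
(* Translation of a bump from ]0, x1 - x0[ to ]x0, x1[, written in the affine form that
   [smooth_affine] expects. *)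
pose b (x : R) := eta (1 * x + - x0); pose th (x : R) := prim (x1 - x0) eta (1 * x + - x0).
have sb : smooth b by exact: smooth_affine.
have dth (x : R) : is_derive x 1 th (b x).
  have sh : is_derive x 1 (fun x : R => 1 * x + - x0) (1 : R).
    by apply: is_derive_eq; rewrite /GRing.scale/=; ring.
  have := is_derive1_comp (g := fun x : R => 1 * x + - x0)
    (prim_test_is_derive l0 (1 * x + - x0) teta) sh.
  by rewrite mulr1.
have sth : smooth th := smooth_antiderivative sb dth.
have did (x : R) : is_derive x 1 (fun x : R => x) (cst 1 x) by exact: is_derive_id.
have sid : smooth (fun x : R => x) := @smooth_antiderivative R _ _ (@smooth_cst R 1) did.
pose q := (fun x : R => x) + (- L) *: th; pose p := (L / 2) *: b.
have sq : smooth q by exact: (@smooth_add _ (fun x => x) _ sid (@smooth_scale _ (- L) _ sth)).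
have sp : smooth p by exact: smooth_scale.
have [Cq Dq] := smooth_C2I L_gt0 sq; have [Cp _] := smooth_C2I L_gt0 sp.
have dq x : 0 <= x <= L -> derivI L q x = 1 - L * b x.
  move=> xL; rewrite Dq// derive1E.
  have -> : 'D_1 q x = 1 + (- L) *: b x.
    by have := is_deriveD (is_derive_id x (1 : R)) (is_deriveZ (- L) (dth x)); case.
  by rewrite /GRing.scale/= mulNr.
have b0 x : x \in `[0, x0] \/ x \in `[x1, L] -> 0 <= x <= L /\ b x = 0.
  move=> H; split.
    case: H; rewrite in_itv/= => /andP[h1 h2]; apply/andP; split => //.
      by rewrite (le_trans h2)// (le_trans _ x1_le_L)// ltW.
    by rewrite (le_trans _ h1)// (le_trans x0_ge0)// ltW.
  apply: (test_fun_out teta); rewrite /= in_itv/= mul1r => /andP[h1 h2].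
  by case: H; rewrite in_itv/= => /andP[h3 h4]; lra.
have th0 : th 0 = 0 by apply: prim0; rewrite mulr0 add0r oppr_le0.
have thL : th L = 1 by rewrite /th primL// mul1r lerD2r.
(* q' = 1 outside ]x0, x1[ allows dq = 1, and 1 / 4 lies below both dq / 2 and the constant value 1
   / 2 of p + q' / 2. *)
exists q, p, 1, 4^-1; split => //; split.
- by rewrite -[q 0]/(0 + - L * th 0) th0; lra.
- by rewrite -[q L]/(L + - L * th L) thL; lra.
- exact: ltr01.
- by move=> x /b0[xL bx]; rewrite dq// bx mulr0 subr0.
- by move=> x /b0[_ bx]; rewrite -[p x]/(L / 2 * b x) bx mulr0.
- by apply/andP; split; lra.
- move=> x; rewrite in_itv/= => /andP[h1 h2].
  rewrite dq; last by rewrite (le_trans x0_ge0)// (le_trans h2).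
  rewrite -[p x]/(L / 2 * b x); lra.
Qed.

End weights.

(** The dissipation is at least min(d1, d2) (m + w), and m + w >= 2 V / C; the factor 2 of [gamma]
    comes from the 1 / 2 in the energy. *)
Lemma decay_algebra (R : realFieldType) (d1 d2 C V m w : R) : 0 < C -> 0 <= m -> 0 <= w ->
  0 <= d1 -> 0 <= d2 -> V <= C * (2^-1 * (m + w)) ->
  - d1 * m - d2 * w <= - (2 * Num.min d1 d2 / C) * V.
Proof.
move=> C0 m0 w0 d10 d20 VE; set mu := Num.min d1 d2.
have mu0 : 0 <= mu by rewrite le_min d10.
have mu1 : mu * m <= d1 * m by rewrite ler_wpM2r// ge_min lexx.
have mu2 : mu * w <= d2 * w by rewrite ler_wpM2r// ge_min lexx orbT.
have g0 : 0 <= 2 * mu / C by rewrite divr_ge0 ?mulr_ge0// ltW.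
have := ler_wpM2l g0 VE.
have -> : 2 * mu / C * (C * (2^-1 * (m + w))) = mu * m + mu * w by field; rewrite gt_eqF.
by rewrite mulNr; lra.
Qed.

Theorem mainTheorem1 (R : realType) (L : R) (a : R -> R) (x0 x1 amin : R)
  (L_gt0 : 0 < L) (a_Linf : Linf L a) (a_ge0 : ae_on L (fun x => 0 <= a x))
  (x0_ge0 : 0 <= x0) (x0_lt_x1 : x0 < x1) (x1_le_L : x1 <= L)
  (amin_gt0 : 0 < amin)
  (a_ge_amin : ae_on L (fun x => x \in `]x0, x1[ -> amin <= a x)) :
  (exists (q p : R -> R) (dq dp : R), admissible L x0 x1 q p dq dp) /\
  forall (q p : R -> R) (dq dp : R), admissible L x0 x1 q p dq dp ->
  forall e1 : R, 0 < e1 ->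
    e1 < Num.min (1 / (2 * C3c L a q p amin dp)) (qpnorm L q p)^-1 ->
  let V := lyapunov L a q p amin e1 in
  let deltaM := 1 - e1 * qpnorm L q p in
  let delta1 := e1 * dp / 2 in
  let delta2 := Num.min (amin / 2) (e1 * dq / 2) in
  (0 < deltaM /\
   exists C5 : R, 0 < C5 /\
     forall f g : R -> R, H10 L f -> L2 L g ->
       deltaM * energy L f g <= V f g <= C5 * energy L f g) /\
  (forall C5 : R, 0 < C5 ->
     (forall f g : R -> R, H10 L f -> L2 L g -> V f g <= C5 * energy L f g) ->
   let gamma := 2 * Num.min delta1 delta2 / C5 in
   forall y0 y1 : R -> R, H10 L y0 -> L2 L y1 ->
   forall y yt : R -> R -> R, weak_solution L a y0 y1 y yt ->
   let Vt := fun t : R => V (y t) (yt t) in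
   let D := fun t : R =>
     - delta1 * \int[lebesgue_measure]_(x in `]0, L[) (wderiv L (y t) x ^+ 2)
     - delta2 * \int[lebesgue_measure]_(x in `]0, L[) (yt t x ^+ 2) in
   {within `[0, +oo[, continuous Vt} /\
   dist_le (dist_deriv (dist_of Vt)) (dist_of D) /\
   dist_le (dist_of D) (dist_of (fun t => - gamma * Vt t))).
Proof.
split; first exact: admissible_exists.
move=> q p dq dp adm e1 e1_gt0 e1_lt V deltaM delta1 delta2.
have [dM [C [C0 HC]]] := lyapunov_bounds L_gt0 a_Linf amin_gt0 adm e1_gt0 e1_lt.
split; first by split => //; exists C.
move=> C5 C50 VC5 gamma y0 y1 _ _ y yt sol Vt D.
have [Lq _ Lp _] := C2_functions_Linf adm.
have [_ _ [_ _ dq0 _] [_ /andP[dp0 _] _]] := adm.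
have d10 : 0 <= delta1 by apply/ltW/divr_gt0 => //; exact: mulr_gt0.
have d20 : 0 <= delta2 by rewrite le_min !ltW// divr_gt0// mulr_gt0.
have diss := dissipation L_gt0 a_Linf a_ge0 x0_ge0 x0_lt_x1 x1_le_L amin_gt0 a_ge_amin adm e1_gt0 e1_lt.
(* The domination of the quotients uses the constant C of (i), V being nonnegative since [deltaM]
   is; the given C5 enters through the rate [gamma]. *)
have Vbd f g : H10 L f -> L2 L g -> `|V f g| <= C * energy L f g.
  move=> Hf Lg; have /andP[V0 V1] := HC f g Hf Lg.
  rewrite ger0_norm//; apply: le_trans V0; apply: mulr_ge0; first exact: ltW.
  exact: energy_ge0.
have cV t : 0 < t -> {for t, continuous Vt} by exact: (sol_V_continuous L_gt0 a_Linf Lp Lq sol).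
have cD t : 0 < t -> {for t, continuous D} by exact: (sol_Dis_continuous (d1 := delta1) (d2 := delta2) L_gt0 sol).
have DV t : 0 < t -> D t <= - gamma * Vt t.
  move=> t0; have Hy := sol_H10 sol (ltW t0); have Lyt := sol_L2 sol (ltW t0).
  apply: decay_algebra => //; [exact: ip_ge0|exact: ip_ge0|].
  by have := VC5 _ _ Hy Lyt; rewrite (energyE (H10_L2_wderiv Hy) Lyt) !L2norm_sqr.
split; [|split].
- apply/subspace_continuousP => t; rewrite /= in_itv/= andbT => t0.
  have [c1 c2] := sol_cvg L_gt0 sol t0.
  have Hy : \forall s \near within `[0, +oo[ (nbhs t), H10 L (y s).
    by apply: nearW_within => s; rewrite /= in_itv/= andbT; exact: (sol_H10 sol).
  have Vc : V (y s) (yt s) @[s --> within `[0, +oo[ (nbhs t)] --> V (y t) (yt t).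
    exact: (lyapunov_cvg L_gt0 a_Linf Lp Lq _ Hy (sol_H10 sol t0) c2 c1).
  exact: Vc.
- move=> phi /test_fun_halfline[B [B0 tphi]] phi0.
  have tphi' := test_fun_derive B0 tphi.
  rewrite /dist_deriv (dist_ofE (B := B)); last by move=> x /negP xB; exact: (test_fun_out tphi').
  rewrite (dist_ofE (B := B)); last by move=> x /negP xB; exact: (test_fun_out tphi).
  exact: (sol_dissipation L_gt0 a_Linf Lp Lq sol diss Vbd d10 d20 (ltW C0)).
- move=> phi /test_fun_halfline[B [B0 tphi]] phi0.
  rewrite !(dist_ofE (B := B)); try by move=> x /negP xB; exact: (test_fun_out tphi).
  apply: (ip_le_test tphi) => // t t0.
  by apply: continuousM; [exact: cst_continuous|exact: cV].
Qed.
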